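(* Let $(R,\mathfrak m,k)$ be a singular local ring, let $N$ be an $R$-module and $M$ an $R$-submodule with $N\supseteq M\supseteq\mathfrak m N$, and set $$s=\operatorname{rank}_k(N/M).$$ If $N$ is finite and its projective dimension $\operatorname{pd}_R N=p$ is finite, then for each $n\in\mathbb Z$ there is an equality $$\mu^n_R(M)=\sum_{i=0}^{p}\mu^{n+i}_R(R)\,\beta^R_i(N)+s\,\beta^R_{n-1}(k).$$
   Context: A local ring $(R,\mathfrak m,k)$ is a commutative noetherian local ring $R$ with maximal ideal $\mathfrak m$ and residue field $k=R/\mathfrak m$. It is called singular when it is not a regular local ring. A finite module is a finitely generated module. The $n$-th Bass number of an $R$-module $M$ is $\mu^n_R(M)=\operatorname{rank}_k\operatorname{Ext}^n_R(k,M)$ and its $n$-th Betti number is $\beta^R_n(M)=\operatorname{rank}_k\operatorname{Ext}^n_R(M,k)$, where $\operatorname{rank}_k$ is the dimension of a $k$-vector space; both are $0$ for $n<0$. *)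

(* Defs.v *)
From HB Require Import structures.
From mathcomp Require Import all_boot all_algebra.
From mathcomp Require Import ring_quotient freeg.
From mathcomp Require Import boolp classical_sets functions.
From mathcomp Require Import constructive_ereal.

Set Implicit Arguments.
Unset Strict Implicit.
Unset Printing Implicit Defensive.

Import GRing.Theory.
Local Open Scope ring_scope.
Local Open Scope quotient_scope.

Section SubQuotient.
Context {R : nzRingType} {V : lmodType R} (S : submodClosed V).

Record submod := Submod { submod_val : V; _ : submod_val \in S }.

HB.instance Definition _ := [isSub for submod_val].
HB.instance Definition _ := [Choice of submod by <:].
HB.instance Definition _ := [SubChoice_isSubLmodule of submod by <:].

(* [Quotient.quot] expects a [zmodClosed], which [submodClosed] does not
   inherit from in the library. *)
Definition quot_pred : {pred V} := fun x => x \in S.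

Fact quot_pred_zmod_closed : zmod_closed quot_pred.
Proof. exact: GRing.submod_closedB (submodClosedP S). Qed.

HB.instance Definition _ :=
  GRing.isZmodClosed.Build V quot_pred quot_pred_zmod_closed.

Definition quotmod := Quotient.quot quot_pred.

HB.instance Definition _ := GRing.Zmodule.on quotmod.

Let pi (x : V) : quotmod := \pi_(Quotient.quot quot_pred) x.

Definition quotmod_scale (a : R) (x : quotmod) : quotmod := pi (a *: repr x).

Let piK (x : quotmod) : pi (repr x) = x.
Proof. exact: reprK. Qed.

Let piD x y : pi (x + y) = pi x + pi y.
Proof. exact: raddfD. Qed.

Let piP x y : x - y \in S -> pi x = pi y.
Proof.
move=> xyS; apply/eqP; rewrite /pi.
by rewrite -(@Quotient.idealrBE _ quot_pred).
Qed.

Let repr_piB x : repr (pi x) - x \in S.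
Proof.
have := Quotient.idealrBE quot_pred (repr (pi x)) x.
by rewrite reprK eqxx.
Qed.

Let quotmod_scaleE a x : quotmod_scale a (pi x) = pi (a *: x).
Proof. by apply: piP; rewrite -scalerBr rpredZ // repr_piB. Qed.

Fact quotmod_scaleA a b x :
  quotmod_scale a (quotmod_scale b x) = quotmod_scale (a * b) x.
Proof. by rewrite -[x]piK !quotmod_scaleE scalerA. Qed.

Fact quotmod_scale1 : left_id 1 quotmod_scale.
Proof. by move=> x; rewrite -[x]piK quotmod_scaleE scale1r. Qed.

Fact quotmod_scaleDr : right_distributive quotmod_scale +%R.
Proof.
move=> a x y; rewrite -[x]piK -[y]piK.
by rewrite -piD !quotmod_scaleE scalerDr piD.
Qed.

Fact quotmod_scaleDl x : {morph quotmod_scale^~ x : a b / a + b}.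
Proof.
by move=> a b; rewrite -[x]piK !quotmod_scaleE scalerDl piD.
Qed.

HB.instance Definition _ := GRing.Zmodule_isLmodule.Build R quotmod
  quotmod_scaleA quotmod_scale1 quotmod_scaleDr quotmod_scaleDl.

End SubQuotient.

Arguments submod {R V} S.
Arguments quotmod {R V} S.

Definition finite_module (R : nzRingType) (V : lmodType R) : Prop :=
  exists n (g : 'I_n -> V),
    forall x, exists a : 'I_n -> R, x = \sum_(i < n) a i *: g i.

Section LocalRings.
Context {R : comNzRingType}.

Definition noetherian : Prop :=
  forall I : submodClosed R^o, finite_module (submod I).

(* [idealr R] is the type of proper ideals of [R]. *)
Definition maximal_ideal (m : idealr R) : Prop :=
  forall I : idealr R, {subset m <= I} -> {subset I <= m}.

Definition local_ring (m : idealr R) : Prop :=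
  [/\ noetherian, maximal_ideal m &
      forall I : idealr R, maximal_ideal I -> I =i m].

Definition prime_chain (d : nat) (p : nat -> prime_idealr R) : Prop :=
  forall i, (i < d)%N ->
    {subset p i <= p i.+1} /\ exists x, x \in p i.+1 /\ x \notin p i.

Definition krull_dim (d : nat) : Prop :=
  (exists p, prime_chain d p) /\ (forall p, ~ prime_chain d.+1 p).

Definition regular_local (m : idealr R) : Prop :=
  local_ring m /\
  exists d, krull_dim d /\
    exists g : 'I_d -> R, forall x,
      x \in m <-> exists a : 'I_d -> R, x = \sum_(i < d) a i * g i.

Definition singular_local (m : idealr R) : Prop :=
  local_ring m /\ ~ regular_local m.

Definition ideal_mul (I : {pred R}) (V : lmodType R) (x : V) : Prop :=
  exists n (a : 'I_n -> R) (v : 'I_n -> V),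
    (forall i, a i \in I) /\ x = \sum_(i < n) a i *: v i.

End LocalRings.

Arguments noetherian R : clear implicits.
Arguments krull_dim R d : clear implicits.

Section ResidueField.
Context {R : comNzRingType} (m : idealr R).

Definition residue := {ideal_quot m}.

HB.instance Definition _ := GRing.ComNzRing.on residue.

Definition to_residue (a : R) : residue := \pi_({ideal_quot m}) a.

Fact to_residue_zmod_morphism : zmod_morphism to_residue.
Proof. exact: raddfB. Qed.

Fact to_residue_monoid_morphism : monoid_morphism to_residue.
Proof. by split=> [|x y]; rewrite /to_residue ?rmorph1 ?rmorphM. Qed.

HB.instance Definition _ :=
  GRing.isZmodMorphism.Build R residue to_residue to_residue_zmod_morphism.
HB.instance Definition _ :=
  GRing.isMonoidMorphism.Build R residue to_residue to_residue_monoid_morphism.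

Definition residue_scale (a : R) (x : residue) : residue := to_residue a * x.

Fact residue_scaleA a b x :
  residue_scale a (residue_scale b x) = residue_scale (a * b) x.
Proof. by rewrite /residue_scale rmorphM mulrA. Qed.

Fact residue_scale1 : left_id 1 residue_scale.
Proof. by move=> x; rewrite /residue_scale rmorph1 mul1r. Qed.

Fact residue_scaleDr : right_distributive residue_scale +%R.
Proof. by move=> a x y; rewrite /residue_scale mulrDr. Qed.

Fact residue_scaleDl x : {morph residue_scale^~ x : a b / a + b}.
Proof. by move=> a b; rewrite /residue_scale rmorphD mulrDl. Qed.

HB.instance Definition _ := GRing.Zmodule_isLmodule.Build R residue
  residue_scaleA residue_scale1 residue_scaleDr residue_scaleDl.

(* An [R]-module [V] carries at most one structure of vector space over
   [k = R / m] inducing its [R]-module structure, and it does so precisely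
   when [m V = 0]. [has_rank d V] says that [V], with this structure, is
   isomorphic to [k ^ d]; as in [Vector.axiom], this is dimension [d]. *)
Definition has_rank (d : nat) (V : lmodType R) : Prop :=
  exists f : {additive 'rV[residue]_d -> V},
    bijective f /\ forall a x, f (to_residue a *: x) = a *: f x.

(* [+oo] stands for an infinite rank, and for [V] not killed by [m]. *)
Definition rank (V : lmodType R) : \bar int :=
  if pselect (exists d, has_rank d V) is left h
  then (Posz (projT1 (cid h)))%:E else +oo%E.

End ResidueField.

Section Resolutions.
Context {R : nzRingType}.

Definition surjective (A B : Type) (f : A -> B) : Prop :=
  forall y, exists x, f x = y.

Definition projective (P : lmodType R) : Prop :=
  forall (U V : lmodType R) (g : {linear U -> V}) (f : {linear P -> V}),
    surjective g -> exists h : {linear P -> U}, forall x, g (h x) = f x.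

(* [... -> P_2 -> P_1 -> P_0 -> M -> 0], with [res_diff n : P_n.+1 -> P_n]. *)
Record projective_resolution (M : lmodType R) := ProjectiveResolution {
  res_mod :> nat -> lmodType R;
  res_diff : forall n, {linear res_mod n.+1 -> res_mod n};
  res_aug : {linear res_mod 0 -> M};
  res_projective : forall n, projective (res_mod n);
  res_aug_surj : surjective res_aug;
  res_exact0 : forall x, res_aug x = 0 <-> exists y, res_diff 0 y = x;
  res_exactS : forall n x,
    res_diff n x = 0 <-> exists y, res_diff n.+1 y = x
}.

Definition pd_le (M : lmodType R) (p : nat) : Prop :=
  exists P : projective_resolution M, forall n, (p < n)%N -> forall x : P n, x = 0.

(* With this convention the zero module has projective dimension [0]. *)
Definition has_pd (M : lmodType R) (p : nat) : Prop :=
  pd_le M p /\ forall q, (q < p)%N -> ~ pd_le M q.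

End Resolutions.

(* A functorial resolution, so that [Ext] needs no choice: [P_0] is free on the
   underlying set of [M], and [P_n.+1] is free on the underlying set of the
   kernel of [P_n -> P_n.-1] (of [P_0 -> M] for [n = 0]). *)
Section StandardResolution.
Context {R : nzRingType}.

Section FreeCover.
Context (M : lmodType R).

Definition free_cover : Type := {freeg M / R}.

HB.instance Definition _ := GRing.Lmodule.on free_cover.

Definition free_cover_map : free_cover -> M := fglift idfun.

Fact freeg_lift_linear (K : choiceType) (f : K -> M) :
  linear (fglift f : {freeg K / R} -> M).
Proof.
pose F := GRing.isZmodMorphism.Build _ _ (fglift f) (lift_is_additive f).
pose L : {additive {freeg K / R} -> M} := HB.pack (fglift f) F.
have sumE (r : seq K) (g : K -> {freeg K / R}) :
    fglift f (\sum_(x <- r) g x) = \sum_(x <- r) fglift f (g x).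
  exact: (raddf_sum L).
move=> a x y; rewrite -[LHS]/(L _) raddfD; congr (_ + _).
rewrite [a *: x]/(fgscale a x) [L _]sumE -[in RHS](freeg_sumE x) [in RHS]sumE.
by rewrite scaler_sumr; apply: eq_bigr => z _; rewrite !liftU scalerA.
Qed.

HB.instance Definition _ := GRing.isLinear.Build R free_cover M *:%R
  free_cover_map (freeg_lift_linear _).

Definition free_cover_ker : {pred free_cover} := fun x => free_cover_map x == 0.

Fact free_cover_ker_submod_closed : GRing.submod_closed free_cover_ker.
Proof.
split=> [|a x y]; rewrite -!topredE /= /free_cover_ker ?linear0 //.
by move=> /eqP x0 /eqP y0; rewrite linearP /= x0 y0 scaler0 addr0.
Qed.

HB.instance Definition _ := GRing.isSubmodClosed.Build R free_cover
  free_cover_ker (GRing.submod_closed_semi free_cover_ker_submod_closed).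

Definition syzygy : lmodType R := submod free_cover_ker.

End FreeCover.

Lemma free_cover_projective (M : lmodType R) : projective (free_cover M).
Proof.
move=> U V g f g_surj.
have [h hE] := choice (fun x : M => g_surj (f << x >>)).
pose H : free_cover M -> U := fglift h.
pose HL := GRing.isLinear.Build R (free_cover M) U *:%R H (freeg_lift_linear h).
pose L := HB.pack_for {linear free_cover M -> U} H HL.
exists L => x.
rewrite -(freeg_sumE x) !linear_sum; apply: eq_bigr => z _.
have -> : << coeff z x *g z >> = coeff z x *: (<< z >> : {freeg M / R}).
  by apply/eqP/freeg_eqP => y; rewrite coeffZ !coeffU mul1r.
by rewrite !linearZ /= /H liftU scale1r hE.
Qed.

Section Standard.
Context (M : lmodType R).

Definition std_syzygy (n : nat) : lmodType R := iter n syzygy M.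

Definition std_mod (n : nat) : lmodType R := free_cover (std_syzygy n).

Definition std_diff (n : nat) (x : std_mod n.+1) : std_mod n :=
  submod_val (free_cover_map x : syzygy (std_syzygy n)).

Fact std_diff_linear n : linear (@std_diff n).
Proof.
by move=> a x y; rewrite /std_diff linearP.
Qed.

HB.instance Definition _ n :=
  GRing.isLinear.Build R (std_mod n.+1) (std_mod n) *:%R (@std_diff n)
    (std_diff_linear (n := n)).

Lemma free_cover_surj (V : lmodType R) : surjective (@free_cover_map V).
Proof.
by move=> x; exists << x >>; rewrite /free_cover_map liftU scale1r.
Qed.

Lemma std_exact (n : nat) (x : std_mod n) :
  free_cover_map (x : free_cover (std_syzygy n)) = 0 <->
  exists y, std_diff (n := n) y = x.
Proof.
split=> [x0|[y <-]].
  have xK : x \in @free_cover_ker (std_syzygy n) by rewrite -topredE /=; apply/eqP.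
  have [y yE] := free_cover_surj (Submod xK : syzygy (std_syzygy n)).
  by exists y; rewrite /std_diff yE.
by apply/eqP; exact: (valP (free_cover_map y : syzygy (std_syzygy n))).
Qed.

Lemma std_diff_eq0 (n : nat) (x : std_mod n.+1) :
  std_diff x = 0 <-> free_cover_map (x : free_cover (std_syzygy n.+1)) = 0.
Proof.
rewrite /std_diff; split=> [x0|->]; last by [].
exact: val_inj.
Qed.

Definition std_resolution : projective_resolution M.
Proof.
refine (@ProjectiveResolution R M std_mod
  (fun n => @std_diff n : {linear std_mod n.+1 -> std_mod n})
  (@free_cover_map M : {linear std_mod 0 -> M}) _ _ _ _).
- by move=> n; exact: free_cover_projective.
- exact: free_cover_surj.
- exact: std_exact.
- by move=> n x; rewrite -std_exact; exact: std_diff_eq0.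
Defined.

End Standard.
End StandardResolution.

Section Ext.
Context {R : comNzRingType}.

Definition hom_pred (U V : lmodType R) : {pred U -> V} :=
  fun f => `[< linear f >].

Fact hom_submod_closed (U V : lmodType R) : GRing.submod_closed (@hom_pred U V).
Proof.
split=> [|a f g]; rewrite -!topredE /= /hom_pred.
  by apply/asboolP => a x y; rewrite -[RHS]/(a *: (0 : V) + 0) scaler0 addr0.
move=> /asboolP fL /asboolP gL; apply/asboolP => b x y.
rewrite -[LHS]/(a *: f (b *: x + y) + g (b *: x + y)) fL gL.
rewrite -[RHS]/(b *: (a *: f x + g x) + (a *: f y + g y)).
by rewrite !scalerDr !scalerA mulrC addrACA.
Qed.

HB.instance Definition _ (U V : lmodType R) :=
  GRing.isSubmodClosed.Build R (U -> V) (@hom_pred U V)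
    (GRing.submod_closed_semi (hom_submod_closed U V)).

Definition Hom (U V : lmodType R) : lmodType R := submod (@hom_pred U V).

Definition hom_fun (U V : lmodType R) (f : Hom U V) : U -> V := submod_val f.

Section Cohomology.
Context (M : lmodType R) (P : projective_resolution M) (N : lmodType R).

Definition cocycle_pred (n : nat) : {pred Hom (P n) N} :=
  fun f => `[< forall y, hom_fun f (res_diff P n y) = 0 >].

Fact cocycle_submod_closed n : GRing.submod_closed (@cocycle_pred n).
Proof.
split=> [|a f g]; rewrite -!topredE /= /cocycle_pred.
  by apply/asboolP.
move=> /asboolP f0 /asboolP g0; apply/asboolP => y.
rewrite -[LHS]/(a *: hom_fun f (res_diff P n y) + hom_fun g (res_diff P n y)).
by rewrite f0 g0 scaler0 addr0.
Qed.

HB.instance Definition _ n :=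
  GRing.isSubmodClosed.Build R (Hom (P n) N) (@cocycle_pred n)
    (GRing.submod_closed_semi (@cocycle_submod_closed n)).

Definition cocycles (n : nat) : lmodType R := submod (@cocycle_pred n).

Definition coboundary_pred (n : nat) : {pred cocycles n} :=
  match n return {pred cocycles n} with
  | 0 => fun f => f == 0
  | n'.+1 => fun f => `[< exists g : Hom (P n') N,
      forall x, hom_fun (submod_val f) x = hom_fun g (res_diff P n' x) >]
  end.

Fact coboundary_submod_closed n : GRing.submod_closed (@coboundary_pred n).
Proof.
case: n => [|n]; split=> [|a f g]; rewrite -!topredE //=.
- by move=> /eqP -> /eqP ->; rewrite scaler0 addr0.
- by apply/asboolP; exists 0 => x.
move=> /asboolP [f' fE] /asboolP [g' gE]; apply/asboolP.
exists (a *: f' + g') => x.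
rewrite -[LHS]/(a *: hom_fun (submod_val f) x + hom_fun (submod_val g) x).
by rewrite fE gE.
Qed.

HB.instance Definition _ n :=
  GRing.isSubmodClosed.Build R (cocycles n) (@coboundary_pred n)
    (GRing.submod_closed_semi (@coboundary_submod_closed n)).

Definition cohomology (n : nat) : lmodType R := quotmod (@coboundary_pred n).

End Cohomology.

Definition Ext (n : nat) (M N : lmodType R) : lmodType R :=
  cohomology (std_resolution M) N n.

Definition bass (m : idealr R) (n : int) (M : lmodType R) : \bar int :=
  if n is Posz i then rank m (Ext i (residue m) M) else 0%E.

Definition betti (m : idealr R) (n : int) (M : lmodType R) : \bar int :=
  if n is Posz i then rank m (Ext i M (residue m)) else 0%E.

End Ext.

(* Main.v *)
Require Import Defs.
From HB Require Import structures.
From mathcomp Require Import all_boot all_algebra.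
From mathcomp Require Import ring_quotient.
From mathcomp Require Import boolp functions.
From mathcomp Require Import constructive_ereal.
(* again, after functions, whose split and lift are not the ones on ordinals *)
From mathcomp Require Import fintype.
From mathcomp Require Import ring zify.
Set Implicit Arguments.
Unset Strict Implicit.
Unset Printing Implicit Defensive.
Import GRing.Theory.
Local Open Scope ring_scope.

(** Write [k = R / m], let [X] be a projective resolution of [k], and let [F] be the
    minimal free resolution of [N], with differentials [D j] and syzygies [syz j];
    it has length at most [p] by [pd_rank] and [F i] has rank [beta_i (N)] by
    [hdim_minimal]. The formula follows from the vanishing of three families of
    maps on cohomology.

    - [Ext (k, syz j.+1) -> Ext (k, F j)] is zero ([syz_val_zero]). Hence the long
      exact sequence of [0 -> syz j.+1 -> F j -> syz j -> 0] splits into short ones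
      ([hdim_zero_left]), and descending along [F] gives
      [mu^n (N) = \sum_i mu^(n+i) (R) beta_i (N)] ([hdim_syz]). It also gives
      [Hom (k, syz j) = 0] for [j > 0], hence the formula in negative degrees.
    - [Ext (k, N) -> Ext (k, N / M)] is zero when [R] is singular
      ([aug_cocyc_zero]). Hence [mu^n (M) = mu^n (N) + rank Ext^(n-1) (k, N / M)]
      ([hdim_zero_right]), and [N / M] is [k^s] ([power_maps], [hdim_power]).
    - [Ext (k, R) -> Ext (k, k)] is zero when [R] is singular
      ([singular_not_split]); the previous point rests on this one.

    The first two hold because [RHom (k, R)] is a complex of [k]-vector spaces and
    [RHom (k, N)] is its derived tensor product with [N], so that the image of
    [Ext (k, R) (x) Tor (k, N)] is all of [Ext (k, N)]. The proof constructs this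
    surjection by hand, with projective modules only. Each basis element of [F i]
    starts a sequence of maps [X -> X[l]] indexed by the bases of [F (i - l)], whose
    first term is the identity; the next term is a null-homotopy of the composite
    with the differential of [F], and it exists because that differential has
    coefficients in [m], which acts as zero on [k] ([almost_chain_step]). Composing
    these maps with cocycles in [Hom (X, R)] gives everything ([rep_exists]). By
    construction the image of such a composite under [D j] is a coboundary
    ([rep_step]), and when the cocycle is a coboundary modulo [m], so is the
    composite ([rep_null]).

    If the third map is not zero, then some syzygy of [k] has a free direct summand,
    and [R] is regular ([split_regular]), by induction on the least number [e] of
    generators of [m]. If a nonzero element is killed by [m], then it kills
    [m F] for every free module [F], hence the minimal syzygies of [k] of positive
    degree, which then have no free summand ([socle_null]). Otherwise [m] has a minimal generator [x] that is a
    nonzero divisor ([regular_elt_exists]); the reduction modulo [x] of a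
    resolution of [m] resolves [m / x m], the direct sum of [k] and [m / (x)], so
    some syzygy of [k] over [R / (x)] has a free summand as well
    ([split_cocycle_descent]). In the end [R] is a domain with a chain of [e] + 1
    primes, and there is no longer chain by Krull's height theorem
    ([krull_height]). *)

(** * Linear maps *)

Section LinearMaps.
Context {R : comNzRingType}.
Implicit Types U V W : lmodType R.

Definition bundle U V (f : U -> V) (fL : linear f) : {linear U -> V} :=
  HB.pack_for {linear U -> V} f (GRing.isLinear.Build R U V *:%R f fL).

Section Values.
Context {U V : lmodType R} {f : U -> V} (fL : linear f).

Lemma lin0 : f 0 = 0. Proof. exact: (linear0 (bundle fL)). Qed.
Lemma linD x y : f (x + y) = f x + f y.
Proof. exact: (linearD (bundle fL)). Qed.
Lemma linN x : f (- x) = - f x.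
Proof. exact: (linearN (bundle fL)). Qed.
Lemma linB x y : f (x - y) = f x - f y.
Proof. exact: (linearB (bundle fL)). Qed.
Lemma linZ a x : f (a *: x) = a *: f x.
Proof. by have := fL a x 0; rewrite lin0 !addr0. Qed.
Lemma lin_sum (I : Type) (r : seq I) (P : pred I) (F : I -> U) :
  f (\sum_(i <- r | P i) F i) = \sum_(i <- r | P i) f (F i).
Proof. exact: (linear_sum (bundle fL)). Qed.

End Values.

Lemma linear_id V : linear (fun x : V => x). Proof. by []. Qed.

Lemma linear_zero U V : linear (fun _ : U => 0 : V).
Proof. by move=> a x y; rewrite scaler0 addr0. Qed.

Lemma linear_comp U V W (f : U -> V) (g : V -> W) :
  linear f -> linear g -> linear (fun x => g (f x)).
Proof. by move=> fL gL a x y; rewrite fL gL. Qed.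

Lemma linear_add U V (f g : U -> V) :
  linear f -> linear g -> linear (fun x => f x + g x).
Proof. by move=> fL gL a x y; rewrite fL gL scalerDr addrACA. Qed.

Lemma linear_opp U V (f : U -> V) : linear f -> linear (fun x => - f x).
Proof. by move=> fL a x y; rewrite fL opprD scalerN. Qed.

Lemma linear_sub U V (f g : U -> V) :
  linear f -> linear g -> linear (fun x => f x - g x).
Proof. by move=> fL gL; apply: linear_add => //; apply: linear_opp. Qed.

Lemma linear_sum_fun U V (n : nat) (f : 'I_n -> U -> V) :
  (forall i, linear (f i)) -> linear (fun x => \sum_(i < n) f i x).
Proof.
move=> fL a x y; rewrite scaler_sumr -big_split; apply: eq_bigr => i _.
by rewrite fL.
Qed.

Lemma linear_scale U V a (f : U -> V) :
  linear f -> linear (fun x => a *: f x).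
Proof. by move=> fL b x y; rewrite fL scalerDr !scalerA mulrC. Qed.

Lemma linear_scaler U V (f : U -> R^o) (v : V) :
  linear f -> linear (fun x => f x *: v).
Proof. by move=> fL a x y; rewrite fL scalerDl -scalerA. Qed.

Lemma linear_mulmx n p (D : 'M[R]_(n, p)) : linear (fun x : 'rV[R]_n => x *m D).
Proof. by move=> a x y; rewrite mulmxDl scalemxAl. Qed.

Lemma linear_entry n (i : 'I_n) : linear (fun x : 'rV[R]_n => x 0 i : R^o).
Proof. by move=> a x y; rewrite !mxE. Qed.

Lemma linear_row V n (f : V -> 'rV[R]_n) :
  (forall i, linear (fun x => f x 0 i : R^o)) -> linear f.
Proof. by move=> fL a x y; apply/rowP => i; rewrite (fL i) !mxE. Qed.

Lemma linear_combination V n (v : 'I_n -> V) :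
  linear (fun x : 'rV[R]_n => \sum_i x 0 i *: v i).
Proof. by apply: linear_sum_fun => i; apply/linear_scaler/linear_entry. Qed.

Section Image.
Context {U V : lmodType R} (f : {linear U -> V}).

Definition im_pred : {pred V} := fun y => `[< exists x, f x = y >].

Fact im_pred_closed : GRing.submod_closed im_pred.
Proof.
split=> [|a y z]; rewrite -!topredE /= /im_pred.
  by apply/asboolP; exists 0; rewrite linear0.
move=> /asboolP[u <-] /asboolP[v <-].
by apply/asboolP; exists (a *: u + v); rewrite linearP.
Qed.

HB.instance Definition _ := GRing.isSubmodClosed.Build R V im_pred
  (GRing.submod_closed_semi im_pred_closed).

Definition im_mod : lmodType R := submod im_pred.

Lemma im_predP y : y \in im_pred <-> exists x, f x = y.
Proof. by rewrite -topredE /= /im_pred; split=> /asboolP. Qed.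

Fact mem_im x : f x \in im_pred. Proof. by apply/im_predP; exists x. Qed.

Definition to_im (x : U) : im_mod := Submod (mem_im x).

Lemma linear_to_im : linear to_im.
Proof. by move=> a x y; apply/val_inj; rewrite /= linearP. Qed.

End Image.

Lemma linear_submod V (S : submodClosed V) :
  linear (@submod_val R V S : submod S -> V).
Proof. by []. Qed.

(** [g] need not be onto: it maps onto its image, and [f] takes its values there. *)
Lemma projective_lift (P U V : lmodType R) (g : U -> V) (f : P -> V) :
  projective P -> linear g -> linear f ->
  (forall x, exists y, g y = f x) ->
  exists2 h : P -> U, linear h & forall x, g (h x) = f x.
Proof.
move=> projP gL fL fg; set G := bundle gL.
have fim x : f x \in im_pred G by apply/im_predP; exact: fg.
have f'L : linear ((fun x => Submod (fim x)) : P -> im_mod G).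
  by move=> a x y; apply/val_inj; rewrite /= fL.
have surjG : surjective (bundle (linear_to_im G)).
  move=> [y yG]; have /im_predP[x xy] := yG.
  by exists x; apply/val_inj; rewrite /= -xy.
have [h hE] := projP _ _ _ (bundle f'L) surjG.
exists h => [|x]; first exact: linearP.
by have := congr1 (@submod_val _ _ _) (hE x).
Qed.

Lemma projective_row n : projective 'rV[R]_n.
Proof.
move=> U V g f gsurj.
have [u uE] := choice (fun i : 'I_n => gsurj (f (delta_mx 0 i))).
exists (bundle (linear_combination u)) => x.
rewrite [X in f X]row_sum_delta !linear_sum; apply: eq_bigr => i _.
by rewrite !linearZ /= uE.
Qed.

Lemma projective_pair (P Q : lmodType R) :
  projective P -> projective Q -> projective (P * Q)%type.
Proof.
move=> projP projQ U V g f gsurj.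
have f1L : linear (fun x : P => f (x, 0)).
  move=> a x y; rewrite -linearP; congr (f _).
  by apply: injective_projections => //=; rewrite scaler0 addr0.
have f2L : linear (fun y : Q => f (0, y)).
  move=> a x y; rewrite -linearP; congr (f _).
  by apply: injective_projections => //=; rewrite scaler0 addr0.
have [h1 h1E] := projP _ _ g (bundle f1L) gsurj.
have [h2 h2E] := projQ _ _ g (bundle f2L) gsurj.
have hL : linear ((fun x => h1 x.1 + h2 x.2) : P * Q -> U).
  by move=> a x y; rewrite !linearP scalerDr addrACA.
exists (bundle hL) => -[x y] /=.
rewrite linearD h1E h2E /= -linearD; congr (f _).
by apply: injective_projections => /=; rewrite ?addr0 ?add0r.
Qed.

End LinearMaps.

(** * Finitely generated submodules and noetherian rings *)

Section Submodules.
Context {R : comNzRingType}.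
Implicit Types U V W : lmodType R.

Definition submodP V (A : V -> Prop) :=
  A 0 /\ forall a x y, A x -> A y -> A (a *: x + y).

Section Closure.
Context {V : lmodType R} {A : V -> Prop} (AP : submodP A).

Lemma sub0 : A 0. Proof. by case: AP. Qed.
Lemma subZ a x : A x -> A (a *: x).
Proof. by case: AP => A0 AL Ax; rewrite -[_ *: _]addr0; apply: AL. Qed.
Lemma subD x y : A x -> A y -> A (x + y).
Proof. by case: AP => A0 AL Ax Ay; rewrite -[x]scale1r; apply: AL. Qed.
Lemma subN x : A x -> A (- x).
Proof. by rewrite -scaleN1r; apply: subZ. Qed.
Lemma subB x y : A x -> A y -> A (x - y).
Proof. by move=> Ax Ay; apply: subD => //; apply: subN. Qed.
Lemma sub_sum n (F : 'I_n -> V) : (forall i, A (F i)) -> A (\sum_i F i).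
Proof.
by move=> AF; apply: (big_ind A) => // [|x y]; [apply: sub0|apply: subD].
Qed.

End Closure.

Definition gen_mod V (A B : V -> Prop) n (g : 'I_n -> V) :=
  (forall i, A (g i)) /\
  forall x, A x -> exists a : 'I_n -> R, B (x - \sum_i a i *: g i).

Definition fgen V (A : V -> Prop) :=
  exists n (g : 'I_n -> V), gen_mod A (fun x => x = 0) g.

Definition join T n1 n2 (u : 'I_n1 -> T) (v : 'I_n2 -> T) (i : 'I_(n1 + n2)) :=
  match fintype.split i with inl j => u j | inr j => v j end.

Lemma joinP T n1 n2 (u : 'I_n1 -> T) (v : 'I_n2 -> T) (P : T -> Prop) :
  (forall i, P (u i)) -> (forall i, P (v i)) -> forall i, P (join u v i).
Proof. by move=> Pu Pv i; rewrite /join; case: fintype.split. Qed.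

Lemma join_lshift T n1 n2 (u : 'I_n1 -> T) (v : 'I_n2 -> T) i :
  join u v (lshift n2 i) = u i.
Proof. by rewrite /join (unsplitK (inl i : 'I_n1 + 'I_n2)). Qed.

Lemma join_rshift T n1 n2 (u : 'I_n1 -> T) (v : 'I_n2 -> T) i :
  join u v (rshift n1 i) = v i.
Proof. by rewrite /join (unsplitK (inr i : 'I_n1 + 'I_n2)). Qed.

Lemma sum_join V n1 n2 (g1 : 'I_n1 -> V) (g2 : 'I_n2 -> V) (a : 'I_(n1 + n2) -> R) :
  \sum_i a i *: join g1 g2 i =
  \sum_i a (lshift n2 i) *: g1 i + \sum_i a (rshift n1 i) *: g2 i.
Proof.
by rewrite big_split_ord /=; congr (_ + _); apply: eq_bigr => i _;
  rewrite ?join_lshift ?join_rshift.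
Qed.

Lemma sum_join2 V n1 n2 (g1 : 'I_n1 -> V) (g2 : 'I_n2 -> V) (a : 'I_n1 -> R) b :
  \sum_i join a b i *: join g1 g2 i = \sum_i a i *: g1 i + \sum_i b i *: g2 i.
Proof.
by rewrite sum_join; congr (_ + _); apply: eq_bigr => i _;
  rewrite ?join_lshift ?join_rshift.
Qed.

Lemma fgen_sum V (A : V -> Prop) n1 (g1 : 'I_n1 -> V) n2 (g2 : 'I_n2 -> V) :
  (forall i, A (g1 i)) -> (forall i, A (g2 i)) ->
  (forall x, A x -> exists a b, x = \sum_i a i *: g1 i + \sum_i b i *: g2 i) ->
  fgen A.
Proof.
move=> Ag1 Ag2 span; exists (n1 + n2)%N, (join g1 g2); split.
  exact: joinP.
move=> x /span[a [b ->]]; exists (join a b).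
by rewrite sum_join2 subrr.
Qed.

Definition idealP (I : R -> Prop) := @submodP R^o I.

Definition noethP := forall I, idealP I -> @fgen R^o I.

(** By induction on [n]: the first coordinates of the elements of [A] form an
    ideal, and the elements with first coordinate zero form a submodule of [R^(n-1)]. *)
Lemma noeth_row (noeth : noethP) n (A : 'rV[R]_n -> Prop) :
  submodP A -> fgen A.
Proof.
elim: n A => [|n IHn] A AP.
  exists 0, (fun i => 0); split=> [[]//|x _]; exists (fun=> 0).
  by rewrite big_ord0 subr0; apply/rowP => -[].
pose I a := exists2 x : 'rV[R]_(1 + n), A x & x 0 0 = a.
have IP : idealP I.
  split; first by exists 0; [exact: sub0|rewrite mxE].
  move=> a _ _ [x Ax <-] [y Ay <-]; exists (a *: x + y); last by rewrite !mxE.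
  by case: AP => _; apply.
have [n1 [g [Ig gspan]]] := noeth I IP.
have [G GA GE] : exists2 G : 'I_n1 -> 'rV[R]_(1 + n),
    (forall i, A (G i)) & forall i, G i 0 0 = g i.
  have : forall i, exists x : 'rV[R]_(1 + n), A x /\ x 0 0 = g i.
    by move=> i; have [x Ax xE] := Ig i; exists x.
  by move/choice => [G GP]; exists G => i; case: (GP i).
pose A' (y : 'rV[R]_n) := A (row_mx 0 y : 'rV[R]_(1 + n)).
have A'P : submodP A'.
  split; first by rewrite /A' row_mx0; exact: sub0.
  move=> a x y Ax Ay; rewrite /A'.
  have -> : row_mx 0 (a *: x + y) =
      a *: (row_mx 0 x) + row_mx 0 y :> 'rV[R]_(1 + n).
    by rewrite scale_row_mx add_row_mx scaler0 addr0.
  by case: AP => _; apply.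
have [n2 [h [A'h hspan]]] := IHn A' A'P.
refine (@fgen_sum 'rV[R]_(1 + n) A n1 G n2 (fun i => row_mx 0 (h i)) GA A'h _) => x Ax.
have /gspan[a /eqP] : I (x 0 0) by exists x.
rewrite subr_eq0 => /eqP aE.
set z := x - \sum_i a i *: G i.
have Az : A z by apply: subB => //; apply: sub_sum => // i; apply: subZ.
have z0 : z 0 0 = 0.
  rewrite /z !mxE aE summxE -sumrB big1 // => i _.
  by rewrite mxE GE; apply: subrr.
have zE : z = row_mx 0 (rsubmx (z : 'rV[R]_(1 + n))).
  rewrite -[LHS]hsubmxK; congr row_mx.
  apply/rowP => j; rewrite mxE [RHS]mxE (ord1 j) -[RHS]z0.
  by congr (fun_of_matrix z _ _); apply/val_inj.
have /hspan[b /eqP] : A' (rsubmx (z : 'rV[R]_(1 + n))) by rewrite /A' -zE.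
rewrite subr_eq0 => /eqP bE.
exists a, b; rewrite -[x](subrK (\sum_i a i *: G i)) addrC; congr (_ + _).
rewrite -/z zE bE.
have L : linear (fun y : 'rV[R]_n => row_mx 0 y : 'rV[R]_(1 + n)).
  by move=> c u v; rewrite scale_row_mx add_row_mx scaler0 addr0.
by rewrite (lin_sum L); apply: eq_bigr => i _; rewrite (linZ L).
Qed.

(** Otherwise [F] contains a strictly increasing sequence of ideals, and its union
    is not finitely generated. *)
Lemma noeth_max (noeth : noethP) (F : (R -> Prop) -> Prop) I0 :
  F I0 -> (forall I, F I -> idealP I) ->
  exists2 I, F I &
    forall J, F J -> (forall x, I x -> J x) -> forall x, J x -> I x.
Proof.
move=> FI0 Fideal; apply: contrapT => nomax.
have step (I : {I | F I}) : exists J : {J | F J},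
    (forall x, sval I x -> sval J x) /\ exists2 x, sval J x & ~ sval I x.
  case: I => I FI /=; apply: contrapT => noJ; apply: nomax; exists I => // J FJ IJ x Jx.
  by apply: contrapT => nIx; apply: noJ; exists (exist _ J FJ); split=> //; exists x.
have [next nextP] := choice step.
pose c n := iter n next (exist _ I0 FI0).
have cS n : forall x, sval (c n) x -> sval (c n.+1) x by case: (nextP (c n)).
have cle n k x : sval (c n) x -> sval (c (k + n)%N) x.
  by elim: k => // k IHk /IHk; apply: cS.
pose U x := exists n, sval (c n) x.
have cP n : idealP (sval (c n)) := Fideal _ (svalP (c n)).
have UP : idealP U.
  split; first by exists 0%N; apply: (sub0 (cP _)).
  move=> a x y [i xi] [j yj]; exists (j + i)%N; case: (cP (j + i)%N) => _; apply.
    exact: cle.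
  by rewrite addnC; apply: cle.
have [n [g [Ug gspan]]] := noeth U UP.
have [N NP] := choice Ug.
pose M := (\max_i N i)%N.
have UM x : U x -> sval (c M) x.
  move=> /gspan[a /eqP]; rewrite subr_eq0 => /eqP ->.
  apply: (@sub_sum R^o _ (cP M)) => i; apply: (@subZ R^o _ (cP M)).
  by rewrite -(subnK (leq_bigmax i : N i <= M)%N); apply: cle.
have [_ [x xJ]] := nextP (c M); apply; apply: UM; by exists M.+1.
Qed.

End Submodules.

Arguments noethP R : clear implicits.

(** * Dimensions of subquotients over the residue field *)

Section Local.
Context {R : comNzRingType}.
Implicit Types U V W : lmodType R.

Record localP (m : R -> Prop) : Prop := LocalP {
  local_ideal : idealP m;
  local_proper : ~ m 1;
  local_unit : forall a, ~ m a -> exists b, b * a = 1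
}.

Section Ideal.
Context {m : R -> Prop} (mL : localP m).

Lemma local0 : m 0. Proof. exact: (sub0 (local_ideal mL)). Qed.
Lemma localD x y : m x -> m y -> m (x + y).
Proof. exact: (@subD R R^o m (local_ideal mL)). Qed.
Lemma localN x : m x -> m (- x).
Proof. exact: (@subN R R^o m (local_ideal mL)). Qed.
Lemma localB x y : m x -> m y -> m (x - y).
Proof. exact: (@subB R R^o m (local_ideal mL)). Qed.
Lemma localM a x : m x -> m (a * x).
Proof. exact: (@subZ R R^o m (local_ideal mL)). Qed.
Lemma localMl a x : m x -> m (x * a).
Proof. by rewrite mulrC; apply: localM. Qed.
Lemma local_sum n (F : 'I_n -> R) : (forall i, m (F i)) -> m (\sum_i F i).
Proof. exact: (@sub_sum R R^o m (local_ideal mL)). Qed.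
Lemma local_1B x : m x -> exists b, b * (1 - x) = 1.
Proof.
move=> mx; apply: (local_unit mL) => m1x; apply: (local_proper mL).
by rewrite -(subrK x 1); apply: localD.
Qed.

End Ideal.

(** When [m A] lies in [B], this says that [A / B] is a vector space of dimension
    [r] over [R / m]. When [B = 0], it says that [A] has a minimal generating family
    with [r] members. *)
Definition qdim (m : R -> Prop) V (A B : V -> Prop) r :=
  exists2 v : 'I_r -> V, gen_mod A B v &
    forall a : 'I_r -> R, B (\sum_i a i *: v i) -> forall i, m (a i).

(** A member of the family that occurs in a relation with an invertible coefficient
    can be left out. *)
Lemma gen_mod_qdim m (mL : localP m) V (A B : V -> Prop) n (g : 'I_n -> V) :
  submodP B -> gen_mod A B g -> exists r, qdim m A B r.
Proof.
move=> BP; elim: n g => [|n IHn] g gA; first by exists 0%N, g => // a _ [].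
have [indep|] := pselect
    (forall a : 'I_n.+1 -> R, B (\sum_i a i *: g i) -> forall i, m (a i)).
  by exists n.+1, g.
move=> /existsNP[a /not_implyP[Ba /existsNP[k mak]]].
have [b ba1] := local_unit mL mak; case: gA => Ag gspan.
apply: (IHn (fun i => g (lift k i))); split=> [i|x Ax]; first exact: Ag.
have [c Bc] := gspan x Ax.
exists (fun i => c (lift k i) - c k * b * a (lift k i)).
have -> : x - \sum_i (c (lift k i) - c k * b * a (lift k i)) *: g (lift k i)
    = (x - \sum_i c i *: g i) + (c k * b) *: \sum_i a i *: g i.
  have split_k (e : 'I_n.+1 -> R) :
      \sum_i e i *: g i = e k *: g k + \sum_i e (lift k i) *: g (lift k i).
    by rewrite (bigD1_ord k).
  rewrite !split_k scalerDr scalerA -mulrA ba1 mulr1 scaler_sumr.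
  under eq_bigr do rewrite scalerBl -scalerA.
  rewrite sumrB; set s1 := \sum_(i < n) _; set s2 := \sum_(i < n) _.
  by rewrite opprB opprD -[RHS]addrA addrACA addNr add0r [t in x + t]addrC.
by case: BP => _ BL; rewrite addrC; apply: BL.
Qed.

Lemma mincover m (mL : localP m) V (A : V -> Prop) :
  fgen A -> exists r, qdim m A (fun x => x = 0) r.
Proof.
move=> [n [g gA]]; apply: (gen_mod_qdim mL _ gA).
by split=> // a x y -> ->; rewrite scaler0 addr0.
Qed.

(** The submodule [m A]. *)
Definition mulP (m : R -> Prop) V (A : V -> Prop) (x : V) :=
  exists n (c : 'I_n -> R) (y : 'I_n -> V),
    [/\ forall i, m (c i), forall i, A (y i) & x = \sum_i c i *: y i].

Lemma mulP_gen m (mL : localP m) V (A : V -> Prop) n (g : 'I_n -> V) x :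
  gen_mod A (fun x => x = 0) g -> mulP m A x ->
  exists2 e : 'I_n -> R, forall j, m (e j) & x = \sum_j e j *: g j.
Proof.
move=> [_ gspan] [k [c [y [mc Ay ->]]]].
have [a aE] := choice (fun i => gspan _ (Ay i)).
exists (fun j => \sum_i c i * a i j) => [j|].
  by apply: (local_sum mL) => i; apply: (localMl mL).
under [RHS]eq_bigr do rewrite scaler_suml.
rewrite exchange_big /=; apply: eq_bigr => i _.
have /eqP := aE i; rewrite subr_eq0 => /eqP ->.
by rewrite scaler_sumr; apply: eq_bigr => j _; rewrite scalerA.
Qed.

Lemma nakayama m (mL : localP m) V (A : V -> Prop) :
  fgen A -> (forall x, A x -> mulP m A x) -> forall x, A x -> x = 0.
Proof.
move=> /(mincover mL)[r [g gA indep]] AmA.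
case: r g gA indep => [|r] g gA indep x Ax.
  case: gA => _ /(_ x Ax)[a /eqP].
  by rewrite big_ord0 subr0 => /eqP.
have [e me eE] := mulP_gen mL gA (AmA _ (gA.1 ord0)).
have /indep/(_ ord0) : \sum_i ((i == ord0)%:R - e i) *: g i = 0.
  under eq_bigr do rewrite scalerBl.
  rewrite sumrB -eE (bigD1 ord0) //= scale1r big1 ?addr0 ?subrr // => i /negPf->.
  by rewrite scale0r.
rewrite eqxx => m1e; case: (local_proper mL).
by rewrite -(subrK (e ord0) 1); apply: (localD mL).
Qed.

(** Additivity of dimensions along [0 -> K / B -> Z / B -> Z' / B' -> 0]. The second
    map is given by a relation [rho] and not by a function, since this is how
    connecting homomorphisms arise, from a choice of lifts. *)
Lemma qdim_rel m (mL : localP m) V V' (Z B : V -> Prop) (Z' B' : V' -> Prop)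
    (rho : V -> V' -> Prop) r1 r2 :
  submodP Z -> submodP B -> submodP B' ->
  rho 0 0 -> (forall a x y x' y', rho x x' -> rho y y' ->
    rho (a *: x + y) (a *: x' + y')) ->
  (forall a z, m a -> Z z -> B (a *: z)) ->
  (forall z, Z z -> exists2 z', Z' z' & rho z z') ->
  (forall z', Z' z' -> exists2 z, Z z & rho z z') ->
  (forall z z', B z -> rho z z' -> B' z') ->
  qdim m (fun z => Z z /\ exists2 z', rho z z' & B' z') B r1 ->
  qdim m Z' B' r2 -> qdim m Z B (r1 + r2).
Proof.
move=> ZP BP B'P rho0 rhoL mZB tot onto wd [v [vK vspan] vind] [w' [w'Z w'span] w'ind].
have rho_sum n (a : 'I_n -> R) (x : 'I_n -> V) (x' : 'I_n -> V') :
    (forall i, rho (x i) (x' i)) -> rho (\sum_i a i *: x i) (\sum_i a i *: x' i).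
  move=> xx'; apply: (big_rec2 rho) => // i y y' _ ?; exact: rhoL.
have rhoB x y x' y' : rho x x' -> rho y y' -> rho (x - y) (x' - y').
  by move=> ? ?; rewrite addrC [x' - _]addrC -!scaleN1r; apply: rhoL.
have /choice[w wP] : forall i, exists z, Z z /\ rho z (w' i).
  by move=> i; have [z ? ?] := onto _ (w'Z i); exists z.
have /choice[u' u'P] : forall i, exists z, rho (v i) z /\ B' z.
  by move=> i; have [_ [z ? ?]] := vK i; exists z.
exists (join v w).
  split; first by apply: joinP => i; [case: (vK i)|case: (wP i)].
  move=> z Zz; have [z' Z'z' zz'] := tot z Zz.
  have [b B'b] := w'span z' Z'z'.
  have [|a Ba] := vspan (z - \sum_i b i *: w i).
    split; last first.
      exists (z' - \sum_i b i *: w' i) => //; apply: rhoB => //.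
      by apply: rho_sum => i; case: (wP i).
    apply: subB => //; apply: sub_sum => // i; apply: subZ => //.
    by case: (wP i).
  by exists (join a b); rewrite sum_join2 opprD addrA addrAC.
move=> a; rewrite sum_join => Ba.
have Bb : B' (\sum_i a (lshift r2 i) *: u' i + \sum_i a (rshift r1 i) *: w' i).
  apply: (wd _ _ Ba); rewrite -[X in rho (X + _)]scale1r -[X in rho _ (X + _)]scale1r.
  apply: rhoL; apply: rho_sum => i; [by case: (u'P i)|by case: (wP i)].
have mb : forall i, m (a (rshift r1 i)).
  apply: w'ind.
  rewrite -[X in B' X](addKr (\sum_i a (lshift r2 i) *: u' i)).
  apply: (subD B'P) => //; apply: (subN B'P); apply: sub_sum => // i.
  by apply: subZ => //; case: (u'P i).
have ma : forall i, m (a (lshift r2 i)).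
  apply: vind.
  rewrite -[X in B X](addrK (\sum_i a (rshift r1 i) *: w i)).
  apply: subB => //; apply: sub_sum => // i; apply: mZB => //.
  by case: (wP i).
by move=> i; case: (split_ordP i) => j ->.
Qed.

Lemma submodP_rel V V' (Z : V -> Prop) (B' : V' -> Prop) (rho : V -> V' -> Prop) :
  submodP Z -> submodP B' -> rho 0 0 ->
  (forall a x y x' y', rho x x' -> rho y y' -> rho (a *: x + y) (a *: x' + y')) ->
  submodP (fun z => Z z /\ exists2 z', rho z z' & B' z').
Proof.
move=> ZP B'P rho0 rhoL; split=> [|a x y [Zx [x' xx' Bx']] [Zy [y' yy' By']]].
  by split; [exact: sub0|exists 0 => //; exact: sub0].
split; first by case: ZP => _; apply.
by exists (a *: x' + y'); [exact: rhoL|case: B'P => _; apply].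
Qed.

Lemma qdim_rel_iso m (mL : localP m) V V' (Z B : V -> Prop) (Z' B' : V' -> Prop)
    (rho : V -> V' -> Prop) r :
  submodP Z -> submodP B -> submodP B' ->
  rho 0 0 -> (forall a x y x' y', rho x x' -> rho y y' ->
    rho (a *: x + y) (a *: x' + y')) ->
  (forall a z, m a -> Z z -> B (a *: z)) ->
  (forall z, Z z -> exists2 z', Z' z' & rho z z') ->
  (forall z', Z' z' -> exists2 z, Z z & rho z z') ->
  (forall z z', B z -> rho z z' -> B' z') ->
  (forall z z', Z z -> rho z z' -> B' z' -> B z) ->
  qdim m Z' B' r -> qdim m Z B r.
Proof.
move=> ZP BP B'P rho0 rhoL mZB tot onto wd inj; rewrite -[r in _ -> _ r]add0n.
apply: (qdim_rel mL ZP BP B'P rho0 rhoL mZB tot onto wd).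
exists (fun=> 0) => [|a _ []//]; split=> [[]//|z [Zz [z' zz' Bz']]].
by exists (fun=> 0); rewrite big_ord0 subr0; apply: inj zz' Bz'.
Qed.

End Local.

(** * Complexes and the comparison theorem *)

(** Dependent choice along a sequence of types, with an invariant [I] that makes
    each step possible. *)
Lemma dependent_choice_inv (T : nat -> Type) (I : forall n, T n -> Prop)
    (S : forall n, T n -> T n.+1 -> Prop) (x0 : T 0%N) :
  I 0%N x0 -> (forall n x, I n x -> exists2 y, I n.+1 y & S n x y) ->
  exists f : forall n, T n,
    [/\ f 0%N = x0, forall n, I n (f n) & forall n, S n (f n) (f n.+1)].
Proof.
move=> Ix0 step.
have step' n (x : {x | I n x}) : exists y : {y | I n.+1 y}, S n (sval x) (sval y).
  by case: x => x Ix; have [y Iy xy] := step n x Ix; exists (exist _ y Iy).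
pose next n x := projT1 (cid (step' n x)).
have nextP n x : S n (sval x) (sval (next n x)) := projT2 (cid (step' n x)).
pose f := nat_rect (fun n => {x | I n x}) (exist _ x0 Ix0) next.
by exists (fun n => sval (f n)); split=> // n; exact: svalP.
Qed.

Section Complexes.
Context {R : comNzRingType}.
Implicit Types U V W : lmodType R.

Record cpx := Cpx {
  cmod :> nat -> lmodType R;
  cdiff : forall n, cmod n.+1 -> cmod n;
  cdiff_linear : forall n, linear (@cdiff n);
  cdiffK : forall n (x : cmod n.+2), cdiff (cdiff x) = 0
}.

Arguments cdiff : clear implicits.
Implicit Types X Y Z : cpx.

(** Degree [0] is left out on purpose. A resolution [P] of [V] is the complex with [V]
    in degree [0] and [P n] in degree [n.+1], so that a map of modules is the degree
    [0] part of the chain map that lifts it. *)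
Definition projC (X : cpx) := forall n, projective (X n.+1).
Definition acyclic (X : cpx) :=
  forall n (x : X n.+1), cdiff X n x = 0 -> exists y, cdiff X n.+1 y = x.

Definition chain_map (X Y : cpx) (f : forall n, X n -> Y n) :=
  (forall n, linear (f n)) /\
  forall n x, cdiff Y n (f n.+1 x) = f n (cdiff X n x).

Lemma chain_map_id X : @chain_map X X (fun n (x : X n) => x).
Proof. by []. Qed.

Lemma chain_map_comp X Y Z (f : forall n, X n -> Y n) (g : forall n, Y n -> Z n) :
  chain_map f -> chain_map g -> chain_map (fun n x => g n (f n x)).
Proof.
move=> [fL fd] [gL gd]; split=> [n|n x]; first exact: linear_comp.
by rewrite gd fd.
Qed.

Lemma chain_map_sub X Y (f g : forall n, X n -> Y n) :
  chain_map f -> chain_map g -> chain_map (fun n x => f n x - g n x).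
Proof.
move=> [fL fd] [gL gd]; split=> [n|n x]; first exact: linear_sub.
by rewrite (linB (@cdiff_linear Y n)) fd gd.
Qed.

Lemma chain_lift (X Y : cpx) (f0 : X 0%N -> Y 0%N) :
  projC X -> acyclic Y -> linear f0 ->
  (forall x, exists y, cdiff Y 0 y = f0 (cdiff X 0 x)) ->
  exists2 f : forall n, X n -> Y n, chain_map f & f 0%N = f0.
Proof.
move=> projX acY f0L f0im.
pose I n (f : X n -> Y n) :=
  linear f /\ forall x, exists y, cdiff Y n y = f (cdiff X n x).
pose S n (f : X n -> Y n) (g : X n.+1 -> Y n.+1) :=
  forall x, cdiff Y n (g x) = f (cdiff X n x).
have [|n f [fL fim]|f [f00 fI fS]] := @dependent_choice_inv _ I S f0.
- by [].
- have [g gL gE] := projective_lift (projX n) (@cdiff_linear Y n)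
    (linear_comp (@cdiff_linear X n) fL) fim.
  exists g => //; split=> // x; apply: acY.
  by rewrite gE cdiffK (lin0 fL).
- by exists f => //; split=> [n|]; [case: (fI n)|exact: fS].
Qed.

(** A homotopy given in degree [0] extends, for the obstruction in each degree is a
    cycle of [Y]. *)
Lemma null_homotopy (X Y : cpx) (f : forall n, X n -> Y n) (s0 : X 0%N -> Y 1%N) :
  projC X -> acyclic Y -> chain_map f -> linear s0 ->
  (forall x, cdiff Y 0 (s0 x) = f 0%N x) ->
  exists s : forall n, X n -> Y n.+1, [/\ s 0%N = s0, forall n, linear (s n) &
    forall n x, f n.+1 x = cdiff Y n.+1 (s n.+1 x) + s n (cdiff X n x)].
Proof.
move=> projX acY [fL fd] s0L s0E.
pose I n (s : X n -> Y n.+1) := linear s /\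
  forall x, cdiff Y n (s (cdiff X n x)) = f n (cdiff X n x).
pose S n (s : X n -> Y n.+1) (t : X n.+1 -> Y n.+2) :=
  forall x, f n.+1 x = cdiff Y n.+1 (t x) + s (cdiff X n x).
have [|n s [sL sE]|s [s00 sI sS]] := @dependent_choice_inv _ I S s0.
- by [].
- have gL : linear (fun x => f n.+1 x - s (cdiff X n x)).
    by apply: linear_sub => //; apply: linear_comp => //; exact: cdiff_linear.
  have [x|t tL tE] := projective_lift (projX n) (@cdiff_linear Y n.+1) gL.
    by apply: acY; rewrite (linB (@cdiff_linear Y n)) fd sE subrr.
  exists t => [|x]; last by rewrite tE subrK.
  by split=> // x; rewrite tE cdiffK (lin0 sL) subr0.
- by exists s; split=> // n; case: (sI n).
Qed.

(** A homotopy equivalence that is an isomorphism in degree [0]. The homotopies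
    vanish there, which is what degree [0] cohomology needs. *)
Record equivalence (X Y : cpx) (f : forall n, X n -> Y n) (g : forall n, Y n -> X n)
    (s : forall n, X n -> X n.+1) (t : forall n, Y n -> Y n.+1) : Prop := Equivalence {
  equiv_f : chain_map f;
  equiv_g : chain_map g;
  equiv_sL : forall n, linear (s n);
  equiv_tL : forall n, linear (t n);
  equiv_s0 : forall x, s 0%N x = 0;
  equiv_t0 : forall x, t 0%N x = 0;
  equiv_gf0 : forall x, g 0%N (f 0%N x) = x;
  equiv_fg0 : forall x, f 0%N (g 0%N x) = x;
  equiv_s : forall n x, x - g n.+1 (f n.+1 x) = cdiff X n.+1 (s n.+1 x) + s n (cdiff X n x);
  equiv_t : forall n x, x - f n.+1 (g n.+1 x) = cdiff Y n.+1 (t n.+1 x) + t n (cdiff Y n x)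
}.

Lemma comparison (X Y : cpx) (f0 : X 0%N -> Y 0%N) (g0 : Y 0%N -> X 0%N) :
  projC X -> acyclic X -> projC Y -> acyclic Y ->
  linear f0 -> linear g0 -> cancel f0 g0 -> cancel g0 f0 ->
  (forall x, exists y, cdiff Y 0 y = f0 (cdiff X 0 x)) ->
  (forall y, exists x, cdiff X 0 x = g0 (cdiff Y 0 y)) ->
  exists f g s t, @equivalence X Y f g s t.
Proof.
move=> projX acX projY acY f0L g0L f0K g0K f0im g0im.
have [f fC f00] := chain_lift projX acY f0L f0im.
have [g gC g00] := chain_lift projY acX g0L g0im.
have [x|s [s0 sL sE]] := null_homotopy projX acX
  (chain_map_sub (chain_map_id X) (chain_map_comp fC gC)) (@linear_zero R _ _).
  by rewrite (lin0 (@cdiff_linear X _)) f00 g00 f0K subrr.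
have [x|t [t0 tL tE]] := null_homotopy projY acY
  (chain_map_sub (chain_map_id Y) (chain_map_comp gC fC)) (@linear_zero R _ _).
  by rewrite (lin0 (@cdiff_linear Y _)) f00 g00 g0K subrr.
exists f, g, s, t; split=> //; rewrite ?f00 ?g00 ?s0 ?t0 //.
Qed.

Lemma equivalence_sym X Y f g s t : @equivalence X Y f g s t -> @equivalence Y X g f t s.
Proof. by case. Qed.

(** Cohomology of [Hom (X, W)] for [X] with a module [V] in degree [0]; since
    [X n.+1] is the [n]-th term of the resolution of [V], a cochain of degree [n]
    is defined on [X n.+1], and there are no coboundaries of degree [0]. *)
Definition cocyc (X : cpx) W n (f : X n.+1 -> W) :=
  linear f /\ forall y, f (cdiff X n.+1 y) = 0.

Definition cobound (X : cpx) W n : (X n.+1 -> W) -> Prop :=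
  match n with
  | 0 => fun f => forall x, f x = 0
  | n'.+1 => fun f => exists2 h : X n'.+1 -> W, linear h &
      forall x, f x = h (cdiff X n'.+1 x)
  end.

Lemma cocyc_submod X W n : submodP (@cocyc X W n).
Proof.
split=> [|a f g [fL f0] [gL g0]].
  by split=> // a x y; rewrite -[LHS]/(0 : W) -[RHS]/(a *: (0 : W) + 0) scaler0 addr0.
split=> [|y]; first exact: (linear_add (linear_scale a fL) gL).
rewrite -[LHS]/(a *: f (cdiff X n.+1 y) + g (cdiff X n.+1 y)).
by rewrite f0 g0 scaler0 addr0.
Qed.

Lemma cobound_submod X W n : submodP (@cobound X W n).
Proof.
case: n => [|n]; split=> [|a f g].
- by [].
- by move=> f0 g0 x; rewrite -[LHS]/(a *: f x + g x) f0 g0 scaler0 addr0.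
- by exists (fun=> 0); first exact: linear_zero.
- move=> [h hL hE] [k kL kE]; exists (fun x => a *: h x + k x) => [|x].
    exact: (linear_add (linear_scale a hL) kL).
  by rewrite -[LHS]/(a *: f x + g x) hE kE.
Qed.

Lemma cobound_cocyc X W n (f : X n.+1 -> W) :
  linear f -> cobound f -> cocyc f.
Proof.
case: n f => [|n] f fL fB; split=> // y.
by case: fB => h hL ->; rewrite cdiffK (lin0 hL).
Qed.

Lemma cobound_ext X W n (f g : X n.+1 -> W) :
  (forall x, f x = g x) -> cobound f -> cobound g.
Proof. by move=> /funext ->. Qed.

Lemma cocyc_post X V W n (q : V -> W) (f : X n.+1 -> V) :
  linear q -> cocyc f -> cocyc (fun x => q (f x)).
Proof.
by move=> qL [fL f0]; split=> [|y]; [exact: linear_comp|rewrite f0 (lin0 qL)].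
Qed.

Lemma cobound_post X V W n (q : V -> W) (f : X n.+1 -> V) :
  linear q -> cobound f -> cobound (fun x => q (f x)).
Proof.
case: n f => [|n] f qL /=; first by move=> f0 x; rewrite f0 (lin0 qL).
move=> [h hL hE]; exists (fun x => q (h x)) => [|x]; first exact: linear_comp.
by rewrite hE.
Qed.

Definition hdim (m : R -> Prop) X W n r := qdim m (@cocyc X W n) (@cobound X W n) r.

Lemma cocyc_comp X Y W n (f : forall n, X n -> Y n) (c : Y n.+1 -> W) :
  chain_map f -> cocyc c -> cocyc (fun x => c (f n.+1 x)).
Proof.
move=> [fL fd] [cL c0]; split=> [|y]; first exact: linear_comp.
by rewrite -fd c0.
Qed.

Lemma cobound_comp X Y W n (f : forall n, X n -> Y n) (c : Y n.+1 -> W) :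
  chain_map f -> cobound c -> cobound (fun x => c (f n.+1 x)).
Proof.
case: n c => [|n] c [fL fd] /=; first by move=> c0 x; rewrite c0.
move=> [h hL hE]; exists (fun x => h (f n.+1 x)) => [|x]; first exact: linear_comp.
by rewrite hE fd.
Qed.

Lemma cocyc_homotopic X Y W f g s t n (c : X n.+1 -> W) :
  @equivalence X Y f g s t -> cocyc c ->
  cobound (fun x => c x - c (g n.+1 (f n.+1 x))).
Proof.
move=> E [cL c0].
have cE x : c x - c (g n.+1 (f n.+1 x)) = c (s n (cdiff X n x)).
  by rewrite -(linB cL) (equiv_s E) (linD cL) c0 add0r.
case: n c cL c0 cE => [|n] c cL c0 cE /=.
  by move=> x; rewrite cE (equiv_s0 E) (lin0 cL).
exists (fun x => c (s n.+1 x)) => //; exact: (linear_comp (@equiv_sL _ _ _ _ _ _ E _) cL).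
Qed.

Lemma fct_combE (T : Type) W n (a : 'I_n -> R) (F : 'I_n -> T -> W) x :
  (\sum_i a i *: F i : T -> W) x = \sum_i a i *: F i x.
Proof. by rewrite fct_sumE. Qed.

Lemma hdim_transfer m X Y W f g s t n r :
  @equivalence X Y f g s t -> hdim m Y W n r -> hdim m X W n r.
Proof.
move=> E [v [vZ vspan] vind]; have fC := equiv_f E; have gC := equiv_g E.
exists (fun i x => v i (f n.+1 x)).
  split=> [i|c cZ]; first exact: (cocyc_comp fC (vZ i)).
  have [a aB] := vspan _ (cocyc_comp gC cZ).
  exists a; have := subD (@cobound_submod X W n) (cocyc_homotopic E cZ)
    (cobound_comp fC aB).
  apply: cobound_ext => x.
  rewrite -[LHS]/(c x - c (g n.+1 (f n.+1 x)) + (c (g n.+1 (f n.+1 x)) -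
    (\sum_i a i *: v i : _ -> _) (f n.+1 x))).
  by rewrite addrA subrK -[RHS]/(c x - (\sum_i a i *: _ : _ -> _) x) !fct_combE.
move=> a aB; apply: vind.
have aZ : cocyc (\sum_i a i *: v i : Y n.+1 -> W).
  by apply: (sub_sum (@cocyc_submod Y W n)) => i;
     apply: (subZ (@cocyc_submod Y W n)).
have := subD (@cobound_submod Y W n) (cocyc_homotopic (equivalence_sym E) aZ)
  (cobound_comp gC aB).
apply: cobound_ext => x.
rewrite -[LHS]/((\sum_i a i *: v i : _ -> _) x - (\sum_i a i *: v i : _ -> _) (f n.+1 (g n.+1 x))
  + (\sum_i a i *: _ : _ -> _) (g n.+1 x)).
by rewrite !fct_combE subrK.
Qed.

End Complexes.

Arguments cdiff {R} c n x.
Arguments cpx R : clear implicits.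

(** * Long exact sequences that split into short ones *)

Section Sequences.
Context {R : comNzRingType} {m : R -> Prop} (mL : localP m).
Context (X : cpx R) (projX : projC X) (acX : acyclic X).
Context (mX0 : forall a (x : X 0%N), m a -> a *: x = 0).

(** Multiplication by [a] is zero in degree [0], hence null-homotopic. *)
Lemma cocyc_killed (W : lmodType R) n a (c : X n.+1 -> W) :
  m a -> cocyc c -> cobound (a *: c : X n.+1 -> W).
Proof.
move=> ma [cL c0].
have aC : @chain_map R X X (fun n x => a *: x).
  by split=> [k|k x]; [apply: linear_scale|rewrite (linZ (@cdiff_linear _ X k))].
have [x|s [s0 sL sE]] := null_homotopy projX acX aC (@linear_zero R _ _).
  by rewrite (lin0 (@cdiff_linear _ X _)) mX0.
have acE x : a *: c x = c (s n (cdiff X n x)).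
  by rewrite -(linZ cL) sE (linD cL) c0 add0r.
case: n c cL c0 acE => [|n] c cL c0 acE /=.
  by move=> x; rewrite -[LHS]/(a *: c x) acE s0 (lin0 cL).
by exists (fun x => c (s n.+1 x)) => //; exact: linear_comp cL.
Qed.

Context {A B C : lmodType R} (i : A -> B) (q : B -> C).
Context (iL : linear i) (qL : linear q).
Context (i_inj : forall a, i a = 0 -> a = 0) (q_surj : forall c, exists b, q b = c).
Context (exact_iq : forall b, q b = 0 <-> exists a, i a = b).

Local Lemma lift_q n (f : X n.+1 -> C) : linear f ->
  exists2 g : X n.+1 -> B, linear g & forall x, q (g x) = f x.
Proof. by move=> fL; apply: projective_lift. Qed.

Local Lemma lift_i n (f : X n.+1 -> B) : linear f -> (forall x, q (f x) = 0) ->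
  exists2 g : X n.+1 -> A, linear g & forall x, i (g x) = f x.
Proof. by move=> fL qf; apply: projective_lift => // x; apply/exact_iq. Qed.

Local Lemma i_eq a b : i a = i b -> a = b.
Proof.
move=> ab; apply/eqP; rewrite -subr_eq0; apply/eqP/i_inj.
by rewrite (linB iL) ab subrr.
Qed.

(** A cochain that bounds in [C] is lifted to [B], and its coboundary is subtracted
    from [g]. *)
Local Lemma cobound_lift n (g : X n.+1 -> B) : linear g ->
  cobound (fun x => q (g x)) ->
  exists2 h : X n.+1 -> A, linear h &
    linear (fun x => g x - i (h x)) /\ cobound (fun x => g x - i (h x)).
Proof.
case: n g => [|n] g gL /= qg.
  have [h hL hE] := lift_i gL qg; exists h => //.
  by split=> [|x]; [apply: linear_sub => //; apply: linear_comp iL|rewrite hE subrr].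
have [t tL tE] := qg; have [u uL uE] := lift_q tL.
have [|x|h hL hE] := @lift_i _ (fun x => g x - u (cdiff X n.+1 x)).
- exact: (linear_sub gL (linear_comp (@cdiff_linear _ X _) uL)).
- by rewrite (linB qL) tE uE subrr.
exists h => //; split; first by apply: linear_sub => //; apply: linear_comp iL.
by exists u => // x; rewrite hE opprB addrC subrK.
Qed.

Local Lemma cocyc_i n (f : X n.+1 -> A) : linear f -> cocyc (fun x => i (f x)) -> cocyc f.
Proof. by move=> fL [_ f0]; split=> // y; apply: i_inj. Qed.

(** If [Ext (k, A) -> Ext (k, B)] is zero, then the connecting homomorphism
    [Ext^n (k, C) -> Ext^(n+1) (k, A)] is onto, with kernel [Ext^n (k, B)]. *)
Section ZeroLeft.
Context (i_zero : forall n (f : X n.+1 -> A), cocyc f -> cobound (fun x => i (f x))).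

Lemma hdim_zero_left0 : hdim m X A 0 0.
Proof.
exists (fun=> 0) => [|a _ []//]; split=> [[]//|f fZ].
exists (fun=> 0); rewrite big_ord0 subr0 => x.
by apply: i_inj; have := i_zero fZ.
Qed.

Lemma hdim_zero_left n r1 r2 :
  hdim m X B n r1 -> hdim m X A n.+1 r2 -> hdim m X C n (r1 + r2).
Proof.
move=> dB dA; pose rho (z : X n.+1 -> C) (f : X n.+2 -> A) :=
  exists2 g : X n.+1 -> B, linear g &
    (forall x, q (g x) = z x) /\ forall x, g (cdiff X n.+1 x) = i (f x).
have rho0 : rho 0 0.
  exists (fun=> 0); first exact: linear_zero.
  by split=> x; rewrite ?(lin0 qL) // -[f in i f]/(0 : A) (lin0 iL).
have rhoL a x y x' y' : rho x x' -> rho y y' -> rho (a *: x + y) (a *: x' + y').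
  move=> [g gL [gq gi]] [h hL [hq hi]]; exists (fun x => a *: g x + h x).
    exact: (linear_add (linear_scale a gL) hL).
  by split=> u; rewrite ?qL ?gq ?hq // gi hi -iL.
apply: (qdim_rel mL (@cocyc_submod _ X C n) (@cobound_submod _ X C n)
  (@cobound_submod _ X A n.+1) rho0 rhoL _ _ _ _ _ dA).
- by move=> a z; apply: cocyc_killed.
- move=> z [zL z0]; have [g gL gE] := lift_q zL.
  have gdL : linear (fun x => g (cdiff X n.+1 x)).
    exact: (linear_comp (@cdiff_linear _ X _) gL).
  have [x|f fL fE] := lift_i gdL; first by rewrite gE z0.
  exists f; last by exists g => //; split=> // x; rewrite fE.
  by apply: cocyc_i => //; split=> [|y]; [exact: linear_comp iL|rewrite fE cdiffK (lin0 gL)].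
- move=> f fZ; have [h hL hE] := i_zero fZ.
  exists (fun x => q (h x)); last by exists h => //; split=> // x; rewrite hE.
  split=> [|y]; first exact: linear_comp qL.
  by rewrite -hE; apply/exact_iq; exists (f y).
- move=> z f zB [g gL [gq gi]].
  have [|h hL [_ hB]] := cobound_lift gL; first by apply: cobound_ext zB.
  exists h => // x; apply: i_eq; rewrite -gi.
  have [_ /(_ x)] := cobound_cocyc (linear_sub gL (linear_comp hL iL)) hB.
  by move/eqP; rewrite subr_eq0 => /eqP.
pose rho' (z : X n.+1 -> C) (b : X n.+1 -> B) :=
  cocyc b /\ forall x, z x = q (b x).
apply: (qdim_rel_iso mL _ (@cobound_submod _ X C n) (@cobound_submod _ X B n) (rho := rho')
  _ _ _ _ _ _ _ dB).
- exact: (submodP_rel (@cocyc_submod _ X C n) (@cobound_submod _ X A n.+1)).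
- split=> [|x]; first exact: (sub0 (@cocyc_submod _ X B n)).
  by rewrite -[x in q x]/(0 : B) (lin0 qL).
- move=> a z z' b b' [bZ zb] [bZ' zb']; split=> [|x]; last by rewrite qL -zb -zb'.
  by case: (@cocyc_submod _ X B n) => _; apply.
- by move=> a z ma [zZ _]; apply: cocyc_killed.
- move=> z [zZ [f [g gL [gq gi]] [h hL hE]]].
  have ghZ : cocyc (fun x => g x - i (h x)).
    split=> [|y]; first by apply: linear_sub => //; apply: linear_comp iL.
    by rewrite gi hE subrr.
  exists (fun x => g x - i (h x)) => //; split=> // x.
  rewrite (linB qL) gq (_ : q (i _) = 0) ?subr0 //.
  by apply/exact_iq; exists (h x).
- move=> b [bL b0]; exists (fun x => q (b x)) => //; split.
    exact: (cocyc_post qL).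
  exists 0; last exact: (sub0 (@cobound_submod _ X A n.+1)).
  by exists b => //; split=> // x; rewrite b0 -[x in i x]/(0 : A) (lin0 iL).
- move=> z b zB [bZ zb].
  have [|h hL [hL' hB]] := cobound_lift bZ.1; first by apply: cobound_ext zB.
  have hZ : cocyc h.
    apply: cocyc_i => //; have := subB (@cocyc_submod _ X B n) bZ (cobound_cocyc hL' hB).
    by congr cocyc; apply/funext => x; rewrite -[LHS]/(b x - (b x - i (h x))) subKr.
  have := subD (@cobound_submod _ X B n) hB (i_zero hZ).
  by apply: cobound_ext => x; rewrite -[LHS]/(b x - i (h x) + i (h x)) subrK.
- move=> z b _ [_ zb] bB; apply: cobound_ext (cobound_post qL bB) => x.
  by rewrite zb.
Qed.

End ZeroLeft.

(** If [Ext (k, B) -> Ext (k, C)] is zero, then [Ext^(n+1) (k, A) -> Ext^(n+1) (k, B)]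
    is onto, with kernel [Ext^n (k, C)]. *)
Section ZeroRight.
Context (q_zero : forall n (f : X n.+1 -> B), cocyc f -> cobound (fun x => q (f x))).

Lemma hdim_zero_right0 r : hdim m X B 0 r -> hdim m X A 0 r.
Proof.
apply: (qdim_rel_iso mL (@cocyc_submod _ X A 0) (@cobound_submod _ X A 0)
  (@cobound_submod _ X B 0) (rho := fun f g => forall x, g x = i (f x))).
- by move=> x; rewrite -[x in i x]/(0 : A) (lin0 iL).
- by move=> a z z' b b' zb zb' x; rewrite iL -zb -zb'.
- by move=> a z; apply: cocyc_killed.
- move=> f [fL f0]; exists (fun x => i (f x)) => //.
  by split=> [|y]; [exact: linear_comp iL|rewrite f0 (lin0 iL)].
- move=> g gZ; have [f fL fE] := lift_i gZ.1 (q_zero gZ); exists f => //.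
  apply: cocyc_i => //; split=> [|y]; first exact: linear_comp iL.
  by rewrite fE gZ.2.
- by move=> f g f0 gf x; rewrite gf f0 (lin0 iL).
- by move=> f g _ gf g0 x; apply: i_inj; rewrite -gf.
Qed.

Lemma hdim_zero_right n r1 r2 :
  hdim m X C n r1 -> hdim m X B n.+1 r2 -> hdim m X A n.+1 (r1 + r2).
Proof.
move=> dC dB; pose rho (f : X n.+2 -> A) (g : X n.+2 -> B) :=
  exists2 h : X n.+1 -> B, linear h & forall x, g x = i (f x) + h (cdiff X n.+1 x).
have rho0 : rho 0 0.
  exists (fun=> 0) => [|x]; first exact: linear_zero.
  by rewrite -[x in i x]/(0 : A) (lin0 iL) addr0.
have rhoL a x y x' y' : rho x x' -> rho y y' -> rho (a *: x + y) (a *: x' + y').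
  move=> [g gL gE] [h hL hE]; exists (fun x => a *: g x + h x).
    exact: (linear_add (linear_scale a gL) hL).
  by move=> u; rewrite iL addrACA -scalerDr -gE -hE.
apply: (qdim_rel mL (@cocyc_submod _ X A n.+1) (@cobound_submod _ X A n.+1)
  (@cobound_submod _ X B n.+1) rho0 rhoL _ _ _ _ _ dB).
- by move=> a z; apply: cocyc_killed.
- move=> f [fL f0]; exists (fun x => i (f x)).
    by split=> [|y]; [exact: linear_comp iL|rewrite f0 (lin0 iL)].
  by exists (fun=> 0) => [|x]; [exact: linear_zero|rewrite addr0].
- move=> g [gL g0]; have [f fL [hL [h hL' hE]]] := cobound_lift gL (q_zero (conj gL g0)).
  exists f; last by exists h => // x; rewrite -hE addrC subrK.
  apply: cocyc_i => //; split=> [|y]; first exact: linear_comp iL.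
  have := hE (cdiff X n.+2 y); rewrite cdiffK (lin0 hL') g0 sub0r => /eqP.
  by rewrite oppr_eq0 => /eqP.
- move=> f g [h hL hE] [k kL kE]; exists (fun x => i (h x) + k x) => [|x].
    by apply: linear_add => //; exact: linear_comp iL.
  by rewrite kE hE.
pose rho' (f : X n.+2 -> A) (c : X n.+1 -> C) := exists2 g : X n.+1 -> B, linear g &
  (forall x, q (g x) = c x) /\ forall x, i (f x) = g (cdiff X n.+1 x).
apply: (qdim_rel_iso mL _ (@cobound_submod _ X A n.+1) (@cobound_submod _ X C n) (rho := rho')
  _ _ _ _ _ _ _ dC).
- exact: (submodP_rel (@cocyc_submod _ X A n.+1) (@cobound_submod _ X B n.+1)).
- exists (fun=> 0); first exact: linear_zero.
  by split=> x; rewrite ?(lin0 qL) // -[f in i f]/(0 : A) (lin0 iL).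
- move=> a x y x' y' [g gL [gq gi]] [h hL [hq hi]]; exists (fun x => a *: g x + h x).
    exact: (linear_add (linear_scale a gL) hL).
  by split=> u; rewrite ?qL ?gq ?hq // iL gi hi.
- by move=> a z ma [zZ _]; apply: cocyc_killed.
- move=> f [[fL f0] [g [h hL hE] [k kL kE]]].
  have dE x : i (f x) = k (cdiff X n.+1 x) - h (cdiff X n.+1 x).
    by rewrite -kE hE addrK.
  have khL : linear (fun x => k x - h x) by exact: linear_sub.
  exists (fun x => q (k x - h x)); last by exists (fun x => k x - h x).
  split=> [|y]; first exact: linear_comp qL.
  by rewrite -dE; apply/exact_iq; exists (f y).
- move=> c [cL c0]; have [g gL gE] := lift_q cL.
  have gdL : linear (fun x => g (cdiff X n.+1 x)).
    exact: (linear_comp (@cdiff_linear _ X _) gL).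
  have [x|f fL fE] := lift_i gdL; first by rewrite gE c0.
  exists f; last by exists g => //; split=> // x; rewrite fE.
  split; last first.
    exists (fun x => g (cdiff X n.+1 x)); last by exists g.
    by exists (fun=> 0) => [|x]; [exact: linear_zero|rewrite addr0 fE].
  apply: cocyc_i => //.
  by split=> [|y]; [exact: linear_comp iL|rewrite fE cdiffK (lin0 gL)].
- move=> f c [h hL hE] [g gL [gq gi]].
  have zL : linear (fun x => g x - i (h x)).
    by apply: linear_sub => //; exact: linear_comp iL.
  have /q_zero : cocyc (fun x => g x - i (h x)).
    by split=> // y; rewrite -gi hE subrr.
  apply: cobound_ext => x; rewrite (linB qL) gq (_ : q (i _) = 0) ?subr0 //.
  by apply/exact_iq; exists (h x).
- move=> f c _ [g gL [gq gi]] cB.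
  have [|h hL [hL' hB]] := cobound_lift gL; first by apply: cobound_ext cB.
  exists h => // x; apply: i_eq; rewrite gi.
  have [_ /(_ x)] := cobound_cocyc hL' hB.
  by move/eqP; rewrite subr_eq0 => /eqP.
Qed.

End ZeroRight.

End Sequences.

(** * Augmented resolutions *)

(** The complex [Y] with [V] added in front. *)
Section Augmented.
Context {R : comNzRingType} {V : lmodType R} {Y : cpx R} {e : Y 0%N -> V}.
Context (eL : linear e) (e0 : forall x, e (cdiff Y 0 x) = 0).

Definition aug_mod n : lmodType R := if n is n'.+1 then Y n' else V.

Definition aug_diff n : aug_mod n.+1 -> aug_mod n :=
  match n with 0 => e | n'.+1 => @cdiff _ Y n' end.

Fact aug_diff_linear n : linear (@aug_diff n).
Proof. by case: n => // n; exact: cdiff_linear. Qed.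

Fact aug_diffK n (x : aug_mod n.+2) : aug_diff (aug_diff x) = 0.
Proof. by case: n x => // n x; exact: cdiffK. Qed.

Definition augment := Cpx aug_diff_linear aug_diffK.

Lemma augment_acyclic :
  (forall x, e x = 0 -> exists y, cdiff Y 0 y = x) -> acyclic Y -> acyclic augment.
Proof. by move=> ex0 ex [|n]; [exact: ex0|exact: ex]. Qed.

Lemma augment_proj : projective (Y 0%N) -> projC Y -> projC augment.
Proof. by move=> P0 P [|n]; [exact: P0|exact: P]. Qed.

End Augmented.

Section ResolutionComplex.
Context {R : comNzRingType} (M : lmodType R) (P : projective_resolution M).

Fact res_aug0 x : res_aug P (res_diff P 0 x) = 0.
Proof. by apply/res_exact0; exists x. Qed.

Fact res_diffK n x : res_diff P n (res_diff P n.+1 x) = 0.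
Proof. by apply/res_exactS; exists x. Qed.

Definition res_mod_cpx := Cpx (fun n => @linearP _ _ _ _ (res_diff P n)) res_diffK.

Definition res_cpx :=
  augment (Y := res_mod_cpx) (@linearP _ _ _ _ (res_aug P)) res_aug0.

Lemma res_acyclic : acyclic res_cpx.
Proof. by apply: augment_acyclic => [x|n x]; [move/res_exact0|move/res_exactS]. Qed.

Lemma res_proj : projC res_cpx.
Proof. by apply: augment_proj => [|n]; exact: res_projective. Qed.

End ResolutionComplex.

(** * Minimal free resolutions *)

Definition row_span {R : comNzRingType} c p (E : 'M[R]_(c, p)) (y : 'rV[R]_p) :=
  exists x : 'rV[R]_c, x *m E = y.

Section MatrixComplex.
Context {R : comNzRingType} {b : nat -> nat} (D : forall n, 'M[R]_(b n.+1, b n)).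
Context (ex : forall n (x : 'rV_(b n.+1)), x *m D n = 0 <-> row_span (D n.+1) x).

Fact mx_diffK n (x : 'rV_(b n.+2)) : x *m D n.+1 *m D n = 0.
Proof. by apply/ex; exists x. Qed.

Definition mx_cpx :=
  @Cpx R (fun n => 'rV[R]_(b n)) _ (fun n => linear_mulmx (D n)) mx_diffK.

Lemma mx_acyclic : acyclic mx_cpx.
Proof. by move=> n x /ex. Qed.

Lemma mx_proj : projC mx_cpx.
Proof. by move=> n; exact: projective_row. Qed.

End MatrixComplex.

Section MinimalResolution.
Context {R : comNzRingType} {m : R -> Prop} (mL : localP m) (noeth : noethP R).

(** Minimality of the generating family is expressed by the coefficients of its
    relations, which become the entries of the next matrix. *)
Lemma row_cover p (A : 'rV[R]_p -> Prop) : submodP A ->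
  exists c (E : 'M[R]_(c, p)), (forall y, A y <-> row_span E y) /\
    forall x : 'rV_c, x *m E = 0 -> forall i, m (x 0 i).
Proof.
move=> AP; have [c [g [Ag gspan] indep]] := mincover mL (noeth_row noeth AP).
exists c, (\matrix_i g i).
have mulE (x : 'rV_c) : x *m (\matrix_i g i) = \sum_i x 0 i *: g i.
  by rewrite mulmx_sum_row; apply: eq_bigr => i _; rewrite rowK.
split=> [y|x]; last by rewrite mulE; apply: indep.
split=> [/gspan[a /eqP]|[x <-]].
  rewrite subr_eq0 => /eqP ->; exists (\row_i a i).
  by rewrite mulE; apply: eq_bigr => i _; rewrite mxE.
by rewrite mulE; apply: sub_sum => // i; apply: subZ.
Qed.

Lemma minimal_free_complex p (A : 'rV[R]_p -> Prop) : submodP A ->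
  exists b (D : forall n, 'M[R]_(b n.+1, b n)) (E : 'M[R]_(b 0%N, p)),
    [/\ forall y, A y <-> row_span E y,
        forall x : 'rV_(b 0%N), x *m E = 0 <-> row_span (D 0%N) x,
        forall n (x : 'rV_(b n.+1)), x *m D n = 0 <-> row_span (D n.+1) x &
        forall n i j, m (D n i j)].
Proof.
move=> AP; have [c [E [EA Emin]]] := row_cover AP.
have kerP q r (G : 'M[R]_(q, r)) : submodP (fun x : 'rV_q => x *m G = 0).
  split=> [|a x y x0 y0]; first exact: mul0mx.
  by rewrite mulmxDl -scalemxAl x0 y0 scaler0 addr0.
pose next q r (G : 'M[R]_(q, r)) := cid (row_cover (kerP _ _ G)).
pose next_mx q r (G : 'M[R]_(q, r)) : 'M[R]_(projT1 (next _ _ G), q) :=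
  projT1 (cid (projT2 (next _ _ G))).
have next_ker q r (G : 'M[R]_(q, r)) (x : 'rV_q) :
    x *m G = 0 <-> row_span (next_mx q r G) x.
  by case: (projT2 (cid (projT2 (next q r G)))).
have next_min q r (G : 'M[R]_(q, r)) (x : 'rV_(projT1 (next _ _ G))) :
    x *m next_mx q r G = 0 -> forall i, m (x 0 i).
  by case: (projT2 (cid (projT2 (next q r G)))) => _; apply.
pose St := {q : nat & {r : nat & 'M[R]_(q, r)}}.
pose stq (s : St) := projT1 s.
pose stm (s : St) := projT2 (projT2 s).
pose st n : St := iter n (fun s => existT _ _ (existT _ _ (next_mx _ _ (stm s))))
  (existT _ c (existT _ p E)).
exists (fun n => stq (st n)), (fun n => stm (st n.+1)), E.
have stE n (x : 'rV_(stq (st n))) : x *m stm (st n) = 0 <-> row_span (stm (st n.+1)) x.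
  exact: next_ker.
have minE n (x : 'rV_(stq (st n))) : x *m stm (st n) = 0 -> forall i, m (x 0 i).
  by case: n x => [|n] x; [exact: Emin|exact: next_min].
split; [exact: EA|exact: (stE 0%N)|by move=> n; exact: (stE n.+1)|move=> n].
move=> i j.
have /minE : (delta_mx 0 i : 'rV_(stq (st n.+1))) *m stm (st n.+1) *m stm (st n) = 0.
  exact: (proj2 (stE n _) (ex_intro _ (delta_mx 0 i) erefl)).
by move/(_ j); rewrite -rowE mxE.
Qed.

End MinimalResolution.

(** A minimal resolution by free modules of finite rank. *)
Record free_res {R : comNzRingType} (m : R -> Prop) (V : lmodType R) := FreeRes {
  fr_rank : nat -> nat;
  fr_mx : forall n, 'M[R]_(fr_rank n.+1, fr_rank n);
  fr_aug : 'rV[R]_(fr_rank 0%N) -> V;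
  fr_aug_linear : linear fr_aug;
  fr_surj : forall v, exists x, fr_aug x = v;
  fr_exact0 : forall x, fr_aug x = 0 <-> row_span (fr_mx 0) x;
  fr_exact : forall n (x : 'rV[R]_(fr_rank n.+1)),
    x *m fr_mx n = 0 <-> row_span (fr_mx n.+1) x;
  fr_min : forall n i j, m (fr_mx n i j)
}.

Arguments fr_mx {R m V} f n.
Arguments fr_aug {R m V} f x.

Section FreeResolution.
Context {R : comNzRingType} {m : R -> Prop} (mL : localP m) (noeth : noethP R).
Context {V : lmodType R}.

Lemma free_res_exists : fgen (fun _ : V => True) -> exists F : free_res m V, True.
Proof.
move=> /(mincover mL)[p [g [_ gspan] indep]].
pose e (x : 'rV[R]_p) := \sum_i x 0 i *: g i.
have eL : linear e := @linear_combination _ _ _ g.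
have kerP : submodP (fun x => e x = 0).
  split=> [|a x y x0 y0]; first exact: lin0.
  by rewrite eL x0 y0 scaler0 addr0.
have [b [D [E [EA E0 Dex Dmin]]]] := minimal_free_complex mL noeth kerP.
pose rk n := if n is n'.+1 then b n' else p.
pose mx n : 'M[R]_(rk n.+1, rk n) :=
  match n return 'M[R]_(rk n.+1, rk n) with 0 => E | n'.+1 => D n' end.
have ex n (x : 'rV_(rk n.+1)) : x *m mx n = 0 <-> row_span (mx n.+1) x by case: n x.
have surj v : exists x, e x = v.
  have [a /eqP] := gspan v I; rewrite subr_eq0 => /eqP ->; exists (\row_i a i).
  by apply: eq_bigr => i _; rewrite mxE.
unshelve eexists (@FreeRes R m V rk mx e eL surj _ ex _) => //.
case=> [|n] i j //=; have /indep : e ((delta_mx 0 i : 'rV_(b 0%N)) *m E) = 0.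
  by apply/EA; exists (delta_mx 0 i).
by move/(_ j); rewrite -rowE mxE.
Qed.

Context (F : free_res m V).
Local Notation b := (fr_rank F).
Local Notation D := (fr_mx F).

Fact fr_aug0 (x : 'rV_(b 1%N)) : fr_aug F (x *m D 0) = 0.
Proof. by apply/fr_exact0; exists x. Qed.

Definition fr_cpx := augment (Y := mx_cpx (@fr_exact _ _ _ F))
  (fr_aug_linear (f := F)) fr_aug0.

Lemma fr_acyclic : acyclic fr_cpx.
Proof. by apply: augment_acyclic; [move=> x /fr_exact0|exact: mx_acyclic]. Qed.

Lemma fr_proj : projC fr_cpx.
Proof. by apply: augment_proj; [exact: projective_row|exact: mx_proj]. Qed.

End FreeResolution.

(** * Classes coming from the ring *)

Section Operators.
Context {R : comNzRingType} {m : R -> Prop} (mL : localP m).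

(** The sign makes a null-homotopy of a chain map [X -> Y] satisfy the same kind of
    equation, as a map [X -> shift Y], as the chain map does. *)
Definition shift (X : cpx R) : cpx R.
Proof.
refine (@Cpx R (fun n => X n.+1) (fun n x => - cdiff X n.+1 x) _ _).
- by move=> n; apply: linear_opp; exact: cdiff_linear.
- by move=> n x; rewrite (linN (@cdiff_linear _ X _)) opprK cdiffK.
Defined.

Lemma shift_acyclic X : acyclic X -> acyclic (shift X).
Proof.
move=> acX n x /eqP; rewrite /= oppr_eq0 => /eqP/acX[y <-]; exists (- y).
by rewrite (linN (@cdiff_linear _ X _)) opprK.
Qed.

(** For a projective resolution of [V] this says that
    [Ext^n (V, R) -> Ext^n (V, R / m)] is zero for [n > 0], as a cochain with values
    in [R / m] lifts to [R]. For [n = 0] it holds in any case, as a cocycle is then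
    the composite of a map [V -> R] with [cdiff X 0]. *)
Definition null_mod (X : cpx R) := forall n (c : X n.+1 -> R^o), cocyc c ->
  exists2 h : X n -> R^o, linear h & forall x, m (c x - h (cdiff X n x)).

Lemma shift_null_mod X : null_mod X -> null_mod (shift X).
Proof.
move=> nullX n c [cL c0]; have [|h hL hE] := nullX n.+1 c.
  split=> // y; apply/eqP; rewrite -oppr_eq0 -(linN cL); apply/eqP; exact: c0.
exists (fun x => - h x) => [|x]; first exact: linear_opp.
by rewrite /= (linN hL) opprK.
Qed.

Context (X : cpx R) (projX : projC X) (acX : acyclic X) (nullX : null_mod X).
Context (mX0 : forall a (x : X 0%N), m a -> a *: x = 0).
Context {b : nat -> nat} (D : forall n, 'M[R]_(b n.+1, b n)).
Context (DK : forall n, D n.+1 *m D n = 0) (mD : forall n i j, m (D n i j)).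

Implicit Types Y : cpx R.

Definition defect (Y : cpx R) (f : forall n, X n -> Y n) n (x : X n.+1) :=
  cdiff Y n (f n.+1 x) - f n (cdiff X n x).

(** Let [F] be the complex with terms ['rV_(b j)] and differentials [D j]. The members
    of the family [f] are indexed by the basis of [F j]. Their defects
    need not be zero, but are combinations of the maps that come before in the construction below,
    with the entries of [D j] as coefficients; this is what the last two fields
    retain, [E] being meant to be the next differential. *)
Record almost_chain j (Y : cpx R) (f : 'I_(b j) -> forall n, X n -> Y n) : Prop := {
  ac_linear : forall a n, linear (f a n);
  ac_mod : forall a n x, mulP m (fun=> True) (defect (f a) (n := n) x);
  ac_killed : forall p (E : 'M_(b j, p)), D j *m E = 0 ->
    forall c n x, \sum_a E a c *: defect (f a) (n := n) x = 0
}.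

Lemma mulP0 (V : lmodType R) : mulP m (fun _ : V => True) 0.
Proof. by exists 0, (fun=> 0), (fun=> 0); split; [case|case|rewrite big_ord0]. Qed.

Lemma mulP_combination (V : lmodType R) n (c : 'I_n -> R) (v : 'I_n -> V) :
  (forall i, m (c i)) -> mulP m (fun _ : V => True) (\sum_i c i *: v i).
Proof. by exists n, c, v. Qed.

Lemma linear_mulP (V : lmodType R) (h : V -> R^o) v :
  linear h -> mulP m (fun=> True) v -> m (h v).
Proof.
move=> hL [n [c [y [mc _ ->]]]]; rewrite (lin_sum hL).
by apply: (local_sum mL) => i; rewrite (linZ hL); exact: (localMl mL).
Qed.

Lemma almost_chain_id j (a0 : 'I_(b j)) :
  almost_chain (fun a n (x : X n) => (a == a0)%:R *: x).
Proof.
have dE a n (x : X n.+1) : defect (fun n (x : X n) => (a == a0)%:R *: x) x = 0.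
  by rewrite /defect (linZ (@cdiff_linear _ X _)) subrr.
split=> [a n|a n x|p E _ c n x].
- exact: (linear_scale (a == a0)%:R (@linear_id R (X n))).
- by rewrite dE; exact: mulP0.
- by rewrite big1 // => a _; rewrite dE scaler0.
Qed.

(** One step along the differential of [F] is null-homotopic, because it has
    coefficients in [m], and [m] kills [X 0]. The homotopy is a
    new almost chain map, of degree one more. *)
Lemma almost_chain_step j Y (f : 'I_(b j.+1) -> forall n, X n -> Y n) :
  acyclic Y -> almost_chain f ->
  exists s : 'I_(b j) -> forall n, X n -> shift Y n,
    [/\ almost_chain s, forall c x, s c 0%N x = 0 &
     forall c n x, \sum_a D j a c *: f a n.+1 x =
       cdiff Y n.+1 (s c n.+1 x) + s c n (cdiff X n x)].
Proof.
move=> acY [fL fm fk].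
pose g c n (x : X n) := \sum_a D j a c *: f a n x.
have gC c : chain_map (g c).
  split=> [n|n x].
    by apply: linear_sum_fun => a; exact: (linear_scale _ (fL a n)).
  apply/eqP; rewrite -subr_eq0 /g (lin_sum (@cdiff_linear _ Y n)) -sumrB.
  rewrite -[X in _ == X](fk _ _ (DK j) c n x); apply/eqP; apply: eq_bigr => a _.
  by rewrite (linZ (@cdiff_linear _ Y n)) scalerBr.
have g0 c (x : X 0%N) : g c 0%N x = 0.
  by rewrite /g big1 // => a _; rewrite -(linZ (fL a 0%N)) mX0 // (lin0 (fL a 0%N)).
have sP c : exists s : forall n, X n -> Y n.+1, [/\ forall n, linear (s n),
    forall x, s 0%N x = 0 & forall n x, g c n.+1 x =
      cdiff Y n.+1 (s n.+1 x) + s n (cdiff X n x)].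
  have [x|s [s0 sL sE]] := null_homotopy projX acY (gC c) (@linear_zero R _ _).
    by rewrite g0 (lin0 (@cdiff_linear _ Y 0)).
  by exists s; split=> // x; rewrite s0.
pose s c := projT1 (cid (sP c)).
have [sL s0 sE] : [/\ forall c n, linear (s c n), forall c x, s c 0%N x = 0 &
   forall c n x, g c n.+1 x = cdiff Y n.+1 (s c n.+1 x) + s c n (cdiff X n x)].
  by split=> c; case: (projT2 (cid (sP c))).
have dE c n x : @defect (shift Y) (s c) n x = - g c n.+1 x.
  by rewrite sE opprD.
exists s; split=> //; split=> // [c n x|p E DE e n x].
  rewrite dE /g -sumrN; under eq_bigr do rewrite -scaleNr.
  by apply: mulP_combination => a; exact: (localN mL).
under eq_bigr do rewrite dE scalerN.
rewrite sumrN; apply/eqP; rewrite oppr_eq0; apply/eqP.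
under eq_bigr do rewrite scaler_sumr.
rewrite exchange_big big1 //= => a _.
have := congr1 (fun M : 'M_(_, _) => M a e *: f a n.+1 x) DE.
rewrite !mxE scale0r scaler_suml; apply: etrans.
by apply: eq_bigr => c _; rewrite scalerA mulrC.
Qed.

(** The maps that come from cocycles with values in [R]. The complexes [Y] that occur
    are the iterated shifts of [X]; only the two properties that they inherit from
    [X] are kept. *)
Inductive rep j n : (X n -> 'rV[R]_(b j)) -> Prop :=
| rep0 : rep (fun=> 0)
| repD g1 g2 : rep g1 -> rep g2 -> rep (fun x => g1 x + g2 x)
| rep_gen Y (f : 'I_(b j) -> forall n, X n -> Y n) (c : Y n -> R^o) :
    acyclic Y -> (null_mod X -> null_mod Y) -> almost_chain f ->
    linear c -> (forall y, c (cdiff Y n y) = 0) ->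
    rep (fun x => \row_a c (f a n x)).

Lemma rep_linear j n (g : X n -> 'rV_(b j)) : rep g -> linear g.
Proof.
elim=> [|g1 g2 _ ? _ ?|Y f c _ _ [fL _ _] cL _].
- exact: linear_zero.
- exact: linear_add.
- apply: linear_row => a u x y; rewrite !mxE.
  exact: (linear_comp (fL a n) cL).
Qed.

Lemma rep_sum j n N (g : 'I_N -> X n -> 'rV_(b j)) :
  (forall i, rep (g i)) -> rep (fun x => \sum_i g i x).
Proof.
elim: N g => [|N IHN] g gR.
  have -> : (fun x => \sum_i g i x) = fun=> 0 by apply/funext => x; rewrite big_ord0.
  exact: rep0.
have -> : (fun x => \sum_i g i x) = fun x => g ord0 x + \sum_i g (lift ord0 i) x.
  by apply/funext => x; rewrite big_ord_recl.
by apply: repD => //; apply: IHN.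
Qed.

Lemma rep_cocyc j n (g : X n -> 'rV_(b j)) :
  linear g -> (forall y, g (cdiff X n y) = 0) -> rep g.
Proof.
move=> gL g0; pose c a (x : X n) : R^o := g x 0 a.
have cL a : linear (c a) by exact: (linear_comp gL (@linear_entry _ _ a)).
have -> : g = fun x => \sum_a \row_a' c a ((a' == a)%:R *: x).
  apply/funext => x; apply/rowP => i; rewrite summxE (bigD1 i) //= big1 => [|a /negPf ai].
    by rewrite mxE eqxx scale1r addr0.
  by rewrite mxE eq_sym ai scale0r (lin0 (cL a)).
apply: rep_sum => a.
apply: (@rep_gen j n X (fun a' n x => (a' == a)%:R *: x)) => //.
  exact: almost_chain_id.
by move=> y; rewrite /c g0 mxE.
Qed.

(** The homotopy produced by [almost_chain_step] exhibits the composite with [D j] as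
    a coboundary; the cochain is zero in degree [0], so this is a true coboundary
    even at the first term of the resolution. *)
Lemma rep_step j n (g : X n.+1 -> 'rV_(b j.+1)) : rep g ->
  exists h : X n -> 'rV_(b j), [/\ rep h, n = 0%N -> forall x, h x = 0 &
    forall x, g x *m D j = h (cdiff X n x)].
Proof.
elim=> [|g1 g2 _ [h1 [h1R h10 h1E]] _ [h2 [h2R h20 h2E]]|Y f c acY nY fC cL c0].
- by exists (fun=> 0); split=> // [|x]; [exact: rep0|rewrite mul0mx].
- exists (fun x => h1 x + h2 x); split=> [|n0 x|x]; first exact: repD.
    by rewrite h10 // h20 // addr0.
  by rewrite mulmxDl h1E h2E.
have [s [sC s0 sE]] := almost_chain_step acY fC.
exists (fun x => \row_a c (s a n x)); split.
- apply: (@rep_gen j n (shift Y) s c (shift_acyclic acY) (fun nX => shift_null_mod (nY nX)) sC cL).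
  by move=> y; rewrite /= (linN cL) c0 oppr0.
- by move=> n0 x; subst n; apply/rowP => a; rewrite !mxE s0 (lin0 cL).
- move=> x; apply/rowP => a; rewrite !mxE.
  have := congr1 c (sE a n x); rewrite (linD cL) c0 add0r => <-.
  rewrite (lin_sum cL); apply: eq_bigr => i _.
  by rewrite (linZ cL) mxE mulrC.
Qed.

(** Every map into [F j] that is a cocycle modulo the image of [D j] comes,
    modulo that image, from cocycles with values in [R]: its failure to be a
    cocycle is measured by such a map into [F j.+1], to which the result applies
    by descending induction on [j]. *)
Lemma rep_exists p (bp : forall j, (p < j)%N -> b j = 0%N)
    (exD : forall j (x : 'rV_(b j.+1)), x *m D j = 0 <-> row_span (D j.+1) x) j n
    (g : X n.+1 -> 'rV_(b j)) : linear g ->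
  (forall x, row_span (D j) (g (cdiff X n.+1 x))) ->
  exists2 r, rep r & forall x, row_span (D j) (g x - r x).
Proof.
have [k] : exists k, (p < j + k)%N by exists p.+1; rewrite addnS ltnS leq_addl.
elim: k j n g => [|k IHk] j n g jk gL gim.
  rewrite addn0 in jk; exists (fun=> 0); first exact: rep0.
  move=> x; exists 0; rewrite mul0mx subr0; apply/rowP => i.
  by have := ltn_ord i; rewrite {2}(bp j jk).
have gdL : linear (fun x => g (cdiff X n.+1 x)).
  exact: (linear_comp (@cdiff_linear _ X _) gL).
have [g' g'L g'E] := projective_lift (@projX n.+1) (linear_mulmx (D j)) gdL gim.
have jk' : (p < j.+1 + k)%N by rewrite addSnnS.
have [x|r' r'R r'E] := IHk j.+1 n.+1 g' jk' g'L.
  by apply/exD; rewrite g'E cdiffK (lin0 gL).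
have [h [hR _ hE]] := rep_step r'R.
exists (fun x => h x + (g x - h x)); last first.
  by move=> x; exists 0; rewrite mul0mx [h x + _]addrC subrK subrr.
apply: repD => //; apply: rep_cocyc.
  exact: linear_sub (rep_linear hR).
move=> y; apply/eqP; rewrite subr_eq0 -g'E -hE -subr_eq0 -mulmxBl; apply/eqP.
by apply/exD.
Qed.

(** Modulo [m] the cocycles from which [r] is built are coboundaries, and almost
    chain maps are chain maps. *)
Lemma rep_null (m_neq0 : exists2 a, m a & a <> 0) (V : lmodType R) (w : 'rV_(b 0) -> V)
    n (r : X n.+1 -> 'rV_(b 0)) :
  linear w -> (forall a v, m a -> a *: w v = 0) -> rep r ->
  cobound (fun x => w (r x)).
Proof.
move=> wL mw rR.
have [h hL [h0 hE]] : exists2 h : X n -> V, linear h &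
    (n = 0%N -> forall x, h x = 0) /\ forall x, w (r x) = h (cdiff X n x).
  elim: rR => [|g1 g2 _ [h1 h1L [h10 h1E]] _ [h2 h2L [h20 h2E]]|Y f c acY nY [fL fm _] cL c0].
  - by exists (fun=> 0); [exact: linear_zero|split=> // x; rewrite (lin0 wL)].
  - exists (fun x => h1 x + h2 x); first exact: linear_add.
    by split=> [n0 x|x]; [rewrite h10 // h20 // addr0|rewrite (linD wL) h1E h2E].
  have [h hL hE] := nY nullX n c (conj cL c0).
  exists (fun x => \sum_a h (f a n x) *: w (delta_mx 0 a)).
    by apply: linear_sum_fun => a; apply: linear_scaler; exact: (linear_comp (fL a n)).
  split=> [n0 x|x]; last first.
    rewrite [X in w X]row_sum_delta (lin_sum wL); apply: eq_bigr => a _.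
    rewrite (linZ wL) mxE; apply/eqP; rewrite -subr_eq0 -scalerBl; apply/eqP/mw.
    rewrite -[c _](subrK (h (cdiff Y n (f a n.+1 x)))) -addrA.
    apply: (localD mL) => //; rewrite -(linB hL).
    exact: (linear_mulP hL (fm a n x)).
  rewrite big1 // => a _; apply: mw; apply: contrapT => hu.
  have [u uE] := local_unit mL hu; have [t mt t0] := m_neq0; apply: t0.
  subst n; rewrite -[t]mulr1 -uE mulrCA.
  rewrite -[t * _]/(t *: (h (f a 0%N x) : R^o)) -(linZ hL) -(linZ (fL a 0%N)) mX0 //.
  by rewrite (lin0 (fL a 0%N)) (lin0 hL) mulr0.
case: n r rR h hL h0 hE => [|n] r rR h hL h0 hE; last by exists h.
by move=> x; rewrite hE h0.
Qed.

End Operators.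

(** * Ranks *)

Section Powers.
Context {R : comNzRingType} {m : R -> Prop} (mL : localP m).
Context (X : cpx R) {W V : lmodType R} {s : nat}.
Context (i : 'I_s -> W -> V) (p : 'I_s -> V -> W).
Context (iL : forall a, linear (i a)) (pL : forall a, linear (p a)).
Context (pi_id : forall a w, p a (i a w) = w).
Context (pi_0 : forall a c w, a != c -> p a (i c w) = 0).
Context (ip_id : forall v, v = \sum_a i a (p a v)).

(** [V] is a direct sum of [s] copies of [W], and the components of a cocycle are
    handled one after the other: [Z k] collects the cocycles all of whose components
    from the [k]-th on are coboundaries. *)
Lemma hdim_power n r :
  (forall a (f : X n.+1 -> V), m a -> cocyc f -> cobound (a *: f : X n.+1 -> V)) ->
  hdim m X W n r -> hdim m X V n (s * r).
Proof.
move=> killed dW.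
pose Z k (f : X n.+1 -> V) := cocyc f /\
  forall a : 'I_s, (k <= a)%N -> cobound (fun x => p a (f x)).
have ZP k : submodP (Z k).
  split=> [|c f g [fZ fB] [gZ gB]].
    split=> [|a _]; first exact: (sub0 (@cocyc_submod _ X V n)).
    by apply: cobound_ext (sub0 (@cobound_submod _ X W n)) => x; rewrite (lin0 (pL a)).
  split=> [|a ka]; first by case: (@cocyc_submod _ X V n) => _; apply.
  have := (@cobound_submod _ X W n).2 c _ _ (fB a ka) (gB a ka).
  by apply: cobound_ext => x; rewrite pL.
have dZ k : (k <= s)%N -> qdim m (Z k) (@cobound _ X V n) (k * r).
  elim: k => [_|k IHk ks].
    exists (fun=> 0) => [|c _ []//]; split=> [[]//|f [fZ fB]].
    exists (fun=> 0); rewrite big_ord0 subr0.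
    have -> : f = \sum_a (fun x => i a (p a (f x))).
      by apply/funext => x; rewrite fct_sumE.
    apply: (sub_sum (@cobound_submod _ X V n)) => a.
    exact: (cobound_post (iL a) (fB a _)).
  have {}IHk := IHk (ltnW ks); pose a := Ordinal ks.
  rewrite mulSn addnC.
  apply: (@qdim_rel _ _ mL _ _ (Z k.+1) _ _ _ (fun f g => g = fun x => p a (f x))
    _ _ (ZP k.+1) (@cobound_submod _ X V n) (@cobound_submod _ X W n) _ _ _ _ _ _ _ dW).
  - by apply/funext => x; rewrite (lin0 (pL a)).
  - by move=> c f g f' g' -> ->; apply/funext => x; rewrite pL.
  - by move=> c f mc [fZ _]; apply: killed.
  - by move=> f [fZ _]; exists (fun x => p a (f x)) => //; apply: cocyc_post.
  - move=> f fZ; exists (fun x => i a (f x)); last by apply/funext => x; rewrite pi_id.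
    split=> [|c kc]; first exact: cocyc_post.
    apply: cobound_ext (sub0 (@cobound_submod _ X W n)) => x; rewrite pi_0 //.
    by apply: contraTneq kc => ->; rewrite ltnn.
  - by move=> f _ fB ->; apply: cobound_post.
  case: IHk => v [vZ vspan] vind; exists v => //; split=> [c|f [[fZ fB] [_ -> faB]]].
    have [vcZ vcB] := vZ c; split.
      by split=> // a' ka'; apply: vcB; apply: ltnW.
    by exists (fun x => p a (v c x)) => //; apply: vcB.
  apply: vspan; split=> // c; rewrite leq_eqVlt => /predU1P[kc|]; last exact: fB.
  by rewrite (_ : c = a) //; apply/val_inj.
have [v [vZ vspan] vind] := dZ s (leqnn s).
exists v => //; split=> [c|f fZ]; first by case: (vZ c).
by apply: vspan; split=> // a; rewrite leqNgt ltn_ord.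
Qed.

End Powers.

Section Finiteness.
Context {R : comNzRingType} {m : R -> Prop} (mL : localP m) (noeth : noethP R).

(** As [W] is cyclic, the cochains on the free module [F n] are images of row
    vectors, and those whose image is a cocycle form a finitely generated module. *)
Lemma hdim_exists (V W : lmodType R) (F : free_res m V) (w : W) n :
  (forall v, exists a, v = a *: w) -> exists r, hdim m (fr_cpx F) W n r.
Proof.
move=> wspan; pose b := fr_rank F n.
pose toF (u : 'rV[R]_b) (x : 'rV[R]_b) := (\sum_a x 0 a * u 0 a) *: w.
have toFL u : linear (toF u).
  apply: (@linear_scaler R 'rV_b W (fun x => \sum_a x 0 a * u 0 a)).
  move=> c x y; rewrite scaler_sumr -big_split; apply: eq_bigr => a _ /=.
  by rewrite !mxE mulrDl -mulrA.
have toF_lin (c : R) u v : toF (c *: u + v) = c *: toF u + toF v.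
  apply/funext => x; rewrite -[RHS]/(c *: toF u x + toF v x) /toF scalerA -scalerDl.
  congr (_ *: _); rewrite mulr_sumr -big_split; apply: eq_bigr => a _ /=.
  by rewrite !mxE; ring.
pose A u := cocyc (X := fr_cpx F) (n := n) (toF u).
have AP : submodP A.
  split=> [|c u v uA vA]; rewrite /A.
    have -> : toF 0 = 0.
      by apply/funext => x; rewrite /toF big1 ?scale0r // => a _; rewrite mxE mulr0.
    exact: (sub0 (@cocyc_submod _ (fr_cpx F) W n)).
  by rewrite toF_lin; case: (@cocyc_submod _ (fr_cpx F) W n) => _; apply.
have [N [g [gA gspan]]] := noeth_row noeth AP.
apply: (@gen_mod_qdim _ _ mL _ _ _ N (fun i => toF (g i)));
  first exact: (@cobound_submod _ (fr_cpx F) W n).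
split=> // f fZ.
have /choice[u uE] := fun a : 'I_b => wspan (f (delta_mx 0 a)).
have fE : f = toF (\row_a u a).
  apply/funext => x; rewrite [in LHS](row_sum_delta x) (lin_sum fZ.1) /toF scaler_suml.
  by apply: eq_bigr => a _; rewrite (linZ fZ.1) uE scalerA mxE.
have [|a /eqP] := gspan (\row_a u a); first by rewrite /A -fE.
rewrite subr_eq0 => /eqP uaE; exists a.
suff -> : f = \sum_i a i *: toF (g i).
  by rewrite subrr; exact: (sub0 (@cobound_submod _ (fr_cpx F) W n)).
rewrite fE uaE; elim/big_rec2: _ => [|i y1 y2 _ <-]; last exact: toF_lin.
by apply/funext => x; rewrite /toF big1 ?scale0r // => c _; rewrite mxE mulr0.
Qed.

(** The differentials of [F] induce zero maps on [Hom (F, R / m)]. *)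
Lemma hdim_minimal (V W : lmodType R) (F : free_res m V) (w : W) n :
  (forall v, exists a, v = a *: w) -> (forall a, a *: w = 0 <-> m a) ->
  hdim m (fr_cpx F) W n (fr_rank F n).
Proof.
move=> wspan wann; have mW a v : m a -> a *: v = 0 :> W.
  by move=> ma; have [c ->] := wspan v; rewrite scalerA mulrC -scalerA (proj2 (wann a)) ?scaler0.
set b := fr_rank F n.
have d0 k (f : 'rV[R]_(fr_rank F k) -> W) (x : 'rV_(fr_rank F k.+1)) :
    linear f -> f (x *m fr_mx F k) = 0.
  move=> fL; rewrite [X in f X]row_sum_delta (lin_sum fL) big1 // => a _.
  rewrite (linZ fL) mW // mxE; apply: (local_sum mL) => c.
  by apply: (localM mL); exact: fr_min.
have cob0 k (f : fr_cpx F k.+1 -> W) : cobound f -> forall x, f x = 0.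
  by case: k f => [|k] f /= => [f0|[h hL hE] x]; [exact: f0|rewrite hE; exact: d0].
exists (fun a (x : 'rV[R]_b) => x 0 a *: w); first split.
- move=> a; have L : linear (fun x : 'rV[R]_b => x 0 a *: w).
    exact: (linear_scaler w (@linear_entry _ _ a)).
  by split=> // y; exact: (d0 n (fun x => x 0 a *: w)).
- move=> f [fL _]; have /choice[u uE] := fun a : 'I_b => wspan (f (delta_mx 0 a)).
  exists u; suff -> : f = \sum_a u a *: (fun x : 'rV[R]_b => x 0 a *: w).
    by rewrite subrr; exact: (sub0 (@cobound_submod _ (fr_cpx F) W n)).
  apply/funext => x; rewrite fct_combE [in LHS](row_sum_delta x) (lin_sum fL).
  by apply: eq_bigr => a _; rewrite (linZ fL) uE !scalerA mulrC.
move=> c cB a; apply/wann.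
have -> : c a *: w = (\sum_a c a *: (fun x : 'rV[R]_b => x 0 a *: w)) (delta_mx 0 a).
  rewrite fct_combE (bigD1 a) //= mxE !eqxx scale1r big1 ?addr0 // => j /negPf ja.
  by rewrite mxE eqxx ja scale0r scaler0.
exact: (cob0 n _ cB).
Qed.

(** Since some resolution vanishes in degree [j], the identity of [F j] is
    [d s + s d] for a homotopy [s]; but the entries of [d] are in [m]. *)
Lemma pd_rank (V : lmodType R) (F : free_res m V) p :
  pd_le V p -> forall j, (p < j)%N -> fr_rank F j = 0%N.
Proof.
move=> [P P0] [//|j] pj.
have [v|v|f [g [s [t E]]]] := @comparison R (fr_cpx F) (res_cpx P) id id
  (@fr_proj _ _ _ F) (@fr_acyclic _ _ _ F) (@res_proj _ _ P) (@res_acyclic _ _ P)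
  (@linear_id _ _) (@linear_id _ _) (fun=> erefl) (fun=> erefl).
- exact: res_aug_surj.
- exact: fr_surj.
case rE : (fr_rank F j.+1) => [//|r].
have i0 : 'I_(fr_rank F j.+1) by rewrite rE; exact: ord0.
have mD k (y : 'rV[R]_(fr_rank F k.+1)) c : m ((y *m fr_mx F k) 0 c).
  rewrite mxE; apply: (local_sum mL) => a; apply: (localM mL); exact: fr_min.
have eE := @equiv_s _ _ _ _ _ _ _ E j.+1 (delta_mx 0 i0).
have m1 : m ((delta_mx 0 i0 - 0 : 'rV[R]_(fr_rank F j.+1)) 0 i0).
  rewrite -(lin0 ((equiv_g E).1 j.+2)) -(P0 _ pj (f j.+2 (delta_mx 0 i0))) eE /= mxE.
  apply: (localD mL); first exact: mD.
  have sL := @equiv_sL _ _ _ _ _ _ _ E j.+1.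
  move: (delta_mx 0 i0 *m _) (mD j (delta_mx 0 i0)) => y my.
  rewrite [X in s _ X]row_sum_delta (lin_sum sL) summxE.
  apply: (local_sum mL) => c; rewrite (linZ sL) mxE; exact: (localMl mL).
by case: (local_proper mL); move: m1; rewrite !mxE !eqxx subr0.
Qed.

End Finiteness.

(** * Krull's height theorem *)

Section Primes.
Context {R : comNzRingType}.
Implicit Types p q I J : R -> Prop.

Record primeP p : Prop := PrimeP {
  prime_ideal : idealP p;
  prime_proper : ~ p 1;
  primeM : forall x y, p (x * y) -> p x \/ p y
}.

Definition subP p q := forall x, p x -> q x.
Definition strict p q := subP p q /\ exists2 x, q x & ~ p x.

Lemma ideal0 I : idealP I -> I 0. Proof. by case. Qed.
Lemma idealD I x y : idealP I -> I x -> I y -> I (x + y).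
Proof. by move=> IP; exact: (@subD R R^o I IP). Qed.
Lemma idealB I x y : idealP I -> I x -> I y -> I (x - y).
Proof. by move=> IP; exact: (@subB R R^o I IP). Qed.
Lemma idealM I a x : idealP I -> I x -> I (a * x).
Proof. by move=> IP; exact: (@subZ R R^o I IP). Qed.
Lemma ideal_sum I n (F : 'I_n -> R) : idealP I -> (forall i, I (F i)) -> I (\sum_i F i).
Proof. by move=> IP; exact: (@sub_sum R R^o I IP). Qed.
Lemma idealP_intro I : I 0 -> (forall x y, I x -> I y -> I (x + y)) ->
  (forall a x, I x -> I (a * x)) -> idealP I.
Proof. by move=> I0 ID IM; split=> // a x y Ix Iy; apply: ID => //; apply: IM. Qed.

Lemma not_primeM p x y : primeP p -> ~ p x -> ~ p y -> ~ p (x * y).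
Proof. by move=> pP px py /(primeM pP)[]. Qed.

Definition adjoin I x z := exists a y, I y /\ z = y + a * x.

Lemma adjoin_ideal I x : idealP I -> idealP (adjoin I x).
Proof.
move=> IP; apply: idealP_intro.
- by exists 0, 0; rewrite mul0r addr0; split=> //; exact: ideal0.
- move=> _ _ [a [y [Iy ->]]] [c [z [Iz ->]]]; exists (a + c), (y + z).
  by split; [exact: idealD|rewrite mulrDl addrACA].
- move=> c _ [a [y [Iy ->]]]; exists (c * a), (c * y).
  by split; [exact: idealM|rewrite mulrDr mulrA].
Qed.

Lemma adjoin_sub I x : subP I (adjoin I x).
Proof. by move=> z Iz; exists 0, z; rewrite mul0r addr0. Qed.

Lemma adjoin_mem I x : idealP I -> adjoin I x x.
Proof. by move=> IP; exists 1, 0; rewrite mul1r add0r; split=> //; exact: ideal0. Qed.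

(** The contraction of the localization of [I] at [p]. *)
Definition sat p I x := exists2 s, ~ p s & I (s * x).

Lemma sat_ideal p I : primeP p -> idealP I -> idealP (sat p I).
Proof.
move=> pP IP; apply: idealP_intro.
- by exists 1; [exact: prime_proper|rewrite mulr0; exact: ideal0].
- move=> x y [s ps Isx] [t pt Ity]; exists (s * t); first exact: not_primeM.
  rewrite mulrDr; apply: idealD => //; last by rewrite -mulrA; exact: idealM.
  by rewrite mulrAC mulrC; exact: idealM.
- by move=> a x [s ps Isx]; exists s => //; rewrite mulrCA; exact: idealM.
Qed.

Lemma sat_sub p I : primeP p -> subP I (sat p I).
Proof. by move=> pP x Ix; exists 1; [exact: prime_proper|rewrite mul1r]. Qed.

Lemma sat_sat p I x s : primeP p -> ~ p s -> sat p I (s * x) -> sat p I x.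
Proof.
move=> pP ps [t pt It]; exists (t * s); first exact: not_primeM.
by rewrite -mulrA.
Qed.

Lemma sat_mono p I J : subP I J -> subP (sat p I) (sat p J).
Proof. by move=> IJ x [s ps /IJ Js]; exists s. Qed.

Context (noeth : noethP R).

(** Nakayama's lemma for [A / B] over the localization at [p]. The generators of [A]
    are eliminated one by one. *)
Lemma nakayama_sat p (A B : R -> Prop) : primeP p -> idealP A -> idealP B ->
  (forall a, A a -> exists s b v, [/\ ~ p s, B b, @mulP R p R^o A v & s * a = b + v]) ->
  subP A (sat p B).
Proof.
move=> pP AP BP AAp.
have [n [g [Ag gspan]]] := noeth AP.
have : forall z, A z -> exists s b (e : 'I_n -> R),
    [/\ ~ p s, B b & s * z = b + \sum_i e i * g i].
  move=> z /gspan[e /eqP]; rewrite subr_eq0 => /eqP zE; exists 1, 0, e.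
  by rewrite mul1r add0r; split=> //; [exact: prime_proper|exact: ideal0].
elim: n g Ag {gspan} => [|n IHn] g Ag gen.
  move=> z /gen[s [b [e [ps Bb sz]]]]; exists s => //.
  by rewrite sz big_ord0 addr0.
(* the elements that are, over the localization, combinations with coefficients in p *)
pose G z := exists s b (e : 'I_n.+1 -> R),
  [/\ ~ p s, B b, forall i, p (e i) & s * z = b + \sum_i e i * g i].
have GD x y : G x -> G y -> G (x + y).
  move=> [s [b [e [ps Bb pe sx]]]] [t [c [f [pt Bc pf ty]]]].
  exists (s * t), (t * b + s * c), (fun i => t * e i + s * f i); split.
  - exact: not_primeM.
  - by apply: idealD => //; apply: idealM.
  - by move=> i; apply: (idealD (prime_ideal pP)); apply: (idealM _ (prime_ideal pP)).
  - under eq_bigr do rewrite mulrDl -!mulrA.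
    rewrite big_split /= -!mulr_sumr mulrDr.
    transitivity (t * (s * x) + s * (t * y)); first by ring.
    by rewrite sx ty; ring.
have GM c y : p c -> A y -> G (c * y).
  move=> pc /gen[s [b [e [ps Bb sy]]]]; exists s, (c * b), (fun i => c * e i); split=> //.
  - exact: idealM.
  - by move=> i; rewrite mulrC; apply: (idealM _ (prime_ideal pP)).
  - under eq_bigr do rewrite -mulrA.
    by rewrite -mulr_sumr mulrCA sy mulrDr.
have GB b : B b -> G b.
  move=> Bb; exists 1, b, (fun=> 0); split=> //; first exact: prime_proper.
    by move=> _; exact: (ideal0 (prime_ideal pP)).
  by rewrite mul1r big1 ?addr0 // => i _; rewrite mul0r.
have [s [b [v [ps Bb [k [c [y [pc Ay vE]]]] sg]]]] := AAp _ (Ag ord0).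
have : G (s * g ord0).
  rewrite sg vE; apply: (GD _ _); first exact: (GB _ Bb).
  apply: (big_ind G) => [|u w|i _]; [|exact: GD|exact: GM].
  by apply: GB; exact: ideal0.
rewrite /G => -[s' [b' [e [ps' Bb' pe s'E]]]].
have elim0 : (s' * s - e ord0) * g ord0 = b' + \sum_i e (lift ord0 i) * g (lift ord0 i).
  by rewrite mulrBl -mulrA s'E big_ord_recl; ring.
have pse : ~ p (s' * s - e ord0).
  move=> pse; apply: (not_primeM pP ps' ps); rewrite -(subrK (e ord0) (s' * s)).
  exact: (idealD (prime_ideal pP)).
apply: (IHn (fun i => g (lift ord0 i))) => // z /gen[t [d [f [pt Bd tz]]]].
exists ((s' * s - e ord0) * t), ((s' * s - e ord0) * d + f ord0 * b'),
  (fun i => (s' * s - e ord0) * f (lift ord0 i) + f ord0 * e (lift ord0 i)); split.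
- exact: not_primeM.
- by apply: idealD => //; apply: idealM.
under eq_bigr do rewrite mulrDl -!mulrA.
rewrite big_split /= -!mulr_sumr -mulrA tz big_ord_recl.
transitivity ((s' * s - e ord0) * d + f ord0 * ((s' * s - e ord0) * g ord0)
  + (s' * s - e ord0) * \sum_(i < n) f (lift ord0 i) * g (lift ord0 i)); first by ring.
by rewrite elim0; ring.
Qed.

Section PrincipalIdeal.
Context {p0 p1 p2 : R -> Prop} (p0P : primeP p0) (p1P : primeP p1) (p2P : primeP p2).
Context (p01 : strict p0 p1) (p12 : strict p1 p2) {x : R} (p2x : p2 x) (p1x : ~ p1 x).
Context (minimal : forall q, primeP q -> subP p0 q -> q x -> subP q p2 -> subP p2 q).

(** The ring [R / (p0 + (x))] localized at [p2] is artinian: a descending sequence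
    of its ideals is stationary. The largest ideal [V] on which the
    sequence is stationary cannot be proper, for otherwise some [v] outside [V] has
    [p2 v] inside [V], because the maximal annihilators of nonzero elements of [R / V]
    are primes between [p0 + (x)] and [p2]; and the sequence is stationary
    on [V + R v] as well. *)
Lemma artinian_stationary (J : nat -> R -> Prop) :
  (forall n, idealP (J n)) -> (forall n, subP (J n.+1) (J n)) ->
  (forall n, subP (adjoin p0 x) (J n)) ->
  (forall n s a, ~ p2 s -> J n (s * a) -> J n a) ->
  exists N, subP (J N) (J N.+1).
Proof.
move=> JP Jdec Jx Jsat.
have Jle n k : (k <= n)%N -> subP (J n) (J k).
  move=> /subnK <-; elim: (n - k)%N => [//|d IHd] a /Jdec; exact: IHd.
pose good V := [/\ idealP V, subP (adjoin p0 x) V,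
  forall s a, ~ p2 s -> V (s * a) -> V a &
  exists N, forall n a, (N <= n)%N -> V a -> J N a -> J n a].
have I0P := adjoin_ideal x (prime_ideal p0P).
have [|V [VP V0 Vsat [N NP]] Vmax] := noeth_max noeth (F := good)
    (I0 := sat p2 (adjoin p0 x)) _ (fun J H => let: And4 a _ _ _ := H in a).
  split; [exact: sat_ideal|exact: sat_sub|by move=> s a; exact: sat_sat|].
  by exists 0%N => n a _ [s ps Is] _; apply: (Jsat n s a ps); exact: Jx.
have [V1|V1] := pselect (V 1).
  have VT a : V a by rewrite -[a]mulr1; exact: idealM.
  by exists N => a; apply: NP.
exfalso.
pose ann v a := V (a * v).
have annP v : idealP (ann v).
  apply: idealP_intro; rewrite /ann.
  - by rewrite mul0r; exact: ideal0.
  - by move=> a c; rewrite mulrDl; exact: idealD.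
  - by move=> a c; rewrite -mulrA; exact: idealM.
have [||A [v Vv AE] Amax] := noeth_max noeth
    (F := fun A => exists2 v, ~ V v & A = ann v) (I0 := ann 1).
- by exists 1.
- by move=> A [v _ ->].
subst A.
have annprime : primeP (ann v).
  split=> //; first by rewrite /ann mul1r.
  move=> a c Vac; have [Vcv|Vcv] := pselect (V (c * v)); [by right|left].
  apply: (Amax (ann (c * v))); first by exists (c * v).
    by move=> t; rewrite /ann mulrCA; exact: idealM.
  by rewrite /ann mulrA.
have p2v : subP p2 (ann v).
  apply: minimal => //.
  - by move=> a p0a; rewrite /ann mulrC; apply: idealM => //; apply: V0; apply: adjoin_sub.
  - rewrite /ann mulrC; apply: idealM => //; apply: V0; apply: adjoin_mem.
    exact: prime_ideal.
  - by move=> a Va; apply: contrapT => p2a; apply: Vv; apply: Vsat Va.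
pose V' := sat p2 (adjoin V v).
apply: Vv; apply: (Vmax V').
- have V'P : idealP V' by apply: sat_ideal => //; exact: adjoin_ideal.
  have V'V : subP V V' by move=> a Va; apply: sat_sub => //; exact: adjoin_sub.
  split=> //; [by move=> a /V0/V'V|by move=> s a; exact: sat_sat|].
  pose phi n := exists s w, [/\ ~ p2 s, V w & J n (s * v + w)].
  have phi_dec n k : (k <= n)%N -> phi n -> phi k.
    by move=> kn [s [w [ps Vw Jn]]]; exists s, w; split=> //; apply: Jle Jn.
  have [N' N'P] : exists N', forall n, (N' <= n)%N -> phi N' -> phi n.
    have [allphi|] := pselect (forall n, phi n); first by exists 0%N.
    by move=> /existsNP[k nphik]; exists k => n _ /nphik.
  exists (maxn N N') => n a; rewrite geq_max => /andP[Nn N'n] [t pt [r [w [Vw ta]]]] Ja.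
  have VJ b : V b -> J (maxn N N') b -> J n b.
    by move=> Vb /(Jle _ _ (leq_maxl N N')); apply: NP.
  have [p2r|p2r] := pselect (p2 r).
    apply: VJ => //; apply: (Vsat t) => //; rewrite ta; apply: idealD => //; exact: p2v.
  have phiM : phi (maxn N N').
    exists r, w; split=> //; rewrite addrC -ta; exact: (idealM _ (JP _)).
  have [s [w' [ps Vw' Jn]]] := N'P n N'n (phi_dec _ _ (leq_maxr N N') phiM).
  have JM : J (maxn N N') (s * v + w') by apply: Jle Jn; rewrite geq_max Nn.
  have : J n (s * w - r * w').
    apply: VJ; first by apply: idealB => //; apply: idealM.
    rewrite (_ : _ - _ = s * (t * a) - r * (s * v + w')); last by rewrite ta; ring.
    by apply: idealB => //; apply: idealM => //; apply: idealM.
  move=> Jd; apply: (Jsat n (s * t)); first exact: not_primeM.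
  rewrite (_ : s * t * a = (s * w - r * w') + r * (s * v + w')).
    by apply: idealD => //; apply: idealM.
  by rewrite -mulrA ta; ring.
- by move=> a Va; apply: sat_sub => //; exact: adjoin_sub.
- by apply: sat_sub => //; exact: adjoin_mem.
Qed.

(** Inverse images of the symbolic powers of the prime [p1 / p0] of [R / p0]. *)
Fixpoint symbolic n : R -> Prop :=
  if n is n'.+1 then
    sat p1 (fun z => exists2 u, p0 u & exists2 v, @mulP R p1 R^o (symbolic n') v & z = u + v)
  else fun=> True.

Lemma mulP_ideal I A : idealP A -> idealP (@mulP R I R^o A).
Proof.
move=> AP; apply: idealP_intro.
- by exists 0%N, (fun=> 0), (fun=> 0); split; [case|case|rewrite big_ord0].
- move=> _ _ [n1 [c1 [y1 [I1 A1 ->]]]] [n2 [c2 [y2 [I2 A2 ->]]]].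
  exists (n1 + n2)%N, (join c1 c2), (join y1 y2).
  by split; [exact: joinP|exact: joinP|rewrite sum_join2].
- move=> a _ [n [c [y [Ic Ay ->]]]]; exists n, c, (fun i => a * y i); split=> //.
    by move=> i; exact: idealM.
  by rewrite mulr_sumr; apply: eq_bigr => i _; exact: mulrCA.
Qed.

Lemma mulP_mono I (A A' : R -> Prop) : subP A A' -> subP (@mulP R I R^o A) (@mulP R I R^o A').
Proof.
by move=> AA' v [n [c [y [Ic Ay ->]]]]; exists n, c, y; split=> // i; apply: AA'.
Qed.

Lemma symbolic_ideal n : idealP (symbolic n).
Proof.
elim: n => [|n IHn]; first by split.
apply: sat_ideal => //; have MP := mulP_ideal p1 IHn; apply: idealP_intro.
- exists 0; first exact: (ideal0 (prime_ideal p0P)).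
  by exists 0; [exact: ideal0|rewrite addr0].
- move=> _ _ [u1 pu1 [v1 Mv1 ->]] [u2 pu2 [v2 Mv2 ->]].
  exists (u1 + u2); first exact: (idealD (prime_ideal p0P)).
  by exists (v1 + v2); [exact: (idealD MP)|rewrite addrACA].
- move=> a _ [u pu [v Mv ->]]; exists (a * u); first exact: (idealM _ (prime_ideal p0P)).
  by exists (a * v); [exact: (idealM _ MP)|rewrite mulrDr].
Qed.

Lemma symbolic_sat n s a : ~ p1 s -> symbolic n (s * a) -> symbolic n a.
Proof. by case: n => // n ps; apply: sat_sat. Qed.

Lemma symbolic_p0 n : subP p0 (symbolic n).
Proof.
case: n => // n a p0a; apply: sat_sub => //; exists a => //; exists 0; last by rewrite addr0.
exact: (ideal0 (mulP_ideal _ (symbolic_ideal n))).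
Qed.

Lemma symbolic_dec n : subP (symbolic n.+1) (symbolic n).
Proof.
elim: n => // n IHn a [s ps [u pu [v Mv sa]]]; exists s => //; exists u => //; exists v => //.
exact: mulP_mono Mv.
Qed.

Lemma symbolic_pow n y : p1 y -> symbolic n (y ^+ n).
Proof.
move=> p1y; elim: n => // n IHn; apply: sat_sub => //.
exists 0; first exact: (ideal0 (prime_ideal p0P)).
exists (y ^+ n.+1); last by rewrite add0r.
by exists 1%N, (fun=> y), (fun=> y ^+ n); split=> //; rewrite big_ord1 exprS.
Qed.

(** Krull's principal ideal theorem. The symbolic powers of [p1] are stationary modulo
    [x], hence by Nakayama's lemma stationary, and again by Nakayama's lemma
    they end up in [p0]; but no power of an element outside [p0] lies in [p0]. *)
Lemma principal_ideal_theorem : False.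
Proof.
have symx_ideal n : idealP (adjoin (symbolic n) x).
  by apply: adjoin_ideal; exact: symbolic_ideal.
have np2 s : ~ p2 s -> ~ p1 s by move=> ps /(p12.1 _).
have [|||n s a|N NP] := @artinian_stationary (fun n => sat p2 (adjoin (symbolic n) x)).
- by move=> n; exact: sat_ideal.
- by move=> n; apply: sat_mono => _ [a [y [/symbolic_dec sy ->]]]; exists a, y.
- move=> n _ [a [y [py ->]]]; apply: sat_sub => //; exists a, y; split=> //.
  exact: symbolic_p0.
- exact: sat_sat.
have step1 : subP (symbolic N) (sat p2 (symbolic N.+1)).
  apply: nakayama_sat => //; try exact: symbolic_ideal.
  move=> a Na; have [s ps [r [b [Sb sa]]]] : sat p2 (adjoin (symbolic N.+1) x) a.
    by apply: NP; apply: sat_sub => //; exact: adjoin_sub.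
  exists s, b, (r * x); split=> //.
  exists 1%N, (fun=> x), (fun=> r); split=> //; last by rewrite big_ord1; exact: mulrC.
  move=> _; apply: (symbolic_sat p1x); rewrite (_ : x * r = s * a - b).
    apply: (idealB (symbolic_ideal N)); last exact: symbolic_dec.
    exact: (idealM _ (symbolic_ideal N)).
  by rewrite sa; ring.
have step2 : subP (symbolic N) (sat p1 p0).
  apply: nakayama_sat => //; [exact: symbolic_ideal|exact: prime_ideal|].
  move=> a /step1[s ps /(symbolic_sat (np2 s ps))[t pt [u pu [v Mv ta]]]].
  by exists t, u, v.
have [y p1y p0y] := p01.2.
have [s ps p0sy] := step2 _ (symbolic_pow N p1y).
have p0yn n : ~ p0 (y ^+ n).
  by elim: n => [|n IHn]; [exact: prime_proper|rewrite exprS; exact: not_primeM].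
by case: (primeM p0P p0sy) => [/p01.1|/p0yn].
Qed.

End PrincipalIdeal.

(** If no prime strictly below [p2] contains [x] and [p0], then [p2] is minimal over
    [p0 + (x)], which the principal ideal theorem excludes. *)
Lemma prime_exchange p0 p1 p2 x : primeP p0 -> primeP p1 -> primeP p2 ->
  strict p0 p1 -> strict p1 p2 -> p2 x ->
  exists q, [/\ primeP q, strict p0 q, strict q p2 & q x].
Proof.
move=> p0P p1P p2P p01 p12 p2x.
have [p1x|p1x] := pselect (p1 x); first by exists p1.
apply: contrapT => none; apply: (principal_ideal_theorem p0P p1P p2P p01 p12 p2x p1x).
move=> q qP p0q qx qp2; apply: contrapT => /existsNP[y /not_implyP[p2y qy]].
apply: none; exists q; split=> //; last by split=> //; exists y.
by split=> //; exists x => // /(p01.1 _).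
Qed.

Definition chainP d (p : nat -> R -> Prop) :=
  (forall i, (i <= d)%N -> primeP (p i)) /\ (forall i, (i < d)%N -> strict (p i) (p i.+1)).

Definition extend_chain d (c : nat -> R -> Prop) q i := if (i <= d)%N then c i else q.

Lemma extend_chainP d (c : nat -> R -> Prop) q : chainP d c -> primeP q ->
  strict (c d) q -> chainP d.+1 (extend_chain d c q).
Proof.
move=> [cP cs] qP cq; split=> i id; rewrite /extend_chain.
  by case: leqP => // {}id; exact: cP.
rewrite ltnS in id; rewrite id; case: ltnP => [|di]; first exact: cs.
by rewrite (_ : i = d) //; apply/eqP; rewrite eqn_leq id.
Qed.

(** From the top down, each prime is exchanged for one that contains [x], at the
    cost of the lowest one. *)
Lemma chain_shift d (c : nat -> R -> Prop) x : chainP d.+1 c -> c d.+1 x ->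
  exists c', [/\ chainP d c', c' d = c d.+1, subP (c 0%N) (c' 0%N) & c' 0%N x].
Proof.
elim: d c => [|d IHd] c [cP cs] cx.
  exists (fun=> c 1%N); split=> //; last by case: (cs 0%N).
  by split=> // i _; exact: cP.
have [q [qP cq qc qx]] : exists q,
    [/\ primeP q, strict (c d) q, strict q (c d.+2) & q x].
  apply: (@prime_exchange (c d) (c d.+1) (c d.+2)) => //.
  - by apply: cP; rewrite leqW // leqW.
  - exact: cP.
  - exact: cP.
  - by apply: cs; rewrite ltnS leqW.
  - exact: cs.
have c'P : chainP d.+1 (extend_chain d c q).
  apply: extend_chainP => //; split=> i id; first by apply: cP; rewrite leqW // leqW.
  by apply: cs; rewrite leqW // leqW.
have [|r [rP rq cr rx]] := IHd _ c'P; first by rewrite /extend_chain ltnn.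
rewrite /extend_chain ltnn in rq.
exists (extend_chain d r (c d.+2)); split=> //.
- by apply: (extend_chainP rP (cP _ (leqnn _))); rewrite rq.
- by rewrite /extend_chain ltnn.
Qed.

Lemma chain_shifts (s : seq R) d (c : nat -> R -> Prop) : chainP (size s + d) c ->
  (forall x, x \in s -> c (size s + d)%N x) ->
  exists c', [/\ chainP d c', c' d = c (size s + d)%N, subP (c 0%N) (c' 0%N) &
    forall x, x \in s -> c' 0%N x].
Proof.
elim: s c => [|y s IHs] c cP cx; first by exists c; split.
have [|q [qP qc c0q q0y]] := @chain_shift (size s + d) c y cP.
  exact: (cx y (mem_head _ _)).
have [|r [rP rq q0r rx]] := IHs q qP.
  by move=> x xs; rewrite qc; apply: cx; rewrite inE xs orbT.
exists r; split=> //; first by rewrite rq.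
  by move=> x /c0q/q0r.
by move=> x; rewrite inE => /predU1P[->|/rx//]; exact: q0r.
Qed.

(** Pushing a chain of length [e] + 1 above all the generators leaves a chain of
    length 1 whose first member contains [m]. *)
Lemma krull_height (m : R -> Prop) (mL : localP m) e (g : 'I_e -> R) c :
  (forall x, m x -> exists a : 'I_e -> R, x = \sum_i a i * g i) ->
  (forall i, m (g i)) -> ~ chainP e.+1 c.
Proof.
move=> gspan mg [cP cs].
have pm p : primeP p -> subP p m.
  move=> pP x px; apply: contrapT => /(local_unit mL)[b bx].
  by apply: (prime_proper pP); rewrite -bx; exact: (idealM _ (prime_ideal pP)).
have mP : primeP m.
  split; [exact: (local_ideal mL)|exact: (local_proper mL)|move=> x y mxy].
  apply: contrapT => /not_orP[/(local_unit mL)[a ax] /(local_unit mL)[b bY]].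
  apply: (local_proper mL); rewrite -(mulr1 1) -[X in X * _]ax -bY mulrACA.
  exact: (localM mL).
have sz : size (codom g) = e by rewrite size_codom card_ord.
have c'P : chainP (size (codom g) + 1) (extend_chain e c m).
  rewrite sz addn1; apply: extend_chainP => //.
    by split=> i ie; [apply: cP; exact: leqW|apply: cs; exact: leqW].
  have [cc [x cx ncx]] := cs e (ltnSn e).
  split; first by apply: pm; apply: cP; exact: leqnSn.
  by exists x => //; exact: (pm _ (cP _ (leqnn _))).
have [|q [qP q1 _ q0]] := chain_shifts c'P.
  move=> x; rewrite sz addn1 /extend_chain ltnn => /codomP[i ->]; exact: mg.
have [_ [x q1x q0x]] := qP.2 0%N isT; apply: q0x.
have : m x by move: q1x; rewrite q1 sz addn1 /extend_chain ltnn.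
move=> /gspan[a ->]; apply: ideal_sum => [|i]; first exact: (prime_ideal (qP.1 0%N _)).
apply: idealM; first exact: (prime_ideal (qP.1 0%N _)).
by apply: q0; exact: codom_f.
Qed.

End Primes.

(** * Nonzero divisors outside the square of the maximal ideal *)

Section PrimeAvoidance.
Context {R : comNzRingType} {m : R -> Prop} (mL : localP m) (noeth : noethP R).

Definition regular_elt (x : R) := forall y, x * y = 0 -> y = 0.

Lemma ann_ideal (z : R) : idealP (fun a => a * z = 0).
Proof.
apply: idealP_intro => [|a b az bz|a b bz]; first exact: mul0r.
  by rewrite mulrDl az bz addr0.
by rewrite -mulrA bz mulr0.
Qed.

Definition max_ann (z : R) := z <> 0 /\ forall w, w <> 0 ->
  (forall a, a * z = 0 -> a * w = 0) -> forall a, a * w = 0 -> a * z = 0.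

(** For [y z <> 0] the annihilator of [y z] contains that of [z]. *)
Lemma max_ann_prime z : max_ann z -> primeP (fun a => a * z = 0).
Proof.
move=> [z0 zmax]; split; [exact: ann_ideal|by rewrite mul1r|move=> x y xyz].
have [yz|yz] := pselect (y * z = 0); [by right|left].
apply: (zmax (y * z)) => //; last by rewrite mulrA.
by move=> a az; rewrite mulrCA az mulr0.
Qed.

Lemma max_ann_exists w : w <> 0 ->
  exists2 z, max_ann z & forall a, a * w = 0 -> a * z = 0.
Proof.
move=> w0; have [||I [z [z0 wz ->]] Imax] := noeth_max noeth
  (F := fun I => exists z, [/\ z <> 0, forall a, a * w = 0 -> a * z = 0 &
    I = fun a => a * z = 0]) (I0 := fun a => a * w = 0).
- by exists w.
- by move=> I [z [_ _ ->]]; exact: ann_ideal.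
exists z => //; split=> // w' w'0 zw' a aw'.
apply: (Imax (fun a => a * w' = 0)) => //; exists w'; split=> // b bw.
by apply: zw'; apply: wz.
Qed.

(** Finitely many of these elements generate all the others. The annihilator of any of
    them then contains the intersection of finitely many of these prime ideals, hence
    one of them, and is equal to it. *)
Lemma max_ann_finite : exists zs : seq R, (forall z, z \in zs -> max_ann z) /\
  forall z, max_ann z -> exists2 z', z' \in zs & forall a, a * z' = 0 <-> a * z = 0.
Proof.
pose gen (zs : seq R) := foldr (fun z I => adjoin I z) (fun a : R => a = 0) zs.
have genP zs : idealP (gen zs).
  elim: zs => [|z zs IH] /=; last exact: adjoin_ideal.
  by split=> // a x y -> ->; rewrite scaler0 addr0.
have [||I [zs [zsP ->]] Imax] := noeth_max noeth
  (F := fun I => exists zs, (forall z, z \in zs -> max_ann z) /\ I = gen zs)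
  (I0 := gen [::]).
- by exists [::].
- by move=> I [zs [_ ->]].
exists zs; split=> // z zP.
have zgen : gen zs z.
  apply: (Imax (gen (z :: zs))); last exact: adjoin_mem.
    by exists (z :: zs); split=> // y; rewrite inE => /predU1P[->|/zsP].
  exact: adjoin_sub.
have zpr := max_ann_prime zP.
have : exists2 z', z' \in zs & forall a, a * z' = 0 -> a * z = 0.
  have killed : forall a, (forall z', z' \in zs -> a * z' = 0) -> a * z = 0.
    move=> a; move: (z) zgen; elim: (zs) => [|y ys IH] u /=; first by move=> -> _; rewrite mulr0.
    move=> [c [v [gv ->]]] aK; rewrite mulrDr IH //; last first.
      by move=> z' z'ys; apply: aK; rewrite inE z'ys orbT.
    by rewrite mulrCA aK ?mulr0 ?addr0 // mem_head.
  apply: contrapT => none; have : exists2 a, a * z <> 0 & forall z', z' \in zs -> a * z' = 0.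
    have {}none z' : z' \in zs -> exists2 a, a * z' = 0 & a * z <> 0.
      move=> z'zs; apply: contrapT => no; apply: none; exists z' => // a az'.
      by apply: contrapT => az; apply: no; exists a.
    elim: (zs) none => [|y ys IH] none; first by exists 1; [exact: (prime_proper zpr)|].
    have [|a az aK] := IH; first by move=> z' z'ys; apply: none; rewrite inE z'ys orbT.
    have [b bY bz] := none y (mem_head _ _).
    exists (a * b); first exact: (not_primeM zpr).
    move=> z'; rewrite inE => /predU1P[->|/aK az']; first by rewrite -mulrA bY mulr0.
    by rewrite mulrAC az' mul0r.
  by move=> [a az /killed].
move=> [z' z'zs z'z]; exists z' => // a; split; first exact: z'z.
by apply: (zsP z' z'zs).2 => //; case: zP.
Qed.

Definition in_square x := @mulP R m R^o m x.

(** The zero divisors are the elements of the finitely many primes of [max_ann_finite].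
    These are avoided one after the other: if [x] lies in the next one, it is
    corrected by an element of [m^2] that lies in the previous ones but not in
    this one. *)
Lemma regular_elt_exists :
  (forall z, (forall a, m a -> a * z = 0) -> z = 0) ->
  (exists2 x, m x & ~ in_square x) ->
  exists x, [/\ m x, ~ in_square x & regular_elt x].
Proof.
move=> depth [x0 mx0 x0sq].
have sqP : idealP in_square := mulP_ideal m (local_ideal mL).
have [zs [zsP zsall]] := max_ann_finite.
suff [x [mx xsq xz]] : exists x, [/\ m x, ~ in_square x & forall z, z \in zs -> x * z <> 0].
  exists x; split=> // y xy; apply: contrapT => y0.
  have [z zP yz] := max_ann_exists y0; have [z' z'zs z'z] := zsall z zP.
  by apply: (xz z' z'zs); apply/z'z; apply: yz.
elim: zs zsP {zsall} => [|z zs IH] zsP; first by exists x0.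
have zsP' y : y \in zs -> max_ann y by move=> yzs; apply: zsP; rewrite inE yzs orbT.
have [x [mx xsq xz]] := IH zsP'.
have [xz0|xz0] := pselect (x * z = 0); last first.
  by exists x; split=> // y; rewrite inE => /predU1P[->|/xz].
have zP := zsP z (mem_head _ _); have zpr := max_ann_prime zP.
have [y yz yK] : exists2 y, y * z <> 0 & forall z', z' \in zs -> y * z' = 0.
  have sep z' : z' \in zs -> exists2 a, a * z' = 0 & a * z <> 0.
    move=> z'zs; apply: contrapT => no; apply: (xz z' z'zs).
    apply: (zsP' z' z'zs).2 xz0; first by case: zP.
    by move=> a az'; apply: contrapT => az; apply: no; exists a.
  elim: (zs) sep => [|u us IHu] sep; first by exists 1; [exact: (prime_proper zpr)|].
  have [|a az aK] := IHu; first by move=> z' z'us; apply: sep; rewrite inE z'us orbT.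
  have [b bu bz] := sep u (mem_head _ _).
  exists (a * b); first exact: (not_primeM zpr).
  move=> z'; rewrite inE => /predU1P[->|/aK az']; first by rewrite -mulrA bu mulr0.
  by rewrite mulrAC az' mul0r.
have [t mt tz] : exists2 t, m t & t * z <> 0.
  apply: contrapT => no; case: zP => z0 _; apply: z0; apply: depth => a ma.
  by apply: contrapT => az; apply: no; exists a.
have sqt : in_square (t * t * y).
  rewrite mulrC; apply: (idealM y sqP); exists 1%N, (fun=> t), (fun=> t).
  by split=> //; rewrite big_ord1.
exists (x + t * t * y); split.
- apply: (localD mL) => //; apply: (localMl mL); exact: (localM mL).
- by move=> sq; apply: xsq; rewrite -(addrK (t * t * y) x); exact: (idealB sqP).
- move=> z'; rewrite inE => /predU1P[->|z'zs].
    rewrite mulrDl xz0 add0r; apply: (not_primeM zpr) => //; exact: (not_primeM zpr).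
  by rewrite mulrDl -mulrA yK // mulr0 addr0; exact: xz.
Qed.

(** Dividing [a] by [x] again and again enlarges the principal ideal of the quotient,
    so the process ends. *)
Lemma regular_factor x : m x -> regular_elt x -> forall a, a <> 0 ->
  exists i b, a = x ^+ i * b /\ forall t, b <> t * x.
Proof.
move=> mx xreg a a0.
have pI (b : R) : idealP (fun z => exists t, z = t * b).
  apply: idealP_intro; first by exists 0; rewrite mul0r.
    by move=> _ _ [t ->] [u ->]; exists (t + u); rewrite mulrDl.
  by move=> c _ [t ->]; exists (c * t); rewrite mulrA.
have [||I [i [b [aE ->]]] Imax] := noeth_max noeth
  (F := fun I => exists i b, a = x ^+ i * b /\ I = fun z => exists t, z = t * b)
  (I0 := fun z => exists t, z = t * a).
- by exists 0%N, a; rewrite expr0 mul1r.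
- by move=> I [i [b [_ ->]]].
exists i, b; split=> // t bt; have [u tu] : exists u, t = u * b.
  apply: (Imax (fun z => exists u, z = u * t)).
  - by exists i.+1, t; split=> //; rewrite aE bt exprS; ring.
  - by move=> _ [c ->]; exists (c * x); rewrite bt; ring.
  - by exists 1; rewrite mul1r.
have [c cE] := local_1B mL (localM mL u mx).
have t0 : t = 0.
  rewrite -[t]mul1r -cE -mulrA (_ : (1 - u * x) * t = 0) ?mulr0 //.
  by rewrite mulrBl mul1r {1}tu bt; ring.
by apply: a0; rewrite aE bt t0 mul0r mulr0.
Qed.

End PrimeAvoidance.

Lemma idealr_of (R : comNzRingType) (I : R -> Prop) : idealP I -> ~ I 1 ->
  exists K : idealr R, forall x, x \in K <-> I x.
Proof.
move=> IP I1; pose B : {pred R} := fun a => `[< I a >].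
have BP : idealr_closed B.
  split; rewrite -?topredE /=.
  - by apply/asboolP; exact: ideal0.
  - by apply/negP => /asboolP.
  - move=> a x y; rewrite -!topredE /= => /asboolP Ix /asboolP Iy; apply/asboolP.
    by apply: idealD => //; exact: idealM.
exists (HB.pack_for (idealr R) B (isIdealr.Build R B BP)) => x.
by rewrite -topredE /=; split=> /asboolP.
Qed.

Lemma quotient_ring (R : comNzRingType) (I : R -> Prop) : idealP I -> ~ I 1 ->
  exists (R' : comNzRingType) (pi : {rmorphism R -> R'}),
    (forall y, exists a, pi a = y) /\ forall a, pi a = 0 <-> I a.
Proof.
move=> IP I1;
have [K KI] := idealr_of IP I1.
exists {ideal_quot K}, (to_residue K : {rmorphism R -> {ideal_quot K}}).
split=> [y|a]; first by exists (repr y); exact: reprK.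
rewrite -(raddf0 (to_residue K)) /=.
have aE : (a \in K) = (to_residue K a == to_residue K 0).
  by have := Quotient.idealrBE K a 0; rewrite subr0.
by rewrite -KI aE; split=> /eqP.
Qed.

(** * Split cocycles and regularity *)

Section Quotients.
Context {R : comNzRingType}.

Lemma submodClosed_of (V : lmodType R) (A : V -> Prop) : submodP A ->
  exists S : submodClosed V, forall x, x \in S <-> A x.
Proof.
move=> [A0 AL]; pose B : {pred V} := fun x => `[< A x >].
have BP : GRing.submod_closed B.
  split=> [|a x y]; rewrite -!topredE /=; first exact/asboolP.
  by move=> /asboolP Ax /asboolP Ay; apply/asboolP; exact: AL.
pose S := HB.pack_for (submodClosed V) B
  (GRing.isSubmodClosed.Build R V B (GRing.submod_closed_semi BP)).
by exists S => x; rewrite -topredE /=; split=> /asboolP.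
Qed.

Lemma quotmod_proj (V : lmodType R) (S : submodClosed V) :
  exists q : V -> quotmod S, [/\ linear q, forall y, exists x, q x = y &
    forall x, q x = 0 <-> x \in S].
Proof.
pose q (x : V) : quotmod S := \pi_(Quotient.quot (quot_pred S))%qT x.
have qD x y : q (x + y) = q x + q y by exact: raddfD.
have qB x y : (q x = q y) <-> x - y \in S.
  have := Quotient.idealrBE (quot_pred S) x y; rewrite -[_ \in quot_pred S]/(x - y \in S).
  by move=> ->; split=> [/eqP|/eqP].
have qZ a x : q (a *: x) = a *: q x.
  apply/qB; rewrite -scalerBr rpredZ //; apply/qB; exact/esym/reprK.
exists q; split=> [a x y|y|x]; first by rewrite qD qZ.
  by exists (repr y); exact: reprK.
by rewrite -[X in X \in S]subr0 -qB -[X in _ = q X](scale0r (0 : V)) qZ scale0r.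
Qed.

Definition residue_module (m : R -> Prop) (V : lmodType R) :=
  exists v : V, (forall w, exists a, w = a *: v) /\ forall a, a *: v = 0 <-> m a.

Lemma residue_module_killed m V : residue_module m V ->
  forall a (w : V), m a -> a *: w = 0.
Proof.
move=> [v [vspan vann]] a w /vann av; have [b ->] := vspan w.
by rewrite scalerA mulrC -scalerA av scaler0.
Qed.

Lemma residue_module_exists m : idealP m -> exists V, residue_module m V.
Proof.
move=> mP; have [S SP] := @submodClosed_of R^o m mP.
have [q [qL qsurj q0]] := quotmod_proj S.
have qE a : q a = a *: q 1 by rewrite -(linZ qL) -[a in LHS]mulr1.
exists (quotmod S), (q 1); split=> [w|a]; last by rewrite -qE q0 SP.
by have [a <-] := qsurj w; exists a.
Qed.

Lemma null_mod_transfer m (mL : localP m) (X Y : cpx R) f g s t :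
  @equivalence R X Y f g s t -> @null_mod R m Y -> @null_mod R m X.
Proof.
move=> E nullY n c cZ; have [fL fd] := equiv_f E.
have [h hL hE] := nullY n _ (cocyc_comp (equiv_g E) cZ).
have sL := @equiv_sL _ _ _ _ _ _ _ E.
exists (fun x => h (f n x) + c (s n x)).
  exact: (linear_add (linear_comp (fL n) hL) (linear_comp (sL n) cZ.1)).
move=> x; have := hE (f n.+1 x); rewrite fd => mh.
have := @equiv_s _ _ _ _ _ _ _ E n x => /(congr1 c).
rewrite (linB cZ.1) (linD cZ.1) cZ.2 add0r => <-.
by rewrite opprD opprB addrCA [X in _ + X]addrC subrK addrC.
Qed.

End Quotients.

Section Split.
Context {R : comNzRingType} (m : R -> Prop).

(** On a minimal resolution of [R / m], a cocycle that is not a coboundary modulo [m]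
    takes the value [1], so it splits off a free summand from a syzygy of [R / m]. *)
Definition split_cocycle := exists X : cpx R,
  [/\ projC X, acyclic X, forall v, exists x, cdiff X 0 x = v,
      residue_module m (X 0%N) & ~ @null_mod R m X].

(** The choice of the resolution does not matter. *)
Lemma split_cocycle_not_null (mL : localP m) : split_cocycle ->
  exists2 V : lmodType R, residue_module m V &
    forall X : cpx R, forall (f : V -> X 0%N) (g : X 0%N -> V),
      linear f -> linear g -> cancel f g -> cancel g f ->
      projC X -> acyclic X -> (forall v, exists x, cdiff X 0 x = v) ->
      ~ @null_mod R m X.
Proof.
move=> [X [projX acX surjX Xres Xnull]]; exists (X 0%N) => // Y f g fL gL fK gK projY acY surjY nullY.
have [v|v|f' [g' [s [t E]]]] := @comparison R X Y f g projX acX projY acY fL gL fK gK.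
- exact: surjY.
- exact: surjX.
by apply: Xnull; exact: null_mod_transfer E nullY.
Qed.

(** As [z] kills [m], multiplication by [z] turns the basis elements of a minimal
    resolution into cycles, that is, into boundaries. A cocycle [c] vanishes on
    these, so [z] kills the values of [c], which are therefore not invertible. *)
Lemma socle_null (mL : localP m) z (V : lmodType R) (F : free_res m V) :
  m z -> z <> 0 -> (forall a, m a -> a * z = 0) ->
  (forall a (v : V), m a -> a *: v = 0) -> @null_mod R m (fr_cpx F).
Proof.
move=> mz z0 zm mV n c [cL c0]; exists (fun=> 0); first exact: linear_zero.
move=> x; rewrite subr0 [x]row_sum_delta (lin_sum cL).
apply: (local_sum mL) => a; rewrite (linZ cL); apply: (localM mL).
have : cdiff (fr_cpx F) n (z *: delta_mx 0 a) = 0.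
  rewrite (linZ (@cdiff_linear _ (fr_cpx F) n)).
  case: n c cL c0 x a => [|n] c cL c0 x a; first exact: mV.
  apply/rowP => i; rewrite mxE /= -rowE !mxE mulrC; apply: zm; exact: fr_min.
move=> /fr_acyclic[y yE]; apply: contrapT => /(local_unit mL)[u uE]; apply: z0.
rewrite -[z]mulr1 -uE mulrCA -[z * _]/(z *: c (delta_mx 0 a)) -(linZ cL) -yE c0.
exact: mulr0.
Qed.

End Split.

Definition seq_rk p q (b : nat -> nat) n :=
  match n with 0 => p | 1 => q | n'.+2 => b n' end.

Definition seq_mx (R : comNzRingType) p q b (E : 'M[R]_(q, p)) (E1 : 'M[R]_(b 0%N, q))
    (D : forall n, 'M[R]_(b n.+1, b n)) n : 'M[R]_(seq_rk p q b n.+1, seq_rk p q b n) :=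
  match n return 'M[R]_(seq_rk p q b n.+1, seq_rk p q b n) with
  | 0 => E | 1 => E1 | n'.+2 => D n'
  end.

Lemma matrix_resolution (R : comNzRingType) (m : R -> Prop) (mL : localP m)
    (noeth : noethP R) p q (E : 'M[R]_(q, p)) :
  exists b E1 D, forall n (x : 'rV_(seq_rk p q b n.+1)),
    x *m @seq_mx R p q b E E1 D n = 0 <-> row_span (@seq_mx R p q b E E1 D n.+1) x.
Proof.
have kerP : submodP (fun x : 'rV_q => x *m E = 0).
  split=> [|a x y x0 y0]; first exact: mul0mx.
  by rewrite mulmxDl -scalemxAl x0 y0 scaler0 addr0.
have [b [D [E1 [EA E1D Dex _]]]] := minimal_free_complex mL noeth kerP.
by exists b, E1, D => -[|[|n]] x; [exact: EA|exact: E1D|exact: Dex].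
Qed.

Lemma lift_row (R R' : comNzRingType) (pi : {rmorphism R -> R'}) k (u : 'rV[R']_k) :
  (forall y, exists a, pi a = y) -> exists w : 'rV[R]_k, map_mx pi w = u.
Proof.
move=> pi_surj; have /choice[w wE] := fun i => pi_surj (u 0 i); exists (\row_i w i).
by apply/rowP => i; rewrite !mxE.
Qed.

(** A cycle modulo [x] lifts to a row whose image is [x u]. Since [x] is regular, [u] is
    a cycle, so [u] is the image of some [v], and the row minus [x v] is a cycle. The
    argument uses the exactness at two consecutive places. *)
Lemma reduce_exact (R R' : comNzRingType) (pi : {rmorphism R -> R'}) x
    (b : nat -> nat) (M : forall n, 'M[R]_(b n.+1, b n)) :
  (forall y, exists a, pi a = y) -> (forall a, pi a = 0 <-> exists t, a = t * x) ->
  regular_elt x ->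
  (forall n (w : 'rV_(b n.+1)), w *m M n = 0 <-> row_span (M n.+1) w) ->
  forall n (y : 'rV_(b n.+2)),
    y *m map_mx pi (M n.+1) = 0 <-> row_span (map_mx pi (M n.+2)) y.
Proof.
move=> pi_surj pi_ker xreg ex n y.
have ker_row k (w : 'rV[R]_k) : map_mx pi w = 0 -> exists u, w = x *: u.
  move=> w0; have /choice[u uE] : forall i, exists t, w 0 i = t * x.
    by move=> i; apply/pi_ker; have /rowP/(_ i) := w0; rewrite !mxE.
  by exists (\row_i u i); apply/rowP => i; rewrite !mxE uE mulrC.
split=> [y0|[u <-]]; last first.
  rewrite -mulmxA -map_mxM (_ : M n.+2 *m M n.+1 = 0) ?map_mx0 ?mulmx0 //.
  apply/row_matrixP => i; rewrite row_mul row0.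
  by apply/(ex n.+1); exists (delta_mx 0 i); rewrite -rowE.
have [w wE] := lift_row y pi_surj; rewrite -wE -map_mxM in y0.
have [u uE] := ker_row _ _ y0.
have /(ex n)[v vE] : u *m M n = 0.
  have : x *: (u *m M n) = 0.
    by rewrite scalemxAl -uE; apply/(ex n); exists w.
  move=> xu; apply/rowP => i; rewrite [RHS]mxE; apply: xreg.
  by have /rowP/(_ i) := xu; rewrite [LHS]mxE [RHS]mxE.
have /(ex n.+1)[v' v'E] : (w - x *: v) *m M n.+1 = 0.
  by rewrite mulmxBl uE -scalemxAl vE subrr.
exists (map_mx pi v'); rewrite -map_mxM v'E -wE map_mxB map_mxZ.
by rewrite (proj2 (pi_ker x)) ?scale0r ?subr0 //; exists 1; rewrite mul1r.
Qed.

Section ProductComplex.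
Context {R : comNzRingType}.

(** [X] without its term of degree [0]. *)
Definition tail_cpx (X : cpx R) := Cpx (fun n => @cdiff_linear _ X n.+1)
  (fun n => @cdiffK _ X n.+1).

Section Prod.
Context (X Y : cpx R).

Definition prod_diff n (z : X n.+1 * Y n.+1) : X n * Y n :=
  (cdiff X n z.1, cdiff Y n z.2).

Fact prod_diff_linear n : linear (@prod_diff n).
Proof.
move=> a z w; apply: injective_projections => /=; first exact: cdiff_linear.
exact: cdiff_linear.
Qed.

Fact prod_diffK n (z : X n.+2 * Y n.+2) : prod_diff (prod_diff z) = 0.
Proof. by apply: injective_projections; exact: cdiffK. Qed.

Definition prod_cpx :=
  @Cpx R (fun n => (X n * Y n)%type) _ prod_diff_linear prod_diffK.

Lemma prod_acyclic : acyclic X -> acyclic Y -> acyclic prod_cpx.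
Proof.
move=> acX acY n [x y] /= xy.
have [u uE] := acX n x (congr1 fst xy); have [v vE] := acY n y (congr1 snd xy).
by exists (u, v); rewrite /= /prod_diff /= uE vE.
Qed.

Lemma prod_proj : projC X -> projC Y -> projC prod_cpx.
Proof. by move=> projX projY n; apply: projective_pair; [exact: projX|exact: projY]. Qed.

End Prod.

End ProductComplex.

Section Descent.
Context {R R' : comNzRingType} {m : R -> Prop} (mL : localP m) (noeth : noethP R).
Context (pi : {rmorphism R -> R'}) {x : R}.
Context (pi_surj : forall y, exists a, pi a = y).
Context (pi_ker : forall a, pi a = 0 <-> exists t, a = t * x).
Context (mx : m x) (xreg : regular_elt x).

Definition image_ideal (y : R') := exists2 a, m a & pi a = y.
Local Notation m' := image_ideal.

(** The kernel of [pi] is contained in [m]. *)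
Lemma image_idealE a : m' (pi a) <-> m a.
Proof.
split=> [[b mb ba]|ma]; last by exists a.
have /pi_ker[t tE] : pi (b - a) = 0 by rewrite rmorphB ba subrr.
rewrite -(subKr b a) tE; apply: (localB mL) => //; exact: (localM mL).
Qed.

Lemma image_local : localP m'.
Proof.
split.
- apply: idealP_intro.
  + by exists 0; [exact: (local0 mL)|exact: rmorph0].
  + by move=> _ _ [a ma <-] [b mb <-]; rewrite -rmorphD; apply/image_idealE; exact: (localD mL).
  + move=> c _ [a ma <-]; have [d <-] := pi_surj c; rewrite -rmorphM.
    by apply/image_idealE; exact: (localM mL).
- by rewrite -(rmorph1 pi) image_idealE; exact: (local_proper mL).
- move=> y; have [a <-] := pi_surj y; rewrite image_idealE => /(local_unit mL)[b ba].
  by exists (pi b); rewrite -rmorphM ba rmorph1.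
Qed.

Lemma image_noeth : noethP R'.
Proof.
move=> I IP; pose J a := I (pi a).
have JP : idealP J.
  apply: idealP_intro; rewrite /J.
  - by rewrite rmorph0; exact: ideal0.
  - by move=> a b Ja Jb; rewrite rmorphD; exact: idealD.
  - by move=> a b Jb; rewrite rmorphM; exact: idealM.
have [n [g [Jg gspan]]] := noeth JP.
exists n, (fun i => pi (g i)); split=> // y; have [a <-] := pi_surj y.
move=> /gspan[c /eqP]; rewrite subr_eq0 => /eqP ->; exists (fun i => pi (c i)).
rewrite rmorph_sum; apply/eqP; rewrite subr_eq0; apply/eqP/eq_bigr => i _.
exact: rmorphM.
Qed.

Context {e : nat} {g : 'I_e -> R} (mg : forall i, m (g i)).
Context (gspan : forall a, m a -> exists r (c : 'I_e -> R), a = r * x + \sum_i c i * g i).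
Context (x_needed : forall r (c : 'I_e -> R), r * x + \sum_i c i * g i = 0 -> m r).
Context (depth : forall z, (forall a, m a -> a * z = 0) -> z = 0).

Local Notation red := (map_mx pi).

(** Let [k] and [k'] be the two residue fields. Over [R'] the module [m / x m] is the
    direct sum of [k'], generated by the class of [x], and [m']. It is resolved by the
    reduction [U] of a resolution of [m], and also by the direct sum [W] of
    resolutions of [k'] and [m'], both of which are parts of a resolution [Q] of [k'].
    If cocycles on [Q] are coboundaries modulo [m'], then so are cocycles on [W], on
    [U], and on the resolution of [k] over [R]. *)
Lemma split_cocycle_descent :
  split_cocycle m -> (forall y, m' y -> y = 0) \/ split_cocycle m'.
Proof.
move=> /(split_cocycle_not_null mL)[V Vres Vnull].
apply: contrapT => /not_orP[m'0 nsplit'].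
have {m'0} [t mt t0] : exists2 t, m' t & t <> 0.
  apply: contrapT => no; apply: m'0 => y my.
  by apply: contrapT => y0; apply: no; exists y.
have m'L := image_local.
(* X resolves k over R and starts with the generators x, g of m *)
pose E : 'M[R]_(1 + e, 1) := col_mx (x%:M) (\col_i g i).
have EE (w : 'rV_(1 + e)) : (w *m E) 0 0 =
    lsubmx w 0 0 * x + \sum_i rsubmx w 0 i * g i.
  rewrite -[w in LHS]hsubmxK mul_row_col mxE; congr (_ + _).
    by rewrite mul_mx_scalar mxE mulrC.
  by rewrite mxE; apply: eq_bigr => i _; congr (_ * _); rewrite mxE.
have rv1 (T : comNzRingType) (u v : 'rV[T]_1) : u 0 0 = v 0 0 -> u = v.
  by move=> uv; apply/rowP => i; rewrite (ord1 i).
have imE (r : 'rV_1) : m (r 0 0) <-> row_span E r.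
  split=> [/gspan[c [d rE]]|[w <-]].
    exists (row_mx c%:M (\row_i d i)); apply: rv1.
    rewrite EE row_mxKl row_mxKr rE mxE eqxx mulr1n; congr (_ + _).
    by apply: eq_bigr => i _; rewrite mxE.
  rewrite EE; apply: (localD mL); first exact: (localM mL).
  by apply: (local_sum mL) => i; exact: (localM mL).
have [b [E1 [D ex]]] := matrix_resolution mL noeth E.
pose rk := seq_rk 1 (1 + e) b.
pose M n : 'M[R]_(rk n.+1, rk n) := seq_mx E E1 D n.
have {}ex n (w : 'rV_(rk n.+1)) : w *m M n = 0 <-> row_span (M n.+1) w := ex n w.
have [v [vspan vann]] := Vres.
pose d0 (r : 'rV[R]_1) : V := r 0 0 *: v.
have d0L : linear d0 by exact: (linear_scaler v (@linear_entry _ _ 0)).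
have d0E (y : mx_cpx ex 1%N) : d0 (cdiff (mx_cpx ex) 0 y) = 0.
  by apply/vann; apply/imE; exists y.
pose X := augment (Y := mx_cpx ex) d0L d0E.
have acX : acyclic X.
  apply: augment_acyclic; last exact: mx_acyclic.
  by move=> r /vann/imE[w wE]; exists w.
have projX : projC X by apply: augment_proj; [exact: projective_row|exact: mx_proj].
(* Q resolves k' over R' and starts with the generators pi g of m' *)
pose E' : 'M[R']_(e, 1) := \col_i pi (g i).
have EE' (w : 'rV_e) : (w *m E') 0 0 = \sum_i w 0 i * pi (g i).
  by rewrite mxE; apply: eq_bigr => i _; rewrite mxE.
have imE' (r : 'rV_1) : m' (r 0 0) <-> row_span E' r.
  split=> [[a /gspan[c [d ->]] aE]|[w <-]].
    exists (\row_i pi (d i)); apply: rv1; rewrite EE' -aE rmorphD rmorphM.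
    rewrite (proj2 (pi_ker x)) ?mulr0 ?add0r; last by exists 1; rewrite mul1r.
    by rewrite rmorph_sum; apply: eq_bigr => i _; rewrite mxE rmorphM.
  rewrite EE'; apply: (local_sum m'L) => i; apply: (localM m'L).
  exact/image_idealE.
have [b' [E1' [D' ex']]] := matrix_resolution m'L image_noeth E'.
pose rk' := seq_rk 1 e b'.
pose M' n : 'M[R']_(rk' n.+1, rk' n) := seq_mx E' E1' D' n.
have {}ex' n (w : 'rV_(rk' n.+1)) : w *m M' n = 0 <-> row_span (M' n.+1) w := ex' n w.
have [V' V'res] := residue_module_exists (local_ideal m'L).
have [v' [v'span v'ann]] := V'res.
pose d0' (r : 'rV[R']_1) : V' := r 0 0 *: v'.
have d0L' : linear d0' by exact: (linear_scaler v' (@linear_entry _ _ 0)).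
have d0E' (y : mx_cpx ex' 1%N) : d0' (cdiff (mx_cpx ex') 0 y) = 0.
  by apply/v'ann; apply/imE'; exists y.
pose Q := augment (Y := mx_cpx ex') d0L' d0E'.
have acQ : acyclic Q.
  apply: augment_acyclic; last exact: mx_acyclic.
  by move=> r /v'ann/imE'[w wE]; exists w.
have projQ : projC Q by apply: augment_proj; [exact: projective_row|exact: mx_proj].
have nullQ : @null_mod R' m' Q.
  apply: contrapT => nQ; apply: nsplit'; exists Q; split=> // w.
  have [a ->] := v'span w; exists (a%:M : 'rV_1).
  by rewrite /= /d0' mxE eqxx mulr1n.
(* U and W have the same module and the same image in degree 0 *)
have exU := reduce_exact pi_surj pi_ker xreg ex.
pose U := @mx_cpx R' (fun n => rk n.+1) (fun n => red (M n.+1)) exU.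
pose W := prod_cpx (tail_cpx Q) (tail_cpx (tail_cpx Q)).
pose f0 (w : U 0%N) : W 0%N := (lsubmx (w : 'rV_(1 + e)), rsubmx (w : 'rV_(1 + e))).
pose g0 (z : W 0%N) : U 0%N := row_mx (z.1 : 'rV[R']_1) (z.2 : 'rV[R']_e).
have f0L : linear f0 by move=> a u w; rewrite /f0 !linearP.
have g0L : linear g0.
  by move=> a u w; rewrite /g0 scale_row_mx add_row_mx.
have f0K : cancel f0 g0 by move=> w; exact: hsubmxK.
have g0K : cancel g0 f0 by move=> [u w]; rewrite /f0 /g0 row_mxKl row_mxKr.
have dU k (y : 'rV_(rk k.+2)) : cdiff U k y = y *m red (M k.+1) by [].
have imU (w : U 0%N) : (exists y, cdiff U 0 y = w) <->
    m' ((f0 w).1 0 0) /\ \sum_i (f0 w).2 0 i * pi (g i) = 0.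
  rewrite /f0 /=; split=> [[y <-]|[mw]].
    have [u <-] := lift_row y pi_surj.
    rewrite -map_mxM.
    set om : 'rV_(1 + e) := u *m M 1%N.
    have omE : lsubmx om 0 0 * x + \sum_i rsubmx om 0 i * g i = 0.
      by rewrite -EE (proj2 (ex 0%N om)) ?mxE //; exists u.
    rewrite -map_lsubmx -map_rsubmx mxE image_idealE; split; first exact: x_needed omE.
    have := congr1 pi omE; rewrite rmorphD rmorphM rmorph0 rmorph_sum.
    rewrite (proj2 (pi_ker x)) ?mulr0 ?add0r; last by exists 1; rewrite mul1r.
    by move=> sE; rewrite -[RHS]sE; apply: eq_bigr => i _; rewrite mxE rmorphM.
  have [om omE] := lift_row (w : 'rV_(1 + e)) pi_surj.
  move: mw; rewrite -omE -map_lsubmx -map_rsubmx mxE image_idealE => mw.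
  have -> : \sum_i red (rsubmx om) 0 i * pi (g i) = pi (\sum_i rsubmx om 0 i * g i).
    by rewrite rmorph_sum; apply: eq_bigr => i _; rewrite mxE rmorphM.
  move=> /pi_ker[c cE].
  have mc : m c.
    rewrite -[c]opprK; apply: (localN mL); apply: (x_needed (c := fun i => rsubmx om 0 i)).
    by rewrite cE mulNr addNr.
  have [|u uE] := (imE (lsubmx om 0 0 + c)%:M).1.
    by rewrite mxE eqxx mulr1n; exact: (localD mL).
  have uE0 : (u *m E) 0 0 = lsubmx om 0 0 + c by rewrite uE mxE eqxx mulr1n.
  have /(ex 0%N)[y yE] : (om - x *: u) *m M 0%N = 0.
    apply: rv1; rewrite mulmxBl -scalemxAl [LHS]mxE [X in _ + X]mxE [X in - X]mxE.
    by rewrite uE0 EE cE [RHS]mxE; ring.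
  exists (red y); rewrite -[LHS]/(red y *m red (M 1%N)) -map_mxM yE map_mxB map_mxZ.
  by rewrite (proj2 (pi_ker x)) ?scale0r ?subr0 //; exists 1; rewrite mul1r.
have imW (z : W 0%N) : (exists y, cdiff W 0 y = z) <->
    m' (z.1 0 0) /\ \sum_i z.2 0 i * pi (g i) = 0.
  split=> [[y <-]|[mz1 z2]].
    split; first by apply/imE'; exists y.1.
    rewrite -EE' (proj2 (ex' 0%N _)) ?mxE //; by exists y.2.
  have /imE'[u uE] := mz1.
  have /(ex' 0%N)[w wE] : z.2 *m M' 0%N = 0.
    by apply: rv1; rewrite EE' z2 mxE.
  by exists (u, w); apply: injective_projections.
have projU : projC U by exact: mx_proj.
have acU : acyclic U by exact: mx_acyclic.
have projW : projC W by apply: prod_proj => n; exact: projQ.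
have acW : acyclic W by apply: prod_acyclic => n y; exact: acQ.
have [y|y|f [f' [s [s' Eq]]]] := @comparison R' U W f0 g0 projU acU projW acW f0L g0L f0K g0K.
- by apply/imW/imU; exists y.
- by apply/imU; rewrite g0K; apply/imW; exists y.
have surjX w : exists r, cdiff X 0 r = w.
  by have [a ->] := vspan w; exists (a%:M : 'rV_1); rewrite /= /d0 mxE eqxx mulr1n.
apply: (Vnull X id id (@linear_id _ _) (@linear_id _ _) (fun=> erefl) (fun=> erefl)
  projX acX surjX).
move=> [|k] c [cL c0].
  (* at the first term R of the resolution, a cocycle vanishes on m; by depth it is 0 *)
  exists (fun=> 0) => [|r]; first exact: linear_zero.
  rewrite subr0 (_ : c r = 0); first exact: (local0 mL).
  apply: depth => a ma; have [|w wE] := (imE (a *: (r : 'rV_1))).1.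
    by rewrite mxE; exact: (localMl mL).
  by rewrite -[a * c r]/(a *: c r) -(linZ cL) -wE; exact: c0.
have cE (w : 'rV[R]_(rk k.+1)) : c w = \sum_a w 0 a * c (delta_mx 0 a).
  by rewrite [w in LHS]row_sum_delta (lin_sum cL); apply: eq_bigr => a _; rewrite (linZ cL).
pose c' (y : U k) : R'^o := \sum_a (y : 'rV_(rk k.+1)) 0 a * pi (c (delta_mx 0 a)).
have c'L : linear c'.
  by apply: linear_sum_fun => a u y z; rewrite !mxE mulrDl -mulrA.
have c'E (w : 'rV[R]_(rk k.+1)) : c' (red w) = pi (c w).
  by rewrite cE rmorph_sum; apply: eq_bigr => a _; rewrite mxE rmorphM.
have c'0 y : c' (cdiff U k y) = 0.
  have [w <-] := lift_row (y : 'rV_(rk k.+2)) pi_surj.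
  rewrite -[cdiff U k _]/(red w *m red (M k.+1)) -map_mxM c'E.
  by rewrite (c0 w) rmorph0.
(* a cochain over R' lifts to R because the terms are free *)
suff [h' h'L h'E] : exists2 h' : 'rV[R']_(rk k) -> R'^o, linear h' &
    forall y : 'rV[R']_(rk k.+1), m' (c' y - h' (y *m red (M k))).
  have /choice[eta etaE] := fun a => pi_surj (h' (delta_mx 0 a)).
  pose h (w : 'rV[R]_(rk k)) : R^o := \sum_a w 0 a * eta a.
  exists h => [|w].
    by apply: linear_sum_fun => a u y z; rewrite !mxE mulrDl -mulrA.
  apply/image_idealE; rewrite rmorphB -c'E.
  have -> : pi (h (w *m M k)) = h' (red w *m red (M k)).
    rewrite -map_mxM [in RHS](row_sum_delta (red _)) (lin_sum h'L) rmorph_sum.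
    by apply: eq_bigr => a _; rewrite (linZ h'L) rmorphM etaE [(red _) 0 a]mxE.
  exact: h'E.
have [gL' gd] := equiv_g Eq; have [fL fd] := equiv_f Eq.
pose c1 (q : Q k.+1) : R'^o := c' (f' k (q, 0)).
pose c2 (q : Q k.+2) : R'^o := c' (f' k (0, q)).
have i1L n : linear (fun q : Q n.+1 => (q, 0) : W n).
  by move=> a u w; apply: injective_projections => //=; rewrite scaler0 addr0.
have i2L n : linear (fun q : Q n.+2 => (0, q) : W n).
  by move=> a u w; apply: injective_projections => //=; rewrite scaler0 addr0.
have c12 (z : W k) : c' (f' k z) = c1 z.1 + c2 z.2.
  rewrite -(linD c'L) -(linD (gL' k)); congr (c' (f' k _)).
  by apply: (@injective_projections (Q k.+1) (Q k.+2)); rewrite /= ?addr0 ?add0r.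
have [h1 h1L h1E] : exists2 h : Q k -> R'^o, linear h &
    forall y, m' (c1 y - h (cdiff Q k y)).
  apply: nullQ; split; first exact: (linear_comp (linear_comp (i1L k) (gL' k)) c'L).
  move=> y; rewrite /c1 (_ : (cdiff Q k.+1 y, 0) = cdiff W k (y, 0)) -?gd ?c'0 //.
  by apply: (@injective_projections (Q k.+1) (Q k.+2)); rewrite //= mul0mx.
have [h2 h2L h2E] : exists2 h : Q k.+1 -> R'^o, linear h &
    forall y, m' (c2 y - h (cdiff Q k.+1 y)).
  apply: nullQ; split; first exact: (linear_comp (linear_comp (i2L k) (gL' k)) c'L).
  move=> y; rewrite /c2 (_ : (0, cdiff Q k.+2 y) = cdiff W k (0, y)) -?gd ?c'0 //.
  by apply: (@injective_projections (Q k.+1) (Q k.+2)); rewrite //= mul0mx.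
case: k => [|k] in c cL c0 cE c' c'L c'E c'0 c1 c2 c12 h1 h1L h1E h2 h2L h2E *.
  (* in degree 0 of W the cochains h1, h2 start from k' and R', and contribute only
     elements of m': t kills k', and the image of R'^e in R' is m' *)
  exists (fun=> 0) => [|y]; first exact: linear_zero.
  rewrite subr0 -[y](equiv_gf0 Eq) c12; move: (f 0%N y) => z.
  apply: (localD m'L).
    rewrite -[c1 _](subrK (h1 (cdiff Q 0 z.1))); apply: (localD m'L) => //.
    move: (cdiff Q 0 z.1) => w; apply: contrapT => /(local_unit m'L)[u uE]; apply: t0.
    rewrite -[t]mulr1 -uE mulrCA -[t * _]/(t *: h1 w) -(linZ h1L).
    by rewrite (residue_module_killed V'res _ mt) (lin0 h1L) mulr0.
  rewrite -[c2 _](subrK (h2 (cdiff Q 1 z.2))); apply: (localD m'L) => //.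
  have : m' ((cdiff Q 1 z.2 : 'rV_1) 0 0) by apply/imE'; exists z.2.
  move: (cdiff Q 1 z.2) => w mw; have -> : w = (w : 'rV_1) 0 0 *: (1%:M : 'rV[R']_1).
    by apply: rv1; rewrite !mxE eqxx mulr1.
  by rewrite (linZ h2L); exact: (localMl m'L).
exists (fun z => h1 (f k z).1 + h2 (f k z).2 + c' (s k z)) => [|y].
  have sL := @equiv_sL _ _ _ _ _ _ _ Eq k.
  apply: linear_add; last exact: (linear_comp sL c'L).
  by apply: linear_add => a u w; rewrite fL /= ?h1L ?h2L.
rewrite -[y *m _]/(cdiff U k y) -fd.
have := @equiv_s _ _ _ _ _ _ _ Eq k y => /(congr1 c').
rewrite (linB c'L) (linD c'L) c'0 add0r c12 => /eqP; rewrite subr_eq => /eqP ->.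
move: (f k.+1 y) (c' (s k _)) => z A.
rewrite [X in _ - X]addrC opprD addrA [A + _]addrC addrK opprD addrACA.
by apply: (localD m'L); [exact: h1E|exact: h2E].
Qed.

End Descent.

(** * A free direct summand of a syzygy of the residue field forces regularity *)

Definition gens (R : comNzRingType) (m : R -> Prop) e := exists g : 'I_e -> R,
  (forall i, m (g i)) /\ forall a, m a -> exists c : 'I_e -> R, a = \sum_i c i * g i.

Section Regularity.
Context {R : comNzRingType}.

Lemma chain_field (m : R -> Prop) (mL : localP m) : (forall a, m a -> a = 0) ->
  (forall x y : R, x * y = 0 -> x = 0 \/ y = 0) /\ exists c, @chainP R 0 c.
Proof.
move=> m0.
have dom (x y : R) : x * y = 0 -> x = 0 \/ y = 0.
  move=> xy; have [x0|x0] := pselect (x = 0); [by left|right].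
  have [|b bx] := local_unit mL (a := x); first by move/m0.
  by rewrite -[y]mul1r -bx -mulrA xy mulr0.
split=> //; exists (fun _ a => a = 0); split=> // i _; split=> //.
- by split=> // a x y -> ->; rewrite scaler0 addr0.
- by apply/eqP; exact: oner_neq0.
Qed.

Context {R' : comNzRingType} (pi : {rmorphism R -> R'}) {x : R}.
Context (pi_surj : forall y, exists a, pi a = y).
Context (pi_ker : forall a, pi a = 0 <-> exists t, a = t * x).

(** If [R / (x)] is a domain, then [R] is one: a product of two elements from which all
    factors [x] have been removed is not zero modulo [x]. So [0] can be added below
    the inverse image of a chain of primes of [R / (x)]. *)
Lemma chain_lift_regular (m : R -> Prop) (mL : localP m) (noeth : noethP R) e :
  m x -> regular_elt x ->
  (forall y z : R', y * z = 0 -> y = 0 \/ z = 0) -> (exists c, @chainP R' e c) ->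
  (forall y z : R, y * z = 0 -> y = 0 \/ z = 0) /\ exists c, @chainP R e.+1 c.
Proof.
move=> mx xreg dom' [c [cP cs]].
have xregX i y : x ^+ i * y = 0 -> y = 0.
  by elim: i y => [|i IHi] y; [rewrite expr0 mul1r|rewrite exprSr -mulrA => /IHi/xreg].
have dom (y z : R) : y * z = 0 -> y = 0 \/ z = 0.
  move=> yz; apply: contrapT => /not_orP[y0 z0].
  have [i [u [yE ux]]] := regular_factor mL noeth mx xreg y0.
  have [j [w [zE wx]]] := regular_factor mL noeth mx xreg z0.
  have /xregX uw : x ^+ (i + j) * (u * w) = 0.
    by rewrite exprD -yz yE zE; ring.
  have [/pi_ker[t ut]|/pi_ker[t wt]] : pi u = 0 \/ pi w = 0.
    by apply: dom'; rewrite -rmorphM uw rmorph0.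
  + exact: (ux t).
  + exact: (wx t).
split=> //; exists (fun i a => if i is i'.+1 then c i' (pi a) else a = 0).
split=> [[|i] ie|[|i] ie].
- split=> //; first by split=> // a y z -> ->; rewrite scaler0 addr0.
  by apply/eqP; exact: oner_neq0.
- have [cI c1 cM] := cP i ie; split.
  + apply: idealP_intro => [|a b ca cb|a b cb].
    * by rewrite rmorph0; exact: ideal0.
    * by rewrite rmorphD; exact: idealD.
    * by rewrite rmorphM; exact: idealM.
  + by rewrite rmorph1.
  + by move=> a b; rewrite rmorphM; exact: cM.
- have cI := prime_ideal (cP 0%N isT); split.
    by move=> _ ->; rewrite rmorph0; exact: ideal0.
  exists x; first by rewrite (proj2 (pi_ker x)); [exact: ideal0|exists 1; rewrite mul1r].
  move=> x0; apply: (local_proper mL); rewrite (_ : 1 = 0); first exact: (local0 mL).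
  by apply: xreg; rewrite x0 mul0r.
- have [cc [y cy ncy]] := cs i ie; split; first by move=> a; exact: cc.
  by have [a aE] := pi_surj y; exists a; rewrite aE.
Qed.

End Regularity.

(** By induction on the number [e] of generators of [m]. Unless [m = 0], no nonzero
    element is killed by [m], so some generator [x] of [m] is regular; and the
    hypothesis passes to [R / (x)]. *)
Theorem split_regular e (R : comNzRingType) (m : R -> Prop) :
  localP m -> noethP R -> gens m e -> (forall k, (k < e)%N -> ~ gens m k) ->
  (forall y, m y -> y = 0) \/ split_cocycle m ->
  (forall x y : R, x * y = 0 -> x = 0 \/ y = 0) /\ exists c, @chainP R e c.
Proof.
elim: e R m => [|e IHe] R m mL noeth [g [mg gspan]] gmin.
  by move=> _; apply: (chain_field mL) => a /gspan[c ->]; rewrite big_ord0.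
have m_neq0 : ~ forall y, m y -> y = 0.
  move=> m0; apply: (gmin 0%N) => //; exists (fun=> 0); split=> [[]//|a /m0 ->].
  by exists (fun=> 0); rewrite big_ord0.
case=> [//|split_m].
have [V Vres Vnull] := split_cocycle_not_null mL split_m.
have depth z : (forall a, m a -> a * z = 0) -> z = 0.
  move=> zm; apply: contrapT => z0.
  have mz : m z.
    apply: contrapT => /(local_unit mL)[b bz]; apply: m_neq0 => y my.
    by rewrite -[y]mulr1 -bz mulrCA zm ?mulr0.
  have Vfg : fgen (fun _ : V => True).
    have [v [vspan _]] := Vres; exists 1%N, (fun=> v); split=> // w _.
    by have [a ->] := vspan w; exists (fun=> a); rewrite big_ord1 subrr.
  have [F _] := free_res_exists mL noeth Vfg.
  apply: (Vnull (fr_cpx F) id id (@linear_id _ _) (@linear_id _ _) (fun=> erefl) (fun=> erefl)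
    (@fr_proj _ _ _ F) (@fr_acyclic _ _ _ F) (@fr_surj _ _ _ F)).
  apply: (socle_null mL mz z0 zm); exact: residue_module_killed Vres.
have [x0 mx0 x0sq] : exists2 x, m x & ~ in_square (m := m) x.
  apply: contrapT => no; apply: m_neq0.
  apply: (@nakayama R m mL R^o m (noeth m (local_ideal mL))) => y my.
  by apply: contrapT => ysq; apply: no; exists y.
have [x [mx xsq xreg]] := regular_elt_exists mL noeth depth (ex_intro2 _ _ x0 mx0 x0sq).
have [c xE] := gspan x mx.
have [k mck] : exists k, ~ m (c k).
  apply: contrapT => no; apply: xsq; exists e.+1, c, g; split=> // i.
  by apply: contrapT => mci; apply: no; exists i.
have [b bc] := local_unit mL mck.
pose h i := g (lift k i).
have sum_k (d : 'I_e.+1 -> R) :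
    \sum_i d i * g i = d k * g k + \sum_i d (lift k i) * h i by rewrite (bigD1_ord k).
have hspan a : m a -> exists r (d : 'I_e -> R), a = r * x + \sum_i d i * h i.
  move=> /gspan[d ->]; exists (d k * b), (fun i => d (lift k i) - d k * b * c (lift k i)).
  have -> : \sum_i (d (lift k i) - d k * b * c (lift k i)) * h i =
      \sum_i d (lift k i) * h i - d k * b * \sum_i c (lift k i) * h i.
    by rewrite mulr_sumr -sumrB; apply: eq_bigr => i _; ring.
  rewrite xE !sum_k mulrDr.
  have -> : d k * b * (c k * g k) = d k * g k * (b * c k) by ring.
  by rewrite bc; ring.
have ngens : ~ gens m e by apply: gmin.
have x_needed r (d : 'I_e -> R) : r * x + \sum_i d i * h i = 0 -> m r.
  move=> rel; apply: contrapT => /(local_unit mL)[u ur]; apply: ngens.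
  exists h; split=> [i|a /hspan[t [d' ->]]]; first exact: mg.
  exists (fun i => d' i - t * u * d i).
  have -> : \sum_i (d' i - t * u * d i) * h i =
      \sum_i d' i * h i - t * u * \sum_i d i * h i.
    by rewrite mulr_sumr -sumrB; apply: eq_bigr => i _; ring.
  have -> : \sum_i d i * h i = - (r * x) by apply/eqP; rewrite -addr_eq0 addrC rel.
  have -> : t * u * - (r * x) = - (t * (u * r) * x) by ring.
  by rewrite ur; ring.
have [||R' [pi [pi_surj pi_ker]]] := @quotient_ring R (fun a => exists t, a = t * x).
- apply: idealP_intro; first by exists 0; rewrite mul0r.
    by move=> _ _ [t ->] [u ->]; exists (t + u); rewrite mulrDl.
  by move=> a _ [t ->]; exists (a * t); rewrite mulrA.
- by move=> [t tx]; apply: (local_proper mL); rewrite tx; exact: (localM mL).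
have mh i : m (h i) by exact: mg.
have pix : pi x = 0 by apply/pi_ker; exists 1; rewrite mul1r.
have m'L := image_local mL pi_surj pi_ker mx.
have [||dom' chain'] := IHe R' (image_ideal (m := m) pi) m'L
    (image_noeth noeth pi_surj) _ _ (split_cocycle_descent mL noeth pi_surj pi_ker mx xreg
       mh hspan x_needed depth split_m).
- exists (fun i => pi (h i)); split=> [i|_ [a /hspan[r [d ->]] <-]].
    by exists (h i).
  exists (fun i => pi (d i)); rewrite rmorphD rmorphM pix mulr0 add0r rmorph_sum.
  by apply: eq_bigr => i _; rewrite rmorphM.
- move=> j je [f [mf fspan]]; apply: (gmin j.+1 je).
  have /choice[F FE] : forall i, exists a, m a /\ pi a = f i.
    by move=> i; have [a ma aE] := mf i; exists a.
  exists (fun i => if unlift ord0 i is Some i' then F i' else x); split=> [i|a ma].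
    by case: unliftP => [i' _|_] //; case: (FE i').
  have [|d dE] := fspan (pi a); first by exists a.
  have /choice[D DE] := fun i => pi_surj (d i).
  have /pi_ker[t tE] : pi (a - \sum_i D i * F i) = 0.
    rewrite rmorphB dE rmorph_sum -sumrB big1 // => i _.
    by rewrite rmorphM DE (FE i).2 subrr.
  exists (fun i => if unlift ord0 i is Some i' then D i' else t).
  rewrite big_ord_recl unlift_none [X in _ = _ + X](_ : _ = \sum_i D i * F i).
    by rewrite -tE subrK.
  by apply: eq_bigr => i _; rewrite liftK.
exact: (chain_lift_regular pi_surj pi_ker mL noeth mx xreg dom' chain').
Qed.

(** * The local ring, its regularity, and ranks of Ext modules *)

Section Rings.
Context {R : comNzRingType}.

Lemma prime_idealr_of (p : R -> Prop) : primeP p ->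
  exists K : prime_idealr R, forall x, x \in K <-> p x.
Proof.
move=> pP; pose B : {pred R} := fun a => `[< p a >].
have BP : idealr_closed B.
  split; rewrite -?topredE /=.
  - by apply/asboolP; exact: (ideal0 (prime_ideal pP)).
  - by apply/negP => /asboolP; exact: (prime_proper pP).
  - move=> a x y; rewrite -!topredE /= => /asboolP Ix /asboolP Iy; apply/asboolP.
    by apply: (idealD (prime_ideal pP)) => //; exact: (idealM _ (prime_ideal pP)).
have Bprime : prime_idealr_closed B.
  move=> x y; rewrite -!topredE /= => /asboolP/(primeM pP)[px|py]; apply/orP; [left|right];
    exact/asboolP.
pose I := HB.pack_for (idealr R) B (isIdealr.Build R B BP).
exists (HB.pack_for (prime_idealr R) B I (isPrimeIdealrClosed.Build R B Bprime)) => x.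
by rewrite -topredE /=; split=> /asboolP.
Qed.

Lemma idealr_ideal (K : idealr R) : idealP (fun x => x \in K).
Proof.
apply: idealP_intro; first exact: rpred0.
  by move=> x y; exact: rpredD.
by move=> a x; exact: idealMr.
Qed.

Lemma prime_idealr_prime (K : prime_idealr R) : primeP (fun x => x \in K).
Proof.
split; [exact: (idealr_ideal K)|by rewrite idealr1|move=> x y].
by rewrite prime_idealrM => /orP.
Qed.

Lemma finite_module_fgen (V : lmodType R) : finite_module V -> fgen (fun _ : V => True).
Proof.
move=> [n [g gspan]]; exists n, g; split=> // x _.
by have [a ->] := gspan x; exists a; rewrite subrr.
Qed.

Lemma noetherian_noethP : noetherian R -> noethP R.
Proof.
move=> noeth I IP; have [S SP] := @submodClosed_of R R^o I IP.
have [n [g gspan]] := noeth S.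
exists n, (fun i => submod_val (g i)); split=> [i|x /SP Sx].
  by apply/SP; exact: (valP (g i)).
have [a aE] := gspan (Submod Sx); exists a.
have := congr1 (@submod_val _ _ _) aE; rewrite (lin_sum (@linear_submod _ _ S)) /= => ->.
by rewrite subrr.
Qed.

Context {m : idealr R}.
Local Notation mP := (fun x => x \in m).

Lemma local_ring_localP : local_ring m -> localP mP.
Proof.
move=> [/noetherian_noethP noeth _ mmax]; split; first exact: idealr_ideal.
  by rewrite idealr1.
move=> a am; apply: contrapT => aunit; apply: am.
have [||I [IP I1 Ia] Imax] := noeth_max noeth
  (F := fun I => [/\ idealP I, ~ I 1 & I a]) (I0 := fun z => exists b, z = b * a).
- split; last by exists 1; rewrite mul1r.
    apply: idealP_intro; first by exists 0; rewrite mul0r.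
      by move=> _ _ [b ->] [c ->]; exists (b + c); rewrite mulrDl.
    by move=> b _ [c ->]; exists (b * c); rewrite mulrA.
  by move=> [b ba]; apply: aunit; exists b.
- by move=> I [].
have [K KI] := idealr_of IP I1.
rewrite -(mmax K); first exact/KI.
move=> J KJ x xJ; apply/KI; apply: (Imax (fun x => x \in J)) => //.
  split; [exact: idealr_ideal|by rewrite idealr1|].
  by apply: KJ; exact/KI.
by move=> y Iy; apply: KJ; exact/KI.
Qed.

(** If [R / m] had a split cocycle, [split_regular] would give a chain of primes whose
    length is the number [e] of generators of [m], and [krull_height] would make [e]
    the dimension. *)
Lemma singular_not_split : singular_local m ->
  ~ split_cocycle mP /\ exists2 a, a \in m & a <> 0.
Proof.
move=> [mloc msing]; have noeth : noethP R by case: mloc => /noetherian_noethP.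
have mL := local_ring_localP mloc.
have : exists e, `[< gens mP e >].
  have [e [g [mg gspan]]] := noeth _ (local_ideal mL).
  exists e; apply/asboolP; exists g; split=> // a /gspan[c /eqP].
  by rewrite subr_eq0 => /eqP ->; exists c.
move=> /ex_minnP[e /asboolP mgens emin].
suff nreg : ~ ((forall y, y \in m -> y = 0) \/ split_cocycle mP).
  split=> [msplit|]; first by apply: nreg; right.
  apply: contrapT => no; apply: nreg; left => y my.
  by apply: contrapT => y0; apply: no; exists y.
move=> msplit; apply: msing; split=> //; exists e.
have [|_ [c [cP cs]]] := split_regular mL noeth mgens _ msplit.
  by move=> k ke kgens; move: ke; rewrite ltnNge emin //; exact/asboolP.
have [g [mg gspan]] := mgens.
split; last first.
  exists g => x; split=> [/gspan//|[a ->]].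
  by apply: (local_sum mL) => i; exact: (localM mL).
split=> [|q qc].
  have /choice[q qE] : forall i, exists K : prime_idealr R, forall x, x \in K <-> c (minn i e) x.
    by move=> i; apply: prime_idealr_of; apply: cP; exact: geq_minr.
  exists q => i ie; have [ci [x cx ncx]] := cs i ie.
  have qi y : y \in q i <-> c i y by rewrite qE (minn_idPl (ltnW ie)).
  have qi1 y : y \in q i.+1 <-> c i.+1 y by rewrite qE (minn_idPl ie).
  split; first by move=> y /qi/ci/qi1.
  by exists x; split; [exact/qi1|apply/negP => /qi].
apply: (krull_height noeth mL gspan mg (c := fun i x => x \in q i)).
split=> [i _|i ie]; first exact: prime_idealr_prime.
have [sub [x [xq xnq]]] := qc i ie; split; first exact: sub.
by exists x => //; exact/negP.
Qed.

End Rings.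

Section Ranks.
Context {R : comNzRingType} {m : idealr R}.
Local Notation mP := (fun x => x \in m).

Lemma to_residue_eq0 a : to_residue m a = 0 <-> a \in m.
Proof.
have := Quotient.idealrBE m a 0; rewrite subr0 => ->.
rewrite -(raddf0 (to_residue m)) /to_residue /=.
by split=> /eqP.
Qed.

Lemma residueK (x : residue m) : to_residue m (repr x) = x.
Proof. exact: reprK. Qed.

Lemma residue_scaleE a (x : residue m) : a *: x = to_residue m a * x.
Proof. by []. Qed.

Lemma residue_module_residue : residue_module mP (residue m).
Proof.
exists 1; split=> [w|a]; first by exists (repr w); rewrite residue_scaleE residueK mulr1.
by rewrite residue_scaleE mulr1; exact: to_residue_eq0.
Qed.

(** Invariance of basis number: linear bijections between spaces of row vectors over
    the residue ring are given by mutually inverse matrices. *)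
Lemma has_rank_uniq (V : lmodType R) d d' : has_rank m d V -> has_rank m d' V -> d = d'.
Proof.
suff le e e' : has_rank m e V -> has_rank m e' V -> (e <= e')%N.
  by move=> h h'; apply/eqP; rewrite eqn_leq !le.
move=> [f [[f' fK f'K] fZ]] [g [[g' gK g'K] gZ]].
pose phi x := g' (f x); pose psi y := f' (g y).
have phiL : linear phi.
  move=> c x y; apply: (can_inj gK); rewrite raddfD /= !g'K.
  by rewrite -(residueK c) raddfD /= fZ gZ g'K.
have psiL : linear psi.
  move=> c x y; apply: (can_inj fK); rewrite raddfD /= !f'K.
  by rewrite -(residueK c) raddfD /= fZ gZ f'K.
apply: (@mulmx1_min _ _ _ (lin1_mx (bundle phiL)) (lin1_mx (bundle psiL))).
apply/row_matrixP => i; rewrite !rowE mulmxA !mul_rV_lin1 mulmx1.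
by rewrite /= /psi /phi g'K fK.
Qed.

Lemma rank_eq (V : lmodType R) d : has_rank m d V -> rank m V = (Posz d)%:E.
Proof.
move=> Vd; rewrite /rank; case: pselect => [h|[]]; last by exists d.
by congr ((Posz _)%:E); apply: has_rank_uniq Vd; exact: (projT2 (cid h)).
Qed.

Lemma has_rank_quotmod (V : lmodType R) (S : submodClosed V) d :
  (forall a (x : V), a \in m -> a *: x \in S) ->
  qdim mP (fun _ : V => True) (fun x => x \in S) d -> has_rank m d (quotmod S).
Proof.
move=> mV [v [_ vspan] vind]; have [q [qL qsurj qker]] := quotmod_proj S.
have q_eq a b x : to_residue m a = to_residue m b -> q (a *: x) = q (b *: x).
  move=> ab; apply/eqP; rewrite -subr_eq0 -(linB qL) -scalerBl; apply/eqP/qker/mV.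
  by apply/to_residue_eq0; rewrite raddfB /= ab subrr.
pose f (x : 'rV[residue m]_d) := \sum_i q (repr (x 0 i) *: v i).
have fE (x : 'rV[residue m]_d) (a : 'I_d -> R) : (forall i, to_residue m (a i) = x 0 i) ->
    f x = q (\sum_i a i *: v i).
  move=> ax; rewrite (lin_sum qL); apply: eq_bigr => i _; apply: q_eq.
  by rewrite residueK ax.
have fB : zmod_morphism f.
  move=> x y; rewrite (fE (x - y) (fun i => repr (x 0 i) - repr (y 0 i))).
    rewrite (lin_sum qL) -sumrB; apply: eq_bigr => i _.
    by rewrite scalerBl (linB qL).
  by move=> i; rewrite raddfB /= !residueK !mxE.
pose F := HB.pack_for {additive 'rV[residue m]_d -> quotmod S} f
  (GRing.isZmodMorphism.Build _ _ f fB).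
exists F; split; last first.
  move=> a x; rewrite /= (fE _ (fun i => a * repr (x 0 i))).
    rewrite (lin_sum qL) /f scaler_sumr; apply: eq_bigr => i _.
    by rewrite -scalerA (linZ qL).
  by move=> i; rewrite rmorphM /= residueK !mxE.
have f_inj x : f x = 0 -> x = 0.
  rewrite (fE x (fun i => repr (x 0 i))) => [/qker/vind vm|i]; last exact: residueK.
  by apply/rowP => i; rewrite mxE -[x 0 i]residueK; apply/to_residue_eq0; exact: vm.
have f_surj y : exists x, f x = y.
  have [x <-] := qsurj y; have [a xa] := vspan x I.
  exists (\row_i to_residue m (a i)); rewrite (fE _ a) => [|i]; last by rewrite mxE.
  by apply/esym/eqP; rewrite -subr_eq0 -(linB qL); apply/eqP/qker.
have [g gE] := choice f_surj.
exists g => [x|y]; last exact: gE.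
by apply/eqP; rewrite -subr_eq0; apply/eqP/f_inj; rewrite fB gE subrr.
Qed.

Lemma has_rank_cohomology (V W : lmodType R) (P : projective_resolution V) n d :
  (forall a (f : res_cpx P n.+1 -> W), a \in m -> cocyc f ->
     cobound (a *: f : res_cpx P n.+1 -> W)) ->
  hdim mP (res_cpx P) W n d -> has_rank m d (cohomology P W n).
Proof.
move=> killed [v [vZ vspan] vind].
pose val (z : cocycles P W n) : res_cpx P n.+1 -> W := hom_fun (submod_val z).
have valL : linear val by [].
have valZ z : cocyc (val z).
  case: z => -[f /= fL] fZ; split; first exact: (asboolW fL).
  by move=> y; have := asboolW fZ; apply.
have val_surj f : cocyc f -> exists z, val z = f.
  move=> [fL f0].
  have fL' : (f : P n -> W) \in @hom_pred R (P n) W by apply/asboolP.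
  have fZ : (Submod fL' : Defs.Hom (P n) W) \in @cocycle_pred R V P W n by apply/asboolP.
  by exists (Submod fZ).
have valB z : z \in @coboundary_pred R V P W n <-> cobound (val z).
  rewrite -topredE /coboundary_pred /val; case: (n) z => [|k] z /=.
    split=> [/eqP -> //|z0]; apply/eqP/val_inj/val_inj/funext => x; exact: z0.
  split=> [/asboolP[h hE]|[h hL hE]].
    by exists (hom_fun h) => //; exact: (asboolW (valP h)).
  have hL' : (h : P k -> W) \in @hom_pred R (P k) W by apply/asboolP.
  by apply/asboolP; exists (Submod hL').
apply: has_rank_quotmod => [a z ma|].
  by apply/valB; rewrite (linZ valL); exact: killed.
have /choice[u uE] := fun i => val_surj _ (vZ i).
exists u; first split=> // z _.
  have [a aB] := vspan _ (valZ z); exists a; apply/valB.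
  rewrite (linB valL) (lin_sum valL).
  by under eq_bigr do rewrite (linZ valL) uE.
move=> a /valB; rewrite (lin_sum valL) => aB; apply: vind.
by under eq_bigr do rewrite -uE -(linZ valL).
Qed.

End Ranks.

(** [V] is a vector space over [R / m], and the [i a] and [p a] are the injections and
    projections attached to a basis. *)
Lemma power_maps (R : comNzRingType) (m : R -> Prop) (V W : lmodType R) s :
  residue_module m W -> (forall a (v : V), m a -> a *: v = 0) ->
  qdim m (fun _ : V => True) (fun v => v = 0) s ->
  exists (i : 'I_s -> W -> V) (p : 'I_s -> V -> W),
    [/\ (forall a, linear (i a)) /\ (forall a, linear (p a)),
        forall a w, p a (i a w) = w, forall a c w, a != c -> p a (i c w) = 0 &
        forall v, v = \sum_a i a (p a v)].
Proof.
move=> [w [wspan wann]] mV [v [_ vspan] vind].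
have mW a : m a -> a *: w = 0 by move/wann.
have [c cE] := choice wspan.
have /choice[d dE] : forall y, exists a : 'I_s -> R, y = \sum_j a j *: v j.
  by move=> y; have [a /eqP] := vspan y I; rewrite subr_eq0 => /eqP; exists a.
have c_eq a b y : a *: w = b *: w -> a *: y = b *: y :> V.
  move=> ab; apply/eqP; rewrite -subr_eq0 -scalerBl; apply/eqP/mV/wann.
  by rewrite scalerBl ab subrr.
have d_eq (a b : 'I_s -> R) : \sum_j a j *: v j = \sum_j b j *: v j ->
    forall j, a j *: w = b j *: w.
  move=> ab j; apply/eqP; rewrite -subr_eq0 -scalerBl; apply/eqP/mW.
  apply: (vind (fun j => a j - b j)).
  by under eq_bigr do rewrite scalerBl; rewrite sumrB ab subrr.
exists (fun j x => c x *: v j), (fun j y => d y j *: w); split.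
- split=> j k x y; rewrite scalerA -scalerDl.
    by apply: c_eq; rewrite -cE scalerDl -scalerA -!cE.
  apply: (d_eq _ (fun j => k * d x j + d y j)); rewrite -dE.
  under eq_bigr do rewrite scalerDl -scalerA.
  by rewrite big_split -scaler_sumr -!dE.
- move=> a x; rewrite [in RHS](cE x).
  rewrite (d_eq _ (fun j => (j == a)%:R * c x)) ?eqxx ?mul1r // -dE (bigD1 a) //=.
  rewrite eqxx mul1r big1 ?addr0 // => j /negPf ->; by rewrite mul0r scale0r.
- move=> a b x ab; rewrite (d_eq _ (fun j => (j == b)%:R * c x)).
    by rewrite (negPf ab) mul0r scale0r.
  rewrite -dE (bigD1 b) //= eqxx mul1r big1 ?addr0 // => j /negPf ->.
  by rewrite mul0r scale0r.
- move=> y; rewrite [LHS]dE; apply: eq_bigr => j _; apply: c_eq; exact: cE.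
Qed.

(** * Bass numbers of modules of finite projective dimension *)

Section Syzygies.
Context {R : comNzRingType} {m : R -> Prop} (mL : localP m).
Context (X : cpx R) (projX : projC X) (acX : acyclic X) (nullX : @null_mod R m X).
Context (mX0 : forall a (x : X 0%N), m a -> a *: x = 0).
Context {V : lmodType R} (F : free_res m V).
Local Notation b := (fr_rank F).
Local Notation D := (fr_mx F).

Definition syz j : lmodType R :=
  if j is j'.+1 then im_mod (bundle (linear_mulmx (D j'))) else V.

Definition syz_cover j : 'rV[R]_(b j) -> syz j :=
  match j with 0 => fr_aug F | j'.+1 => to_im (bundle (linear_mulmx (D j'))) end.

Definition syz_val j (z : syz j.+1) : 'rV[R]_(b j) := submod_val z.

Lemma syz_cover_linear j : linear (@syz_cover j).
Proof. by case: j => [|j]; [exact: fr_aug_linear|exact: linear_to_im]. Qed.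

Lemma syz_cover_surj j z : exists x, @syz_cover j x = z.
Proof.
case: j z => [|j] z; first exact: fr_surj.
case: z => z zim; have /im_predP[x xz] := zim.
by exists x; apply/val_inj.
Qed.

Lemma syz_val_inj j (z : syz j.+1) : syz_val z = 0 -> z = 0.
Proof. by move=> z0; apply/val_inj. Qed.

Lemma syz_val_span j (z : syz j.+1) : row_span (D j) (syz_val z).
Proof. by case: z => z zim; have /im_predP[x xz] := zim; exists x. Qed.

Lemma syz_exact j x : @syz_cover j x = 0 <-> exists z, @syz_val j z = x.
Proof.
have -> : (exists z, @syz_val j z = x) <-> row_span (D j) x.
  split=> [[z <-]|[y yx]]; first exact: syz_val_span.
  by exists (to_im (bundle (linear_mulmx (D j))) y).
case: j x => [|j] x; first exact: fr_exact0.
rewrite -fr_exact; split=> [/(congr1 (@submod_val _ _ _))//|x0].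
exact: val_inj.
Qed.

Let DK n : D n.+1 *m D n = 0.
Proof.
apply/row_matrixP => i; rewrite row_mul row0.
by apply/(@fr_exact _ _ _ F n); exists (delta_mx 0 i); rewrite -rowE.
Qed.

Context {p : nat} (bp : forall j, (p < j)%N -> b j = 0%N).

(** A cocycle with values in the image of [D j] lifts to a map into [F j.+1], which
    comes from cocycles with values in [R] modulo the image of [D j.+1]; then
    [rep_step] applies. *)
Lemma syz_val_zero j n (f : X n.+1 -> syz j.+1) :
  cocyc f -> cobound (fun x => syz_val (f x)).
Proof.
move=> [fL f0].
have vfL : linear (fun x => syz_val (f x)) by move=> a x y; rewrite fL.
have [g gL gE] := projective_lift (@projX n) (linear_mulmx (D j)) vfL
  (fun x => syz_val_span (f x)).
have [|r rR rE] := rep_exists mL projX acX mX0 DK (@fr_min _ _ _ F) bp (@fr_exact _ _ _ F) gL.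
  by move=> x; apply/fr_exact; rewrite gE f0.
have [h [hR h0 hE]] := rep_step mL projX mX0 DK (@fr_min _ _ _ F) rR.
have fE x : syz_val (f x) = h (cdiff X n x).
  rewrite -gE -hE; apply/eqP; rewrite -subr_eq0 -mulmxBl; apply/eqP.
  exact/fr_exact.
case: n f fL f0 vfL g gL gE r rR rE h hR h0 hE fE => [|n] f fL f0 vfL g gL gE r rR rE h hR h0 hE fE.
  by move=> x; rewrite fE h0.
by exists h => //; exact: rep_linear hR.
Qed.

(** A cocycle with values in [V] lifts to a map into [F 0], which comes from cocycles
    with values in [R] modulo the kernel of [F 0 -> V]; then [rep_null] applies. *)
Lemma aug_cocyc_zero (m_neq0 : exists2 a, m a & a <> 0) (U : lmodType R) (q : V -> U) :
  linear q -> (forall a u, m a -> a *: u = 0 :> U) ->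
  forall n (f : X n.+1 -> V), cocyc f -> cobound (fun x => q (f x)).
Proof.
move=> qL mU n f [fL f0].
have [g gL gE] := projective_lift (@projX n) (@fr_aug_linear _ _ _ F) fL
  (fun x => fr_surj F (f x)).
have [|r rR rE] := rep_exists mL projX acX mX0 DK (@fr_min _ _ _ F) bp (@fr_exact _ _ _ F) gL.
  by move=> x; apply/fr_exact0; rewrite gE f0.
have := rep_null mL nullX mX0 m_neq0 (linear_comp (@fr_aug_linear _ _ _ F) qL) _ rR.
have {}rE x : f x = fr_aug F (r x).
  rewrite -gE; apply/eqP; rewrite -subr_eq0 -(linB (@fr_aug_linear _ _ _ F)); apply/eqP.
  exact/fr_exact0.
move=> rB; apply: (cobound_ext (f := fun x => q (fr_aug F (r x)))); first by move=> x; rewrite rE.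
by apply: rB => a v ma; exact: mU.
Qed.

Context {mu : nat -> nat} (hmu : forall n, hdim m X R^o n (mu n)).

Lemma hdim_free j n : hdim m X 'rV[R]_(b j) n (b j * mu n).
Proof.
apply: (@hdim_power _ _ mL X R^o 'rV[R]_(b j) (b j)
  (fun a t => t *: delta_mx 0 a) (fun a x => x 0 a)) => //.
- by move=> a; exact: (@linear_scaler R R^o _ id _ (@linear_id _ R^o)).
- by move=> a; exact: linear_entry.
- by move=> a w; rewrite !mxE !eqxx mulr1.
- by move=> a c w ac; rewrite !mxE (negPf ac) mulr0.
- by move=> v; exact: row_sum_delta.
- by move=> a f; exact: cocyc_killed.
Qed.

(** The sum is long enough when [syz (j + k)] is zero. *)
Lemma hdim_syz k j n : (p < j + k)%N ->
  hdim m X (syz j) n (\sum_(i < k) b (j + i) * mu (n + i))%N.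
Proof.
elim: k j n => [|k IHk] j n jk.
  rewrite big_ord0; rewrite addn0 in jk; case: j jk => // j jk.
  have z0 (z : syz j.+1) : z = 0.
    apply: syz_val_inj; have [x <-] := syz_val_span z.
    rewrite (_ : x = 0) ?mul0mx //; apply/rowP => i.
    by have := ltn_ord i; rewrite {2}(bp jk).
  exists (fun=> 0) => [|a _ []//]; split=> [[]//|f _]; exists (fun=> 0).
  rewrite big_ord0 subr0 (_ : f = 0); first exact: (sub0 (@cobound_submod _ X _ n)).
  by apply/funext => x; exact: z0.
rewrite big_ord_recl !addn0.
under eq_bigr do rewrite /= /bump add1n -!addSnnS.
apply: (hdim_zero_left mL projX acX mX0 (@linear_submod _ _ (im_pred _))
  (@syz_cover_linear j) (@syz_val_inj j) (@syz_cover_surj j) (@syz_exact j)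
  (@syz_val_zero j)).
  exact: hdim_free.
by apply: IHk; rewrite addSnnS.
Qed.

(** [Hom (k, syz t.+1)] embeds into [Hom (k, F t)] by a map that is zero, so the sum
    that [hdim_syz] gives for its dimension is zero. *)
Lemma mu_low t i : (i + t.+1 <= p)%N -> (b (t.+1 + i) * mu i = 0)%N.
Proof.
move=> it.
have d0 : hdim m X (syz t.+1) 0 0.
  apply: (hdim_zero_left0 (@syz_val_inj t) (@syz_val_zero t)).
have d1 := @hdim_syz p t.+1 0 (leq_addl _ _).
have : (\sum_(i < p) b (t.+1 + i) * mu (0 + i) = 0)%N.
  case: (d1); case: (\sum_(i < p) _)%N => [//|r] v [vZ _] vind.
  case: (local_proper mL).
  have [w [_ wspan] _] := d0; have [a] := wspan _ (vZ ord0).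
  rewrite big_ord0 subr0 => vB.
  have := vind (fun j => (j == ord0)%:R) _ ord0; rewrite eqxx; apply.
  by rewrite (bigD1 ord0) //= scale1r big1 ?addr0 // => j /negPf ->; rewrite scale0r.
have ip : (i < p)%N by rewrite (leq_trans _ it) // addnS ltnS leq_addr.
move/eqP; rewrite sum_nat_eq0 => /forallP/(_ (Ordinal ip))/eqP.
by rewrite add0n.
Qed.

End Syzygies.

Section ExtRanks.
Context {R : comNzRingType} {m : idealr R}.
Local Notation mP := (fun x => x \in m).
Context (mL : localP mP) (noeth : noethP R).

Lemma std_comparison (V : lmodType R) (F : free_res mP V) :
  exists f g s t, @equivalence R (res_cpx (std_resolution V)) (fr_cpx F) f g s t.
Proof.
apply: (@comparison R (res_cpx (std_resolution V)) (fr_cpx F) id id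
  (@res_proj _ _ _) (@res_acyclic _ _ _) (@fr_proj _ _ _ F) (@fr_acyclic _ _ _ F)
  (@linear_id _ _) (@linear_id _ _) (fun=> erefl) (fun=> erefl)) => v.
  exact: fr_surj.
exact: (res_aug_surj (std_resolution V)).
Qed.

Lemma residue_killed a (x : residue m) : a \in m -> a *: x = 0.
Proof. exact: (residue_module_killed residue_module_residue). Qed.

Lemma bass_eq n (V : lmodType R) d :
  hdim mP (res_cpx (std_resolution (residue m))) V n d ->
  bass m (Posz n) V = (Posz d)%:E.
Proof.
move=> Vd; apply: rank_eq; apply: has_rank_cohomology Vd => a f ma.
apply: (cocyc_killed (m := mP)) => //; [exact: res_proj|exact: res_acyclic|].
exact: residue_killed.
Qed.

Lemma betti_eq i (V : lmodType R) (F : free_res mP V) :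
  betti m (Posz i) V = (Posz (fr_rank F i))%:E.
Proof.
have [f [g [s [t E]]]] := std_comparison F.
have [w [wspan wann]] := @residue_module_residue R m.
apply: rank_eq; apply: (@has_rank_cohomology _ _ V).
  move=> a h ma _; apply: cobound_ext (sub0 (@cobound_submod _ _ _ i)) => x.
  by rewrite -[RHS]/(a *: h x) residue_killed.
by apply: (hdim_transfer E); exact: (hdim_minimal mL F i wspan wann).
Qed.

Lemma hdim_residue_exists (W : lmodType R) (w : W) : (forall v, exists a, v = a *: w) ->
  forall n, exists r, hdim mP (res_cpx (std_resolution (residue m))) W n r.
Proof.
move=> wspan n.
have kfg : fgen (fun _ : residue m => True).
  have [v [vspan _]] := @residue_module_residue R m.
  exists 1%N, (fun=> v); split=> // u _.
  by have [a ->] := vspan u; exists (fun=> a); rewrite big_ord1 subrr.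
have [F _] := free_res_exists mL noeth kfg.
have [f [g [s [t E]]]] := std_comparison F.
have [r dr] := hdim_exists mL noeth F n wspan.
by exists r; exact: hdim_transfer E dr.
Qed.

End ExtRanks.

Theorem corollary3p2 (R : comNzRingType) (m : idealr R)
    (N : lmodType R) (M : submodClosed N) (s : \bar int) (p : nat) :
  singular_local m ->
  (forall x : N, ideal_mul m x -> x \in M) ->
  s = rank m (quotmod M) ->
  finite_module N ->
  has_pd N p ->
  forall n : int,
    bass m n (submod M) =
      (\sum_(i < p.+1) bass m (n + i%:Z)%R R^o * betti m i%:Z N
       + s * betti m (n - 1)%R (residue m))%E.
Proof.
move=> sing mN sE Nfin [pdN _] n.
have [nsplit m_neq0] := singular_not_split sing.
have noeth : noethP R by case: sing => -[/noetherian_noethP].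
pose mP : R -> Prop := fun x => x \in m.
have mL : localP mP by case: sing => /local_ring_localP.
pose X := res_cpx (std_resolution (residue m)).
have projX : projC X by exact: res_proj.
have acX : acyclic X by exact: res_acyclic.
have mX0 a (x : X 0%N) : mP a -> a *: x = 0 by exact: residue_killed.
have kres : residue_module mP (residue m) := residue_module_residue.
have nullX : @null_mod R mP X.
  apply: contrapT => nX; apply: nsplit; exists X; split=> //.
  exact: (res_aug_surj (std_resolution (residue m))).
have Nfg := finite_module_fgen Nfin.
have [F _] := free_res_exists mL noeth Nfg.
have bp := pd_rank mL F pdN.
have /choice[mu muE] : forall j, exists r, hdim mP X R^o j r.
  by apply: (hdim_residue_exists mL noeth (w := 1 : R^o)) => v; exists v; rewrite -[LHS]mulr1.
have /choice[beta betaE] : forall j, exists r, hdim mP X (residue m) j r.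
  have [w [wspan _]] := kres; exact: (hdim_residue_exists mL noeth wspan).
have mM a (x : N) : mP a -> a *: x \in M.
  move=> ma; apply: mN; exists 1%N, (fun=> a), (fun=> x).
  by split=> //; rewrite big_ord1.
have MP : submodP (fun x : N => x \in M).
  by split=> [|a x y xM yM]; [exact: rpred0|rewrite rpredD // rpredZ].
have [s0 dM] : exists s0, qdim mP (fun _ : N => True) (fun x => x \in M) s0.
  have [l [g [_ gspan]]] := Nfg.
  apply: (gen_mod_qdim mL (g := g)) => //; split=> // x _.
  by have [a xa] := gspan x I; exists a; rewrite xa; exact: rpred0.
have sE0 : s = (Posz s0)%:E by rewrite sE; apply: rank_eq; exact: has_rank_quotmod.
have [q [qL qsurj qker]] := quotmod_proj M.
have mQ a (y : quotmod M) : mP a -> a *: y = 0.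
  by move=> ma; have [x <-] := qsurj y; rewrite -(linZ qL); apply/qker/mM.
have dQ : qdim mP (fun _ : quotmod M => True) (fun y => y = 0) s0.
  have [v [_ vspan] vind] := dM; exists (fun i => q (v i)).
    split=> // y _; have [x <-] := qsurj y; have [a xa] := vspan x I; exists a.
    have -> : \sum_i a i *: q (v i) = q (\sum_i a i *: v i).
      by rewrite (lin_sum qL); apply: eq_bigr => i _; rewrite (linZ qL).
    by rewrite -(linB qL); apply/qker.
  move=> a aq; apply: vind; apply/qker; rewrite (lin_sum qL).
  by under eq_bigr do rewrite (linZ qL).
have [i_ [p_ [[iL pL] pi_id pi_0 ip_id]]] := power_maps kres mQ dQ.
have hQ j : hdim mP X (quotmod M) j (s0 * beta j).
  apply: (hdim_power mL iL pL pi_id pi_0 ip_id _ (betaE j)) => a f.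
  exact: (cocyc_killed projX acX mX0).
have hN j : hdim mP X N j (\sum_(i < p.+1) fr_rank F i * mu (j + i))%N.
  exact: (hdim_syz mL projX acX mX0 bp muE (k := p.+1) (j := 0%N) j (ltnSn p)).
have q_zero := aug_cocyc_zero mL projX acX nullX mX0 bp m_neq0 qL mQ.
have ex_iq x : q x = 0 <-> exists y : submod M, submod_val y = x.
  rewrite qker; split=> [xM|[y <-]]; first by exists (Submod xM).
  exact: (valP y).
have val_inj0 (y : submod M) : submod_val y = 0 -> y = 0 by move=> y0; apply/val_inj.
have hM0 : hdim mP X (submod M) 0 (\sum_(i < p.+1) fr_rank F i * mu (0 + i))%N.
  exact: (hdim_zero_right0 mL projX acX mX0 (@linear_submod _ _ M) val_inj0 ex_iq q_zero (hN 0%N)).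
have hM j : hdim mP X (submod M) j.+1
    (s0 * beta j + \sum_(i < p.+1) fr_rank F i * mu (j.+1 + i))%N.
  exact: (hdim_zero_right mL projX acX mX0 (@linear_submod _ _ M) qL val_inj0 qsurj ex_iq
    q_zero (hQ j) (hN j.+1)).
have bettiE (i : nat) : betti m i%:Z N = (Posz (fr_rank F i))%:E by exact: betti_eq.
have sum_bass j : (\sum_(i < p.+1) bass m (Posz j + i%:Z)%R R^o * betti m i%:Z N)%E =
    (Posz (\sum_(i < p.+1) fr_rank F i * mu (j + i)))%:E.
  rewrite (big_morph Posz PoszD (erefl (Posz 0))) -sumEFin; apply: eq_bigr => i _.
  by rewrite bettiE -PoszD (bass_eq (muE _)) -EFinM -PoszM mulnC.
case: n => [[|j]|t].
- by rewrite sum_bass (bass_eq hM0) mule0 adde0.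
- have -> : (Posz j.+1 - 1 = Posz j)%R by rewrite -addn1 PoszD addrK.
  rewrite sum_bass (bass_eq (hM j)) sE0 [betti _ _ _](bass_eq (betaE j)).
  by rewrite -EFinM -EFinD -PoszM -PoszD addnC.
(* in negative degree every term is zero, either by definition or by mu_low *)
have -> : (Negz t - 1 = Negz t.+1)%R by rewrite !NegzE -opprD -PoszD addn1.
rewrite mule0 adde0 big1 // => i _; rewrite bettiE.
have [ti|it] := ltnP t i; last first.
  have -> : (Negz t + i%:Z = Negz (t - i))%R by lia.
  exact: mul0e.
have [k ik] : exists k, i = (t.+1 + k)%N :> nat by exists (i - t.+1)%N; rewrite subnKC.
have -> : (Negz t + i%:Z = Posz k)%R by rewrite NegzE ik PoszD addKr.
rewrite (bass_eq (muE k)) -EFinM -PoszM ik mulnC.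
rewrite (mu_low mL projX acX mX0 bp muE) // addnC -ik -ltnS; exact: ltn_ord.
Qed.
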